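(* Let $f$ satisfy (f1) and (f2) described in the context, with associated $B,g,v,\tilde u,R_1,R_2$, and assume $$\lim_{x\to 0}(-\log|x|)^{1/2}\,[R_1(x)+R_2(x)]=0 .$$ Assume further that $f\in C^1([0,\infty))$ and that $f(s)>0$, $F(s)<\infty$, $f'(s)>0$ for all $s>0$. Then there exist $R>0$ and $u_\infty\in C^2(B_R\setminus\{0\})$ such that $$u_\infty(x)=\tilde u(x)+O\Big(f(\tilde u(x))\,F(\tilde u(x))\,\sup_{|y|\le|x|}\big(R_1(y)+R_2(y)\big)\Big)\qquad\text{as } |x|\to 0$$ and $$-\Delta u_\infty=f(u_\infty)\ \text{ in } B_R\setminus\{0\},\qquad u_\infty=0\ \text{ on }\partial B_R,$$ in the classical sense. Furthermore, $u_\infty$ satisfies $-\Delta u_\infty=f(u_\infty)$ in $B_R$ in the sense of distributions.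
   Context: The space dimension is $N=2$; $B_R=\{x\in\mathbb{R}^2:|x|<R\}$. (f1): $f\in C^2((s_0,\infty))$ for some $s_0>0$, and for all $s>s_0$: $f(s)>0$, $f'(s)>0$ and $F(s):=\int_s^\infty \frac{d\tau}{f(\tau)}<\infty$. For large $s$ define $B_1[f](s)$ and $B_2[f](s)$ through their reciprocals: $$\frac1{B_1[f](s)}:=(-\log F(s))\,[1-f'(s)F(s)],\qquad \frac1{B_2[f](s)}:=f'(s)F(s)\,(-\log F(s))^2\Big[\frac{f(s)f''(s)F(s)}{f'(s)}-1\Big].$$ $B_1[g],B_2[g]$ are defined in the same way with $f,F$ replaced by $g,G$. (f2): the limits $\lim_{s\to\infty}f'(s)F(s)$ and $\lim_{s\to\infty}B_2[f](s)$ exist, $\lim_{s\to\infty}f'(s)F(s)=1$, and $B:=\lim_{s\to\infty}B_2[f](s)\in[1,\infty)$. Model nonlinearity and model solution: if $B>1$, let $B'$ be the Hölder conjugate ($1/B+1/B'=1$) and $$v(x)=\Big(\log\frac1{|x|^2}\Big)^{1/B'},\quad g(s)=\frac{4}{BB'}s^{1-2B'}e^{s^{B'}},\quad G(s)=\int_s^\infty\frac{d\tau}{g(\tau)}=\frac B4\,\frac{s^{B'}+1}{e^{s^{B'}}};$$ if $B=1$, $$v(x)=\log\log\frac1{|x|^2},\quad g(s)=4\frac{e^{e^s}}{e^{2s}},\quad G(s)=\int_s^\infty\frac{d\tau}{g(\tau)}=\frac14\,\frac{e^s+1}{e^{e^s}}.$$ For $x\ne0$ close to $0$, $\tilde u(x):=F^{-1}[G(v(x))]$,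 and $$R_i(x):=\Big|\frac1{B_i[f](\tilde u(x))}-\frac1{B_i[g](v(x))}\Big|,\qquad i=1,2.$$ *)

(* Defs.v *)
From HB Require Import structures.
From mathcomp Require Import all_boot all_order all_algebra.
From mathcomp Require Import all_classical all_reals all_analysis.

Set Implicit Arguments.
Unset Strict Implicit.
Unset Printing Implicit Defensive.

Import Order.TTheory GRing.Theory Num.Theory.
Import numFieldNormedType.Exports.

Local Open Scope classical_set_scope.
Local Open Scope ring_scope.

Section OneVariable.
Variable R : realType.
Implicit Types (f : R -> R) (s : R).

Definition tailint f s : \bar R :=
  (\int[lebesgue_measure]_(t in `[s, +oo[) ((f t)^-1)%:E)%E.

Definition Fint f s : R := fine (tailint f s).

(* The branch of the inverse of [Fint f] with values in ]0, +oo[. *)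
Definition Finv f : R -> R := 'pinv_(fun=> 0) `]0, +oo[ (Fint f).

(* Defined through their reciprocals: as 0^-1 = 0, (B1 f s)^-1 and (B2 f s)^-1
   are the expressions below even where these vanish. *)
Definition B1 f s : R :=
  (- ln (Fint f s) * (1 - derive1 f s * Fint f s))^-1.

Definition B2 f s : R :=
  (derive1 f s * Fint f s * (- ln (Fint f s)) ^+ 2 *
    (f s * derive1n 2 f s * Fint f s / derive1 f s - 1))^-1.

Definition C2_above s0 f : Prop := forall s, s0 < s ->
  [/\ derivable f s 1, derivable (derive1 f) s 1 &
      {for s, continuous (derive1n 2 f)}].

(* Differentiability is relative to [0, +oo[, hence one-sided at 0; the values
   of f on the negative half-line are irrelevant. *)
Definition C1_ge0 f : Prop := exists2 df : R -> R,
  {within `[0, +oo[, continuous df} &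
  forall s, 0 <= s ->
    (f t - f s) / (t - s) @[t --> within `[0, +oo[ s^'] --> df s.

Definition hyp_f1 f : Prop := exists s0 : R,
  [/\ 0 < s0, C2_above s0 f &
      forall s, s0 < s -> [/\ 0 < f s, 0 < derive1 f s & (tailint f s < +oo)%E]].

Definition hyp_f2 f (B : R) : Prop :=
  [/\ derive1 f s * Fint f s @[s --> +oo] --> (1 : R),
      B2 f s @[s --> +oo] --> B & 1 <= B].

(* The Hoelder conjugate B' = B / (B - 1); only used for 1 < B. *)
Definition hconj (B : R) : R := fine (hoelder_conjugate B%:E).

Definition model_g (B s : R) : R :=
  if B == 1 then 4 * (expR (expR s) / expR (2 * s))
  else let B' := hconj B in
       4 / (B * B') * s `^ (1 - 2 * B') * expR (s `^ B').

End OneVariable.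

Section Plane.
Variable R : realType.
Local Notation plane := (R * R)%type.
Implicit Types (u phi : plane -> R) (x : plane) (W : set plane).

Definition enorm x : R := Num.sqrt (x.1 ^+ 2 + x.2 ^+ 2).

Definition disk (r : R) : set plane := [set x | enorm x < r].

Definition punctured_disk (r : R) : set plane := [set x | 0 < enorm x < r].

Definition d1 u : plane -> R := fun x => 'D_((1, 0) : plane) u x.
Definition d2 u : plane -> R := fun x => 'D_((0, 1) : plane) u x.

(* For W open: all partial derivatives up to order n exist and are continuous
   on W. *)
Fixpoint Cn (n : nat) W u : Prop :=
  (forall x, W x -> {for x, continuous u}) /\
  if n is m.+1 then
    [/\ forall x, W x -> derivable u x (1, 0) /\ derivable u x (0, 1),
        Cn m W (d1 u) & Cn m W (d2 u)]
  else True.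

Definition laplacian u x : R := d1 (d1 u) x + d2 (d2 u) x.

Definition lebesgue2 := (@lebesgue_measure R \x @lebesgue_measure R)%E.

Definition L1loc W u : Prop := forall K : set plane,
  compact K -> K `<=` W -> lebesgue2.-integrable K (EFin \o u).

Definition test_function W phi : Prop :=
  [/\ forall n, Cn n setT phi,
      compact (closure [set x | phi x != 0]) &
      closure [set x | phi x != 0] `<=` W].

Definition distributional_solution (f : R -> R) W u : Prop :=
  [/\ L1loc W u, L1loc W (f \o u) &
      forall phi, test_function W phi ->
        (- (\int[lebesgue2]_(x in W) (u x * laplacian phi x)%:E) =
         \int[lebesgue2]_(x in W) (f (u x) * phi x)%:E)%E].

(* The boundary condition is attained continuously.  The nonlinearity is only
   given on [0, +oo[, so u must be nonnegative for f (u x) to make sense. *)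
Definition classical_dirichlet_solution (f : R -> R) (r : R) u : Prop :=
  [/\ Cn 2 (punctured_disk r) u,
      forall x, punctured_disk r x -> 0 <= u x /\ - laplacian u x = f (u x),
      {within [set x | 0 < enorm x <= r], continuous u} &
      forall x, enorm x = r -> u x = 0].

Definition model_v (B : R) x : R :=
  if B == 1 then ln (ln (enorm x ^+ 2)^-1)
  else (ln (enorm x ^+ 2)^-1) `^ (hconj B)^-1.

(* Meaningful for x != 0 close to 0, as are Rem1, Rem2 and Remsup. *)
Definition utilde (f : R -> R) (B : R) x : R :=
  Finv f (Fint (model_g B) (model_v B x)).

Definition Rem1 (f : R -> R) (B : R) x : R :=
  `| (B1 f (utilde f B x))^-1 - (B1 (model_g B) (model_v B x))^-1 |.

Definition Rem2 (f : R -> R) (B : R) x : R :=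
  `| (B2 f (utilde f B x))^-1 - (B2 (model_g B) (model_v B x))^-1 |.

Definition Remsup (f : R -> R) (B : R) x : R :=
  sup [set Rem1 f B y + Rem2 f B y | y in [set y | 0 < enorm y <= enorm x]].

End Plane.

(* Main.v *)
Require Import Defs.
From HB Require Import structures.
From mathcomp Require Import all_boot all_order all_algebra.
From mathcomp Require Import all_classical all_reals all_analysis.
From mathcomp Require Import ring lra.
From mathcomp Require Import measurable_realfun.

(* In the variable s = log(1/|x|^2) the radial equation is
   4 U'' + e^{-s} f(U) = 0.  The solution is sought as a reparametrisation of
   ut(s) = F^{-1}(G(v)): U(s - mu(s)) = ut(s) and U'(s - mu(s)) = ut'(s) e^{del(s)}.
   This turns the equation into
     mu' = 1 - e^{-del},   B s del' = A(s) - e^{mu - 2 del},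
   where A is identically 1 for the model nonlinearity and in general
   |A - 1| and s |A'| are bounded by C sup_{t >= s} (R_1 + R_2)(t).  For
   lam = mu - log A the energy lam^2 + B s del^2 - lam del increases along the
   flow while it is small compared with 1/s and large compared with
   (sup (R_1 + R_2))^2, so the solutions started from lam = del = 0 at s = n and
   followed backwards satisfy |mu| = O(sup (R_1 + R_2)) uniformly in n; a limit
   n -> oo gives U near s = +oo, and concavity of U makes its continuation to
   the left hit 0.
     For the distributional equation, u is replaced by U(-log(|x|^2 + eps)),
   whose negative laplacian is a nonnegative density converging to f(u) plus a
   nonnegative density that vanishes in the limit away from the origin.  The
   total mass of both in a small square is its flux, at most 16 times the
   supremum of U' over the square, which tends to 0 with the size of the square. *)

Import Order.TTheory GRing.Theory Num.Theory.
Import numFieldNormedType.Exports.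

Local Open Scope classical_set_scope.
Local Open Scope ring_scope.
Set Implicit Arguments.
Unset Strict Implicit.
Unset Printing Implicit Defensive.

(** * Calculus and a barrier argument *)

(** The linearisation at mu = del = 0 is lam' = del, B s del' = -(lam - 2 del). In the unknowns lam
    and del / k, with k = (B s)^(-1/2), it is a rotation of speed k whose amplitude grows only at a
    rate of order k^2. It is stable backwards, hence the solutions started at s = n and followed to
    the left. The natural energy N^2 = lam^2 + B s del^2 gains only in del; the term - lam del is
    there to add a gain in lam. The quadratic remainders of the exponentials cost up to k N^3
    against a gain of k^2 N^2, so N must stay small compared with k: this is the origin of the
    weight (-log|x|)^(1/2) in the hypothesis. R_1 and R_2 enter through 1 - f'(ut) G. As F(ut) = G,
    this is 1/B_1 divided by -log G, and its derivative in s is a multiple of 1/B_2. Subtracting the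
    same identities for the model leaves R_1 in A - 1, and both remainders in A'. Shifting the
    argument of ut, instead of adding a correction to ut, keeps f(ut) exact in the equation, so that
    f is never expanded. *)

Section Continuity.
Variables (R : realType) (T : topologicalType).
Implicit Types (f g : T -> R) (x : T).

(** Restatements with the operations on functions written pointwise, so that they unify with goals
    about explicit expressions; the derivative rules ending in [l] below serve the same purpose. *)
Lemma cont_cst (c : R) x : {for x, continuous (fun _ : T => c)}.
Proof. exact: cst_continuous. Qed.

Lemma cont_add f g x : {for x, continuous f} -> {for x, continuous g} ->
  {for x, continuous (fun t => f t + g t)}.
Proof. exact: continuousD. Qed.

Lemma cont_opp f x : {for x, continuous f} -> {for x, continuous (fun t => - f t)}.
Proof. exact: continuousN. Qed.

Lemma cont_sub f g x : {for x, continuous f} -> {for x, continuous g} ->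
  {for x, continuous (fun t => f t - g t)}.
Proof. exact: continuousB. Qed.

Lemma cont_mul f g x : {for x, continuous f} -> {for x, continuous g} ->
  {for x, continuous (fun t => f t * g t)}.
Proof. exact: continuousM. Qed.

Lemma cont_inv f x : f x != 0 -> {for x, continuous f} ->
  {for x, continuous (fun t => (f t)^-1)}.
Proof. exact: continuousV. Qed.

Lemma cont_comp (h : R -> R) f x : {for x, continuous f} ->
  {for f x, continuous h} -> {for x, continuous (fun t => h (f t))}.
Proof. exact: continuous_comp. Qed.

End Continuity.

Section Derivatives.
Variables (R : realType) (V : normedModType R).
Implicit Types (f g : V -> R) (x v : V) (a b k : R).

Lemma is_derive_Dl f g x v a b : is_derive x v f a -> is_derive x v g b ->
  is_derive x v (fun t => f t + g t) (a + b).
Proof. exact: is_deriveD. Qed.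

Lemma is_derive_Bl f g x v a b : is_derive x v f a -> is_derive x v g b ->
  is_derive x v (fun t => f t - g t) (a - b).
Proof. exact: is_deriveB. Qed.

Lemma is_derive_Nl f x v a : is_derive x v f a ->
  is_derive x v (fun t => - f t) (- a).
Proof. exact: is_deriveN. Qed.

Lemma is_derive_cstl k x v : is_derive x v (fun=> k) 0.
Proof. exact: is_derive_cst. Qed.

Lemma is_derive_Ml f g x v a b : is_derive x v f a -> is_derive x v g b ->
  is_derive x v (fun t => f t * g t) (a * g x + f x * b).
Proof.
move=> df dg; apply: (@is_derive_eq _ _ _ _ _ _ _ _ (is_deriveM df dg)).
by rewrite addrC mulrC.
Qed.

(** A directional derivative only sees the restriction of [f] to the line through [x] along [v], so
    the one-variable chain rule suffices and [f] need not be differentiable as a function on [V]. *)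
Lemma is_derive_compl (h : R -> R) f x v a b :
  is_derive x v f a -> is_derive (f x) 1 h b ->
  is_derive x v (fun t => h (f t)) (b * a).
Proof.
move=> [df fa] dh; pose F (s : R) := f (s *: v + x).
have shE (k : V -> R) : (fun s : R => s^-1 *: (((fun r => k (r *: v + x)) \o
    shift 0) (s *: 1) - k (0 *: v + x))) =
    (fun s => s^-1 *: ((k \o shift x) (s *: v) - k x)).
  apply/funext => s /=.
  by rewrite addr0 scale0r add0r -[s *: 1]/(s * 1) mulr1.
have F0 : F 0 = f x by rewrite /F scale0r add0r.
have dF : is_derive (0 : R) 1 F a.
  split; first exact: ((derivable1P f x v).1 df).
  by rewrite -fa /derive shE.
rewrite -F0 in dh.
have [dhF hFE] := @is_derive1_comp _ h F 0 _ _ dh dF.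
split; first exact: ((derivable1P (fun t => h (f t)) x v).2 dhF).
by rewrite -hFE /derive -(shE (h \o f)).
Qed.

Lemma is_derive_Vl f x v a : f x != 0 -> is_derive x v f a ->
  is_derive x v (fun t => (f t)^-1) (- a / f x ^+ 2).
Proof.
move=> f0 [df <-]; split; first exact: derivableV.
by rewrite deriveV// -[LHS]/(_ * _) mulNr mulNr mulrC.
Qed.

Lemma is_derive_sqrl f x v a : is_derive x v f a ->
  is_derive x v (fun t => f t ^+ 2) (2 * f x * a).
Proof.
move=> df; rewrite (_ : (fun t => f t ^+ 2) = (fun t => f t * f t)).
  have [dm E] := is_derive_Ml df df.
  by split; rewrite // E; ring.
by apply/funext => t; rewrite expr2.
Qed.

Lemma is_derive_expRl f x v a : is_derive x v f a ->
  is_derive x v (fun t => expR (f t)) (expR (f x) * a).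
Proof. by move=> df; apply: is_derive_compl. Qed.

Lemma is_derive_lnl f x v a : 0 < f x -> is_derive x v f a ->
  is_derive x v (fun t => ln (f t)) ((f x)^-1 * a).
Proof. by move=> f0 df; apply: is_derive_compl => //; exact: is_derive1_ln. Qed.

Lemma is_derive_idl (x : R) : is_derive x 1 (fun t : R => t) 1.
Proof. exact: is_derive_id. Qed.

End Derivatives.

Section RealCalculus.
Variable R : realType.
Implicit Types (f g df : R -> R) (a b c t : R).

Lemma is_derive_cont f t a : is_derive t 1 f a -> {for t, continuous f}.
Proof.
by move=> [df _]; apply/differentiable_continuous; exact/derivable1_diffP.
Qed.

Lemma cont_dist f t c : {for t, continuous f} -> 0 < c ->
  exists2 d, 0 < d & forall u, `|t - u| < d -> `|f t - f u| < c.
Proof.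
move=> ft c0; have /cvgrPdist_lt/(_ _ c0)[d /= d0 H] := ft.
by exists d => // u tu; exact: H.
Qed.

Lemma is_derive_within f df (i : interval R) :
  (forall t, t \in i -> is_derive t 1 f (df t)) -> {within [set` i], continuous f}.
Proof.
move=> df_; apply: derivable_within_continuous => x xi.
by case: (df_ x xi).
Qed.

Lemma is_derive_ge0_le f df a b : a <= b ->
  (forall t, a <= t <= b -> is_derive t 1 f (df t)) ->
  (forall t, a < t < b -> 0 <= df t) -> f a <= f b.
Proof.
move=> ab d d0.
have [->//|ab'] := eqVneq a b; have {}ab' : a < b by rewrite lt_neqAle ab'.
have [c1 c1ab E] : exists2 c, c \in `]a, b[ & f b - f a = df c * (b - a).
  apply: MVT => //.
    by move=> x; rewrite in_itv/= => /andP[? ?]; apply: d; rewrite !ltW.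
  by apply: is_derive_within => x; rewrite in_itv/=; exact: d.
rewrite -subr_ge0 E mulr_ge0 ?subr_ge0//; apply: d0.
by move: c1ab; rewrite in_itv.
Qed.

Lemma is_derive_gt0_lt f df a b : a < b ->
  (forall t, a <= t <= b -> is_derive t 1 f (df t)) ->
  (forall t, a < t < b -> 0 < df t) -> f a < f b.
Proof.
move=> ab d d0.
have [c1 c1ab E] : exists2 c, c \in `]a, b[ & f b - f a = df c * (b - a).
  apply: MVT => //.
    by move=> x; rewrite in_itv/= => /andP[? ?]; apply: d; rewrite !ltW.
  by apply: is_derive_within => x; rewrite in_itv/=; exact: d.
rewrite -subr_gt0 E mulr_gt0 ?subr_gt0//; apply: d0.
by move: c1ab; rewrite in_itv.
Qed.

Lemma is_derive_dist_le f df a b c : a <= b ->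
  (forall t, a <= t <= b -> is_derive t 1 f (df t)) ->
  (forall t, a < t < b -> `|df t| <= c) -> `|f b - f a| <= c * (b - a).
Proof.
move=> ab d dc.
(* Both signs at once: c t - s f(t) is nondecreasing for s = 1 and for s = -1. *)
have H (s : R) : `|s| = 1 -> s * (f b - f a) <= c * (b - a).
  move=> s1.
  suff: c * a - s * f a <= c * b - s * f b by lra.
  apply: (@is_derive_ge0_le (fun t => c * t - s * f t) (fun t => c - s * df t) _ _ ab).
  - move=> t /d dt; apply: (@is_derive_eq _ _ _ _ _ _ _ _ (is_derive_Bl
      (is_derive_Ml (is_derive_cstl c t _) (is_derive_idl t))
      (is_derive_Ml (is_derive_cstl s t _) dt))).
    by lra.
  - move=> t /dc; rewrite subr_ge0; apply: le_trans.
    by rewrite (le_trans (ler_norm _))// normrM s1 mul1r.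
rewrite ler_norml; apply/andP; split.
  by have := H (-1); rewrite normrN1 => /(_ erefl); lra.
by have := H 1; rewrite normr1 => /(_ erefl); lra.
Qed.

Lemma barrier_backward V dV a b c : a <= b -> V b < c ->
  (forall t, a <= t <= b -> is_derive t 1 V (dV t)) ->
  (forall t, a <= t < b -> V t = c -> 0 < dV t) ->
  forall t, a <= t <= b -> V t < c.
Proof.
move=> ab Vb dVV pos t /andP[at_ tb]; rewrite ltNge; apply/negP => cV.
(* V would equal c at the last point of [t, b] where it is at least c. *)
pose S := [set s | t <= s <= b /\ c <= V s].
have St : S t by split=> //; rewrite lexx tb.
have hS : has_sup S.
  by split; [exists t|exists b => s -[/andP[]]].
pose s := sup S.
have ts : t <= s by exact: (ub_le_sup hS.2 St).
have sb : s <= b by apply: ge_sup; [exists t|move=> u [/andP[]]].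
have cts u : t <= u <= b -> {for u, continuous V}.
  move=> /andP[tu ub]; apply: is_derive_cont; apply: dVV.
  by rewrite ub (le_trans at_ tu).
have Vs : c <= V s.
  rewrite leNgt; apply/negP => Vsc.
  have [||e e0 He] := @cont_dist V s (c - V s).
  - by apply: cts; rewrite ts sb.
  - by rewrite subr_gt0.
  have [u [/andP[tu ub] cu] su] := sup_adherent e0 hS.
  have us : u <= s by apply: (ub_le_sup hS.2); split => //; rewrite tu ub.
  have /= := He u; rewrite ger0_norm ?subr_ge0// => H.
  have {}H : `|V s - V u| < c - V s by apply: H; rewrite -/s in su; lra.
  by move: H; rewrite ltr_norml => /andP[]; lra.
have sltb : s < b.
  by rewrite lt_neqAle sb andbT; apply/eqP => E; move: Vb; rewrite -E ltNge Vs.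
have Vlt u : s < u <= b -> V u < c.
  move=> /andP[su ub]; rewrite ltNge; apply/negP => cu.
  have : u <= s by apply: (ub_le_sup hS.2); split => //; rewrite ub (le_trans ts (ltW su)).
  by rewrite leNgt su.
have VsE : V s = c.
  apply/eqP; rewrite eq_le Vs andbT leNgt; apply/negP => cVs.
  have [||e e0 He] := @cont_dist V s (V s - c).
  - by apply: cts; rewrite ts sb.
  - by rewrite subr_gt0.
  pose u := Num.min b (s + e / 2).
  have su : s < u by rewrite /u lt_min sltb/=; lra.
  have ub : u <= b by rewrite /u ge_min lexx.
  have ue : u <= s + e / 2 by rewrite /u ge_min lexx orbT.
  have := He u; rewrite /= distrC gtr0_norm ?subr_gt0// => H.
  have := Vlt u; rewrite su ub => /(_ isT).
  have {}H : `|V s - V u| < V s - c by apply: H; lra.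
  by move: H; rewrite ltr_norml => /andP[]; lra.
have dpos : 0 < dV s by apply: pos => //; rewrite sltb (le_trans at_ ts).
have /(_ _)[|dvs dvE] := dVV s; first by rewrite (le_trans at_ ts) sb.
have /cvgrPdist_lt/(_ _ dpos) : h^-1 *: (V (h *: 1 + s) - V s) @[h --> 0^'] --> dV s.
  by rewrite -dvE.
move=> [e /= e0 He].
(* A step to the right so short that the difference quotient at [s] is positive, whereas V has
   already dropped below c there. *)
pose h := Num.min (b - s) (e / 2).
have h0 : 0 < h by rewrite /h lt_min; apply/andP; split; lra.
have hb : h <= b - s by rewrite /h ge_min lexx.
have he : h <= e / 2 by rewrite /h ge_min lexx orbT.
have := He h; rewrite /= sub0r normrN gtr0_norm// => H.
have {}H : `|dV s - h^-1 * (V (h * 1 + s) - V s)| < dV s.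
  by apply: H; [lra|rewrite gt_eqF].
have Vh : V (h + s) < c by apply: Vlt; apply/andP; split; lra.
move: H; rewrite mulr1 VsE ltr_norml => /andP[_].
have : h^-1 * (V (h + s) - c) < 0 by rewrite pmulr_rlt0 ?invr_gt0// subr_lt0.
by lra.
Qed.

End RealCalculus.

(** * Picard iteration *)

Section Primitive.
Variable R : realType.
Local Notation mu := (@lebesgue_measure R).
Implicit Types (h H dH : R -> R) (a b c k t : R).

(** The oriented integral from t0 to t; at least one of the two intervals is empty. *)
Definition primitive (t0 : R) h t : R :=
  \int[mu]_(s in `]t0, t]) h s - \int[mu]_(s in `]t, t0]) h s.

Lemma primitive_start t0 h : primitive t0 h t0 = 0.
Proof. by rewrite /primitive subrr. Qed.

Lemma continuous_integrable_itv h a b : continuous h ->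
  mu.-integrable `[a, b] (EFin \o h).
Proof.
move=> ch; apply: continuous_compact_integrable; first exact: segment_compact.
exact: continuous_subspaceT.
Qed.

Lemma primitiveE t0 h a t : continuous h -> a < t0 -> a < t ->
  primitive t0 h t = \int[mu]_(s in `[a, t]) h s - \int[mu]_(s in `[a, t0]) h s.
Proof.
move=> ch at0 at1; rewrite /primitive; have [tt0|t0t] := leP t t0.
  rewrite -(@Rintegral_itvB _ h (BLeft a) (BRight t0) t); last 3 first.
  - exact: continuous_integrable_itv.
  - by rewrite bnd_simp ltW.
  - by rewrite bnd_simp.
  rewrite [X in \int[_]_(_ in X) _](_ : _ = set0).
    by rewrite Rintegral_set0; lra.
  by apply/seteqP; split => // x /=; rewrite in_itv/= => /andP[]; lra.
rewrite -(@Rintegral_itvB _ h (BLeft a) (BRight t) t0); last 3 first.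
- exact: continuous_integrable_itv.
- by rewrite bnd_simp ltW.
- by rewrite bnd_simp ltW.
rewrite [X in _ - \int[_]_(_ in X) _](_ : _ = set0).
  by rewrite Rintegral_set0; lra.
by apply/seteqP; split => // x /=; rewrite in_itv/= => /andP[]; lra.
Qed.

Lemma is_derive_primitive t0 h t : continuous h ->
  is_derive t 1 (primitive t0 h) (h t).
Proof.
(* A base point to the left of both t and t0: near t only one integral with a moving endpoint
   remains. *)
move=> ch; pose a := Num.min t t0 - 1.
have aM : a < Num.min t t0 by rewrite /a; lra.
have [at1 at0] : a < t /\ a < t0 by move: aM; rewrite lt_min => /andP[].
have [dG GE] := @continuous_FTC1_closed _ h a t (t + 1) ltac:(lra)
  (@continuous_integrable_itv h a (t + 1) ch) at1 (ch t).
have dG' : is_derive t 1 (fun u => \int[mu]_(s in `[a, u]) h s) (h t).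
  by split; [exact: dG|rewrite -derive1E; exact: GE].
apply: (@near_eq_is_derive _ _ _ (fun u => \int[mu]_(s in `[a, u]) h s
  - \int[mu]_(s in `[a, t0]) h s)).
  near=> u; rewrite (@primitiveE _ _ a)//.
  by near: u; exact: lt_nbhsr.
rewrite -[h t]subr0; apply: is_derive_Bl => //; exact: is_derive_cstl.
Unshelve. all: by end_near. Qed.

(** The weight exp(k|t - t0|) dominates k times its own integral from t0. In the norm with this
    weight, Picard's operator is a contraction on the whole line at once, with no restriction to
    short intervals. *)
Lemma exp_growth_le H dH t0 c k : 0 <= c -> 0 < k -> H t0 = 0 ->
  (forall t, is_derive t 1 H (dH t)) ->
  (forall t, `|dH t| <= c * k * expR (k * `|t - t0|)) ->
  forall t, `|H t| <= c * expR (k * `|t - t0|).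
Proof.
move=> c0 k0 H0 dH_ dHle t.
suff K (s : R) : `|s| = 1 -> s * H t <= c * expR (k * `|t - t0|).
  rewrite ler_norml; apply/andP; split.
    by have := K (-1); rewrite normrN1 => /(_ erefl); lra.
  by have := K 1; rewrite normr1 => /(_ erefl); lra.
move=> s1.
have dHle' u : - (c * k * expR (k * `|u - t0|)) <= s * dH u <= c * k * expR (k * `|u - t0|).
  by rewrite -ler_norml normrM s1 mul1r.
have dE (u r : R) : is_derive u 1 (fun v => c * expR (k * (r * (v - t0))) : R)
    (c * k * expR (k * (r * (u - t0))) * r).
  have := is_derive_Ml (is_derive_cstl c u (1 : R)) (is_derive_expRl
    (is_derive_Ml (is_derive_cstl k u (1 : R)) (is_derive_Ml (is_derive_cstl r u (1 : R))
    (is_derive_Bl (is_derive_idl u) (is_derive_cstl t0 u (1 : R)))))).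
  by move/is_derive_eq; apply; ring.
have [tt0|t0t] := leP t t0.
  suff: s * H t - c * expR (k * (-1 * (t - t0))) <=
        s * H t0 - c * expR (k * (-1 * (t0 - t0))).
    by rewrite H0 !subrr !mulr0 expR0 ler0_norm ?subr_le0// mulN1r; lra.
  apply: (@is_derive_ge0_le _ (fun v => s * H v - c * expR (k * (-1 * (v - t0))))
    (fun v => s * dH v + c * k * expR (k * (-1 * (v - t0))))) => //.
  - move=> u _; have := is_derive_Bl (is_derive_Ml (is_derive_cstl s u (1 : R)) (dH_ u))
      (dE u (-1)).
    by move/is_derive_eq; apply; ring.
  - move=> u /andP[_ ut0]; have := dHle' u; rewrite ltr0_norm ?subr_lt0//.
    by rewrite mulN1r => /andP[]; lra.
suff: c * expR (k * (1 * (t0 - t0))) - s * H t0 <=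
      c * expR (k * (1 * (t - t0))) - s * H t.
  by rewrite H0 !subrr !mulr0 expR0 gtr0_norm ?subr_gt0// mul1r; lra.
apply: (@is_derive_ge0_le _ (fun v => c * expR (k * (1 * (v - t0))) - s * H v)
    (fun v => c * k * expR (k * (1 * (v - t0))) - s * dH v)) => //.
- exact: ltW.
- move=> u _; have := is_derive_Bl (dE u 1)
    (is_derive_Ml (is_derive_cstl s u (1 : R)) (dH_ u)).
  by move/is_derive_eq; apply; ring.
- move=> u /andP[ut0 _]; have := dHle' u; rewrite gtr0_norm ?subr_gt0//.
  by rewrite mul1r => /andP[]; lra.
Qed.

(** The intervals around [u n] of radius 2 c / 2^n are nested, so the supremum of their left ends
    lies in all of them; this gives the limit together with its rate. *)
Lemma geometric_limit (u : nat -> R) c :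
  (forall n, `|u n.+1 - u n| <= c / 2 ^+ n) ->
  exists l, forall n, `|l - u n| <= 2 * c / 2 ^+ n.
Proof.
move=> uc.
pose d n := 2 * c / 2 ^+ n.
have dS n : d n = 2 * d n.+1.
  rewrite /d exprS invfM; have : 0 < 2 ^+ n :> R by rewrite exprn_gt0.
  by move=> ?; field; rewrite gt_eqF.
have dc n : c / 2 ^+ n = d n.+1.
  rewrite /d exprS invfM; have : 0 < 2 ^+ n :> R by rewrite exprn_gt0.
  by move=> ?; field; rewrite gt_eqF.
have lo n m : (n <= m)%N -> u n - d n <= u m - d m.
  move=> /subnK <-; elim: (m - n)%N => [//|k IH]; apply: le_trans IH _.
  rewrite addSn; have := uc (k + n)%N; rewrite dc (dS (k + n)%N).
  by rewrite ler_norml => /andP[]; lra.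
have up n m : (n <= m)%N -> u m + d m <= u n + d n.
  move=> /subnK <-; elim: (m - n)%N => [//|k IH]; apply: le_trans IH.
  rewrite addSn; have := uc (k + n)%N; rewrite dc (dS (k + n)%N).
  by rewrite ler_norml => /andP[]; lra.
have d0 n : 0 <= d n.
  have c0 : 0 <= c by have := uc 0%N; rewrite expr0 divr1; apply: le_trans.
  by rewrite /d mulr_ge0 ?invr_ge0 ?exprn_ge0//; lra.
have cross n m : u n - d n <= u m + d m.
  have := lo n (maxn n m) (leq_maxl _ _); have := up m (maxn n m) (leq_maxr _ _).
  by have := d0 (maxn n m); lra.
exists (sup (range (fun n => u n - d n))) => n.
have hS : has_sup (range (fun n => u n - d n)).
  by split; [exists (u 0%N - d 0%N), 0%N|exists (u 0%N + d 0%N) => _ [m _ <-]].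
have l1 : u n - d n <= sup (range (fun n => u n - d n)).
  by apply: (ub_le_sup hS.2); exists n.
have l2 : sup (range (fun n => u n - d n)) <= u n + d n.
  by apply: ge_sup; [exact: hS.1|move=> _ [m _ <-]].
by rewrite -/(d n) ler_norml; apply/andP; split; lra.
Qed.

Lemma exp2n_arch c e : 0 < e -> exists n, c / 2 ^+ n < e.
Proof.
move=> e0; have [c0|c0] := leP c 0.
  by exists 0%N; rewrite expr0 divr1; apply: le_lt_trans e0.
exists (Num.truncn (c / e)).+1.
rewrite ltr_pdivrMr ?exprn_gt0// mulrC -ltr_pdivrMr//.
apply: lt_trans (truncnS_gt _) _.
by rewrite -natrX ltr_nat ltn_expl.
Qed.

Lemma eq0_geometric (x c : R) : (forall n, `|x| <= c / 2 ^+ n) -> x = 0.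
Proof.
move=> H; apply/eqP; rewrite -normr_le0 leNgt; apply/negP => x0.
by have [n] := exp2n_arch c x0; rewrite ltNge H.
Qed.

End Primitive.

Section Picard.
Variables (R : realType) (F : bool -> R -> R -> R -> R) (K M t0 : R) (z0 : bool -> R).
Hypothesis K0 : 0 < K.
Hypothesis contF : forall b (X Y : R -> R), continuous X -> continuous Y ->
  continuous (fun t => F b t (X t) (Y t)).
Hypothesis lipF : forall b t x y x' y',
  `|F b t x y - F b t x' y'| <= K * (`|x - x'| + `|y - y'|).
Hypothesis bndF : forall b t, `|F b t (z0 true) (z0 false)| <= M.

Let rhs (Z : bool -> R -> R) b t := F b t (Z true t) (Z false t).
Let next (Z : bool -> R -> R) b t := z0 b + primitive t0 (rhs Z b) t.
Let Z n := iter n next (fun b _ => z0 b).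
Let k := 4 * K.
Let W t := expR (k * `|t - t0|).
Let C := M / k.

Let k0 : 0 < k. Proof. by rewrite /k mulr_gt0. Qed.
Let M0 : 0 <= M. Proof. exact: le_trans (bndF true 0). Qed.
Let C0 : 0 <= C. Proof. by rewrite /C divr_ge0// ltW. Qed.
Let CkE : C * k = M. Proof. by rewrite /C divfK// gt_eqF. Qed.
Let W1 t : 1 <= W t.
Proof. by rewrite -[leLHS]expR0 ler_expR mulr_ge0// ltW. Qed.

Let next_derive (X : bool -> R -> R) b (t : R) : (forall b, continuous (X b)) ->
  is_derive t 1 (next X b) (rhs X b t).
Proof.
move=> cX; rewrite -[rhs X b t]add0r.
apply: (@is_derive_Dl _ _ (fun=> z0 b) (primitive t0 (rhs X b))).
by apply: is_derive_primitive; exact: contF.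
Qed.

Let next_start X b : next X b t0 = z0 b.
Proof. by rewrite /next primitive_start addr0. Qed.

Let contZ n b : continuous (Z n b).
Proof.
elim: n b => [|n IH] b t; first exact: cvg_cst.
by apply: is_derive_cont; apply: next_derive.
Qed.

Let next_lip (X Y : bool -> R -> R) c : 0 <= c ->
  (forall b, continuous (X b)) -> (forall b, continuous (Y b)) ->
  (forall b t, `|X b t - Y b t| <= c * W t) ->
  forall b t, `|next X b t - next Y b t| <= c / 2 * W t.
Proof.
move=> c0 cX cY XY b t.
apply: (@exp_growth_le _ (fun t => next X b t - next Y b t)
  (fun t => rhs X b t - rhs Y b t)) => //.
- by rewrite divr_ge0.
- by rewrite !next_start subrr.
- by move=> u; apply: is_derive_Bl; exact: next_derive.
- move=> u; apply: le_trans (lipF _ _ _ _ _ _) _.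
  have := lerD (XY true u) (XY false u).
  move=> /(ler_wpM2l (ltW K0))/le_trans; apply.
  by rewrite -/(W u) le_eqVlt; apply/orP; left; apply/eqP; rewrite /k; field.
Qed.

Let Zstep n b t : `|Z n.+1 b t - Z n b t| <= (C * W t) / 2 ^+ n.
Proof.
have -> : (C * W t) / 2 ^+ n = C / 2 ^+ n * W t by rewrite mulrAC.
elim: n b t => [|n IH] b t.
  rewrite expr0 divr1.
  apply: (@exp_growth_le _ (fun t => next (Z 0) b t - z0 b) (rhs (Z 0) b)) => //.
  - by rewrite next_start subrr.
  - move=> u; have := is_derive_Bl (@next_derive (Z 0) b u (@contZ 0%N))
      (is_derive_cstl (z0 b) u (1 : R)).
    by rewrite subr0.
  - move=> u; rewrite CkE; apply: le_trans (bndF _ _) _.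
    by rewrite ler_peMr//; exact: W1.
have -> : C / 2 ^+ n.+1 = C / 2 ^+ n / 2 by rewrite exprS invfM; ring.
apply: (@next_lip (Z n.+1) (Z n) (C / 2 ^+ n) _ (@contZ n.+1) (@contZ n) IH b t).
by rewrite divr_ge0// exprn_ge0.
Qed.

(** The booleans index the two unknowns, so that one iteration treats both. With k = 4 K the map
    [next] halves weighted distances: the two components contribute K (c + c), which is (c / 2) k.
    Boundedness of the field is needed only at the initial value, for the first step. *)
Lemma picard_exists : exists X : bool -> R -> R,
  (forall b, X b t0 = z0 b) /\
  forall b (t : R), is_derive t 1 (X b) (F b t (X true t) (X false t)).
Proof.
have lim b t : exists l, forall n, `|l - Z n b t| <= 2 * (C * W t) / 2 ^+ n.
  by apply: geometric_limit => n; exact: Zstep.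
pose X b t := projT1 (cid (lim b t)).
have XZ b t n : `|X b t - Z n b t| <= 2 * (C * W t) / 2 ^+ n.
  by rewrite /X; case: cid.
have XZ' n b t : `|X b t - Z n b t| <= 2 * C / 2 ^+ n * W t.
  by apply: le_trans (XZ _ _ _) _; rewrite le_eqVlt; apply/orP; left; apply/eqP; ring.
have cW : continuous W.
  move=> t; apply: continuous_comp; last exact: continuous_expR.
  apply: continuousM; first exact: cst_continuous.
  apply: continuous_comp; last exact: norm_continuous.
  by apply: continuousB; [exact: cvg_id|exact: cst_continuous].
have cX b : continuous (X b).
  move=> t; apply/cvgrPdist_lt => e e0.
  (* The iterates converge uniformly only relative to W; bounding W by W(t) + 1 near t makes the
     convergence locally uniform, and the usual e / 3 argument applies. *)
  have [n Hn] := @exp2n_arch R (2 * C * (W t + 1)) (e / 3) ltac:(lra).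
  have [d d0 Hd] := @cont_dist _ W t 1 (cW t) ltac:(lra).
  have [d' d0' Hd'] := @cont_dist _ (Z n b) t (e / 3) (@contZ n b t) ltac:(lra).
  near=> s.
  have ts : `|t - s| < d by near: s; exact: cvgr_dist_lt.
  have ts' : `|t - s| < d' by near: s; exact: cvgr_dist_lt.
  have Ws : W s <= W t + 1.
    by have := Hd _ ts; rewrite ltr_norml => /andP[]; lra.
  have bnd u : W u <= W t + 1 -> `|X b u - Z n b u| < e / 3.
    move=> Wu; apply: le_lt_trans (XZ' _ _ _) _; apply: le_lt_trans Hn.
    rewrite [leRHS]mulrAC ler_wpM2l//.
    by apply: divr_ge0; [exact: mulr_ge0|exact: exprn_ge0].
  have := Hd' _ ts'; have := bnd _ Ws; have := bnd t ltac:(lra).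
  rewrite !ltr_norml => /andP[? ?] /andP[? ?] /andP[? ?].
  by apply/andP; split; lra.
have XE : X = next X.
  apply/funext => b; apply/funext => t; apply/eqP; rewrite -subr_eq0; apply/eqP.
  apply: (@eq0_geometric _ _ (2 * C * W t)) => n.
  have Cn : 0 <= 2 * C / 2 ^+ n.
    by apply: divr_ge0; [exact: mulr_ge0|exact: exprn_ge0].
  have E1 := @next_lip X (Z n) (2 * C / 2 ^+ n) Cn cX (@contZ n) (XZ' n) b t.
  have E2 := XZ' n.+1 b t.
  have -> : X b t - next X b t = (X b t - Z n.+1 b t) - (next X b t - next (Z n) b t).
    by rewrite /Z iterS; ring.
  apply: le_trans (ler_normB _ _) _; apply: le_trans (lerD E2 E1) _.
  rewrite exprS invfM; rewrite le_eqVlt; apply/orP; left; apply/eqP.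
  by field; rewrite gt_eqF// exprn_gt0.
exists X; split=> [b|b t]; first by rewrite XE next_start.
by have := @next_derive X b t cX; rewrite -(congr1 (fun Z => Z b) XE).
Unshelve. all: by end_near. Qed.

End Picard.

(** * Gronwall's inequality for systems of two equations *)

Section Gronwall.
Variables (R : realType) (f g : R -> R -> R -> R) (K : R).
Hypothesis lipf : forall t x y x' y',
  `|f t x y - f t x' y'| <= K * (`|x - x'| + `|y - y'|).
Hypothesis lipg : forall t x y x' y',
  `|g t x y - g t x' y'| <= K * (`|x - x'| + `|y - y'|).

(** The squared distance D satisfies D' <= 2 K (|x| + |y|)^2 <= 4 K D, so D exp(-4 K t) is
    nonincreasing. *)
Lemma gronwall_pair (X Y X' Y' : R -> R) (a b : R) : a <= b -> 0 <= K ->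
  (forall t, a <= t <= b -> is_derive t 1 X (f t (X t) (Y t))) ->
  (forall t, a <= t <= b -> is_derive t 1 Y (g t (X t) (Y t))) ->
  (forall t, a <= t <= b -> is_derive t 1 X' (f t (X' t) (Y' t))) ->
  (forall t, a <= t <= b -> is_derive t 1 Y' (g t (X' t) (Y' t))) ->
  (X b - X' b) ^+ 2 + (Y b - Y' b) ^+ 2 <=
  ((X a - X' a) ^+ 2 + (Y a - Y' a) ^+ 2) * expR (4 * K * (b - a)).
Proof.
move=> ab K0 dX dY dX' dY'.
pose D t := (X t - X' t) ^+ 2 + (Y t - Y' t) ^+ 2.
pose dD t := 2 * (X t - X' t) * (f t (X t) (Y t) - f t (X' t) (Y' t)) +
  2 * (Y t - Y' t) * (g t (X t) (Y t) - g t (X' t) (Y' t)).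
have dD_ t : a <= t <= b -> is_derive t 1 D (dD t).
  by move=> h; apply: is_derive_Dl; apply: is_derive_sqrl; apply: is_derive_Bl; auto.
have dDle t : dD t <= 4 * K * D t.
  rewrite /dD /D; set x := X t - X' t; set y := Y t - Y' t.
  have := lipf t (X t) (Y t) (X' t) (Y' t); have := lipg t (X t) (Y t) (X' t) (Y' t).
  set p := f _ _ _ - _; set q := g _ _ _ - _; rewrite -/x -/y => hq hp.
  have : x * p <= `|x| * (K * (`|x| + `|y|)).
    by rewrite (le_trans (ler_norm _))// normrM ler_wpM2l.
  have : y * q <= `|y| * (K * (`|x| + `|y|)).
    by rewrite (le_trans (ler_norm _))// normrM ler_wpM2l.
  rewrite -(real_normK (num_real x)) -(real_normK (num_real y)).
  have := mulr_ge0 K0 (sqr_ge0 (`|x| - `|y|)); move: (`|x|) (`|y|) => u v; lra.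
have dE t : a <= t <= b -> is_derive t 1
    (fun s => - (D s * expR (- (4 * K) * s))) ((4 * K * D t - dD t) * expR (- (4 * K) * t)).
  move=> h; have := is_derive_Nl (is_derive_Ml (dD_ _ h) (is_derive_expRl
    (is_derive_Ml (is_derive_cstl (- (4 * K)) t (1 : R)) (is_derive_idl t)))).
  by move/is_derive_eq; apply; ring.
have := is_derive_ge0_le ab dE; rewrite lerN2 => /(_ _)H.
have {}H : D b * expR (- (4 * K) * b) <= D a * expR (- (4 * K) * a).
  by apply: H => t _; rewrite mulr_ge0 ?expR_ge0// subr_ge0.
have -> : expR (4 * K * (b - a)) = expR (4 * K * b) * expR (- (4 * K) * a).
  by rewrite -expRD; congr (expR _); ring.
rewrite -/(D b) -/(D a).
have e1 : expR (4 * K * b) * expR (- (4 * K) * b) = 1.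
  by rewrite -expRD mulNr subrr expR0.
have := ler_wpM2l (expR_ge0 (4 * K * b)) H.
by rewrite mulrCA e1 mulr1 mulrCA.
Qed.

End Gronwall.

(** * The energy inequality *)

Section EnergyInequality.
Variable R : realType.

Lemma ler_norm_bound (a b : R) : `|a| <= b -> - b <= a <= b.
Proof. by rewrite ler_norml. Qed.

Lemma ler_normM_bound (a b a' b' : R) :
  `|a| <= a' -> `|b| <= b' -> `|a * b| <= a' * b'.
Proof. by move=> ha hb; rewrite normrM ler_pM. Qed.

Lemma ler_of_sqr (a b : R) : 0 <= b -> a ^+ 2 <= b ^+ 2 -> a <= b.
Proof.
move=> b0 ab; have [a0|/ltW/le_trans] := leP 0 a; last exact.
by rewrite -(ler_pXn2r (n := 2)).
Qed.

(* The right-hand side is the derivative of the energy x^2 + y^2 - k x y along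
   the linearised flow, x and y / k being the unknowns and r1, r2 the
   quadratic remainders of the exponentials. *)
Lemma energy_derivative_ge (B A k x y l r1 r2 N : R) :
  1 <= B -> 0 < k <= 32^-1 -> `|1 - A| <= k / 16 ->
  0 <= N <= k / 384 -> N ^+ 2 = x ^+ 2 + y ^+ 2 ->
  `|r1| <= k ^+ 2 * N ^+ 2 -> `|r2| <= 4 * N ^+ 2 ->
  k ^+ 2 * N ^+ 2 / 2 - 3 * N * `|l| <=
  2 * k * (x * y) * (1 - A) + k ^+ 2 * y ^+ 2 * (B + 4 * A - 1)
  + A * k ^+ 2 * x ^+ 2 - 2 * A * k ^+ 3 * (x * y) - (2 * x - k * y) * (r1 + l)
  - (2 * A * k * y - A * k ^+ 2 * x) * r2.
Proof.
move=> B1 /andP[k0 k1] hA /andP[N0 N1] NE hr1 hr2.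
have xN : `|x| <= N.
  by rewrite -(ler_pXn2r (n := 2))// ?nnegrE// real_normK ?num_real// NE lerDl sqr_ge0.
have yN : `|y| <= N.
  by rewrite -(ler_pXn2r (n := 2))// ?nnegrE// real_normK ?num_real// NE lerDr sqr_ge0.
have A2 : `|A| <= 2.
  by rewrite ler_norml; have /andP[] := ler_norm_bound hA; lra.
have kk : `|k| <= k by rewrite gtr0_norm.
have h2 : `|2 : R| <= 2 by rewrite gtr0_norm.
have kN : 0 <= k ^+ 2 * N ^+ 2 by rewrite mulr_ge0 ?sqr_ge0.
have xyN : `|x * y| <= N ^+ 2 / 2.
  rewrite NE ler_norml; have := sqr_ge0 (x - y); have := sqr_ge0 (x + y).
  by rewrite sqrrD sqrrB => ? ?; apply/andP; split; lra.
have e1 : `|2 * k * (x * y) * (1 - A)| <= k ^+ 2 * N ^+ 2 / 16.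
  apply: le_trans (ler_normM_bound (ler_normM_bound (ler_normM_bound h2 kk) xyN) hA) _.
  by rewrite le_eqVlt; apply/orP; left; apply/eqP; field.
have e2 : `|2 * A * k ^+ 3 * (x * y)| <= k ^+ 2 * N ^+ 2 / 16.
  have k3 : `|k ^+ 3| <= k ^+ 2 / 32.
    rewrite gtr0_norm ?exprn_gt0// exprSr; apply: ler_wpM2l => //.
    by rewrite sqr_ge0.
  apply: le_trans (ler_normM_bound (ler_normM_bound (ler_normM_bound h2 A2) k3) xyN) _.
  by rewrite le_eqVlt; apply/orP; left; apply/eqP; field.
have c1 : `|2 * x - k * y| <= 3 * N.
  apply: le_trans (ler_normB _ _) _.
  apply: le_trans (lerD (ler_normM_bound h2 xN) (ler_normM_bound kk yN)) _.
  have : k * N <= 1 * N by apply: ler_wpM2r => //; lra.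
  by lra.
have e3 : `|(2 * x - k * y) * r1| <= k ^+ 2 * N ^+ 2 / 16.
  apply: le_trans (ler_normM_bound c1 hr1) _.
  have : N * (k ^+ 2 * N ^+ 2) <= 48^-1 * (k ^+ 2 * N ^+ 2).
    by apply: ler_wpM2r => //; lra.
  by lra.
have e4 : `|(2 * x - k * y) * l| <= 3 * N * `|l| by apply: ler_normM_bound.
have c2 : `|2 * A * k * y - A * k ^+ 2 * x| <= 6 * k * N.
  apply: le_trans (ler_normB _ _) _.
  have k2 : `|k ^+ 2| <= k * 1.
    by rewrite ger0_norm ?sqr_ge0// expr2 ler_wpM2l//; lra.
  apply: le_trans (lerD (ler_normM_bound (ler_normM_bound (ler_normM_bound h2 A2) kk) yN)
    (ler_normM_bound (ler_normM_bound A2 k2) xN)) _.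
  by lra.
(* The critical remainder: it is at most 6 k N * 4 N^2 = 24 k N^3, and the bound N <= k / 384 is
   chosen with 384 = 24 * 16. *)
have e5 : `|(2 * A * k * y - A * k ^+ 2 * x) * r2| <= k ^+ 2 * N ^+ 2 / 16.
  apply: le_trans (ler_normM_bound c2 hr2) _.
  have : N * (k * N ^+ 2) <= k / 384 * (k * N ^+ 2).
    by apply: ler_wpM2r => //; rewrite mulr_ge0 ?sqr_ge0// ltW.
  by rewrite expr2; lra.
(* The gain: the x part comes from the cross term of the energy alone. After the four remainders of
   k^2 N^2 / 16 at least 11/16 of k^2 N^2 is left, more than the half that is claimed. *)
have e6 : 15 / 16 * (k ^+ 2 * N ^+ 2) <=
    k ^+ 2 * y ^+ 2 * (B + 4 * A - 1) + A * k ^+ 2 * x ^+ 2.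
  have [_ hA2] := andP (ler_norm_bound hA).
  have : 0 <= k ^+ 2 * y ^+ 2 * (B + 4 * A - 1 - 15 / 16).
    by apply: mulr_ge0; [rewrite -exprMn sqr_ge0|lra].
  have : 0 <= k ^+ 2 * x ^+ 2 * (A - 15 / 16).
    by apply: mulr_ge0; [rewrite -exprMn sqr_ge0|lra].
  by rewrite NE; lra.
move: (ler_norm_bound e1) (ler_norm_bound e2) (ler_norm_bound e3)
  (ler_norm_bound e4) (ler_norm_bound e5) => /andP[a1 b1] /andP[a2 b2]
  /andP[a3 b3] /andP[a4 b4] /andP[a5 b5].
rewrite [(2 * x - k * y) * (r1 + l)]mulrDr.
by lra.
Qed.

Lemma expR_remainder2 (w : R) : `|w| <= 1 -> `|expR w - 1 - w| <= w ^+ 2.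
Proof.
move=> w1; have /andP[w1l w1u] := ler_norm_bound w1.
have g0 := expR_ge1Dx w.
rewrite ger0_norm; last by lra.
suff H (v : R) : -1 <= v <= 1 -> expR v <= 1 + v + v ^+ 2.
  by have := H w; rewrite w1l w1u => /(_ isT); lra.
move=> /andP[v1 v2].
(* [h t = (1 + t + t^2) e^{-t}] has derivative [t (1 - t) e^{-t}], so it is
   minimal at 0 on [-1, 1]. *)
pose h t : R := (1 + t + t ^+ 2) * expR (- t).
pose dh t : R := t * (1 - t) * expR (- t).
have dh_ t : is_derive t (1 : R) h (dh t).
  have := is_derive_Ml (is_derive_Dl (is_derive_Dl (is_derive_cstl 1 t (1 : R))
    (is_derive_idl t)) (is_derive_sqrl (is_derive_idl t)))
    (is_derive_expRl (is_derive_Nl (is_derive_idl t))).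
  by move/is_derive_eq; apply; rewrite /dh; ring.
have h0 : h 0 = 1 by rewrite /h oppr0 expR0; ring.
have hv : 1 <= h v.
  have [v0|v0] := leP 0 v.
    rewrite -h0; apply: (is_derive_ge0_le v0 (fun t _ => dh_ t)).
    move=> t /andP[? ?]; rewrite /dh; apply: mulr_ge0 (expR_ge0 _); apply: mulr_ge0; lra.
  suff : - h v <= - h 0 by rewrite h0; lra.
  apply: (is_derive_ge0_le (ltW v0) (fun t _ => is_derive_Nl (dh_ t))).
  move=> t /andP[? ?]; rewrite /dh -mulNr -mulNr; apply: mulr_ge0 (expR_ge0 _); apply: mulr_ge0; lra.
have := ler_wpM2r (expR_ge0 v) hv.
by rewrite /h mul1r -mulrA -expRD [- v + v]addNr expR0 mulr1.
Qed.

Lemma expR_lip (a b c : R) : a <= c -> b <= c ->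
  `|expR a - expR b| <= expR c * `|a - b|.
Proof.
wlog ab : a b / a <= b.
  move=> H ac bc; have [/H|/ltW/H] := leP a b; first exact.
  by rewrite distrC [`|b - a|]distrC; exact.
move=> ac bc; rewrite distrC [`|a - b|]distrC [`|b - a|]ger0_norm ?subr_ge0//.
apply: (@is_derive_dist_le _ expR expR) => // t /andP[_ tb].
by rewrite ger0_norm ?expR_ge0// ler_expR; lra.
Qed.

Lemma lip_continuous (h : R -> R) (c : R) :
  (forall x y, `|h x - h y| <= c * `|x - y|) -> continuous h.
Proof.
move=> H x; apply/cvgrPdist_lt => e e0; near=> y.
apply: le_lt_trans (H _ _) _.
have : `|x - y| < e / (`|c| + 1).
  near: y; apply: cvgr_dist_lt => //; rewrite divr_gt0// ltr_wpDl//.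
rewrite ltr_pdivlMr ?ltr_wpDl// mulrC mulrDl mul1r.
have : c * `|x - y| <= `|c| * `|x - y| by rewrite ler_wpM2r// ler_norm.
by have := normr_ge0 (x - y); lra.
Unshelve. all: by end_near. Qed.

Definition clamp (a b x : R) : R := Num.max a (Num.min x b).

Lemma clamp_itv a b x : a <= b -> a <= clamp a b x <= b.
Proof.
by move=> ab; rewrite /clamp le_max lexx/= ge_max ab ge_min lexx orbT.
Qed.

Lemma clamp_id a b x : a <= x <= b -> clamp a b x = x.
Proof. by move=> /andP[ax xb]; rewrite /clamp (min_idPl xb) (max_idPr ax). Qed.

Lemma clamp_lip a b x y : `|clamp a b x - clamp a b y| <= `|x - y|.
Proof.
have minl u v : `|Num.min u b - Num.min v b| <= `|u - v|.
  have h1 := ler_norm (u - v); have h2 := ler_norm (v - u).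
  rewrite distrC in h2; rewrite ler_norml.
  by case: (leP u b) => ?; case: (leP v b) => ?; apply/andP; split; lra.
apply: le_trans (minl x y); rewrite /clamp; move: (Num.min x b) (Num.min y b) => u v.
have h1 := ler_norm (u - v); have h2 := ler_norm (v - u).
rewrite distrC in h2; rewrite ler_norml.
by case: (leP a u) => ?; case: (leP a v) => ?; apply/andP; split; lra.
Qed.

Lemma clamp_continuous a b : continuous (clamp a b).
Proof.
by apply: (@lip_continuous _ 1) => x y; rewrite mul1r; exact: clamp_lip.
Qed.

Lemma bounded_pair_cluster (x y : nat -> R) :
  (forall n, `|x n| <= 1) -> (forall n, `|y n| <= 1) ->
  exists a b, forall e m, 0 < e -> exists n,
    [/\ (m <= n)%N, `|x n - a| < e & `|y n - b| < e].
Proof.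
move=> x1 y1.
pose I := `[-1, 1]%classic : set R.
have cI : compact (I `*` I) by apply: compact_setX; exact: segment_compact.
have [|[a b] [_ clp]] := cI ((fun n => (x n, y n)) @ \oo) _.
  exists 0%N => // n _; split.
    by change (x n \in `[-1, 1]); rewrite in_itv/= -ler_norml.
  by change (y n \in `[-1, 1]); rewrite in_itv/= -ler_norml.
exists a, b => e m e0.
have [|[p q] [/= [n mn [<- <-]]]] := clp [set z | exists2 n, (m <= n)%N & (x n, y n) = z]
  (ball ((a, b) : R * R) e) _ (nbhsx_ballx _ _ e0).
  by exists m => // n mn /=; exists n.
by move=> [/= h1 h2]; exists n; split=> //; rewrite distrC.
Qed.

End EnergyInequality.

(** * The singular profile *)

Lemma ln_near1 (R : realType) (a : R) : 2^-1 <= a -> `|ln a| <= 2 * `|a - 1|.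
Proof.
move=> a2; have a0 : 0 < a by lra.
have h1 : ln a <= a - 1.
  by have := @le_ln1Dx R (a - 1) ltac:(lra); rewrite addrC subrK.
have h2 : - ln a <= a^-1 - 1.
  have ai : 0 < a^-1 by rewrite invr_gt0.
  by have := @le_ln1Dx R (a^-1 - 1) ltac:(lra); rewrite addrC subrK lnV.
have n1 := ler_norm (a - 1); have n2 := ler_norm (1 - a); rewrite distrC in n2.
rewrite ler_norml; apply/andP; split; last by have := normr_ge0 (a - 1); lra.
have : a^-1 - 1 <= 2 * `|a - 1|.
  rewrite (_ : a^-1 - 1 = a^-1 * (1 - a)); last by field; rewrite gt_eqF.
  have ai : a^-1 <= 2 by rewrite -[leRHS]invrK lef_pV2 ?posrE// invr_gt0.
  apply: le_trans (_ : a^-1 * `|a - 1| <= _).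
    by apply: ler_wpM2l => //; rewrite invr_ge0 ltW.
  by apply: ler_wpM2r.
by lra.
Qed.

Section SingularProfile.
Variables (R : realType) (B : R) (A dA S : R -> R) (C s1 : R).
Hypotheses (B1 : 1 <= B) (C0 : 0 < C) (s1_ge1 : 1 <= s1).
Hypothesis A_derive : forall s : R, s1 <= s -> is_derive s 1 A (dA s).
Hypothesis S_ge0 : forall s : R, s1 <= s -> 0 <= S s.
Hypothesis S_decr : forall s t : R, s1 <= s -> s <= t -> S t <= S s.
Hypothesis A_near1 : forall s : R, s1 <= s -> `|A s - 1| <= C * S s.
Hypothesis dA_small : forall s : R, s1 <= s -> `|dA s| <= C * S s / s.

Ltac slra := move: B1 C0 s1_ge1 => ? ? ?; lra.

(** The speed of rotation of the linearised system; y / k s is the variable that makes B s y^2 a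
    plain square. *)
Let k (s : R) := (Num.sqrt (B * s))^-1.
Hypothesis k_small : forall s : R, s1 <= s -> k s <= 32^-1.
Hypothesis S_small : forall s : R, s1 <= s -> 12 * C * B * S s <= k s / 1536.

(* The cutoffs make the system globally Lipschitz; they are inactive along the
   solutions that are kept. *)
Let cl := clamp (-1) (1 : R).
Let rhs1 (s x y : R) := 1 - expR (- cl y).
Let rhs2 (s x y : R) :=
  (A (Num.max s s1) - expR (cl x - 2 * cl y)) / (B * Num.max s s1).

Let s_gt0 (s : R) : s1 <= s -> 0 < s.
Proof. by move=> ss; apply: lt_le_trans (le_trans s1_ge1 ss). Qed.

Let Bs0 (s : R) : s1 <= s -> 0 < B * s.
Proof. by move=> ss; apply: mulr_gt0 (s_gt0 ss); exact: lt_le_trans B1. Qed.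

Let Bsy0 (s y : R) : s1 <= s -> 0 <= B * s * y ^+ 2.
Proof. by move=> ss; apply: mulr_ge0 (sqr_ge0 _); exact/ltW/Bs0. Qed.

Let k0 (s : R) : s1 <= s -> 0 < k s.
Proof. by move=> ss; rewrite /k invr_gt0 sqrtr_gt0 Bs0. Qed.

Let k2 (s : R) : s1 <= s -> k s ^+ 2 * (B * s) = 1.
Proof.
move=> ss; rewrite /k exprVn sqr_sqrtr ?mulVf ?gt_eqF ?Bs0//.
by rewrite ltW ?Bs0.
Qed.

Let CS0 (s : R) : s1 <= s -> 0 <= C * S s.
Proof. by move=> ss; apply: mulr_ge0; [exact: ltW|exact: S_ge0]. Qed.

Let CBS0 (s : R) : s1 <= s -> 0 <= C * B * S s.
Proof.
by move=> ss; apply: mulr_ge0; [apply: mulr_ge0; slra|exact: S_ge0].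
Qed.

Let A_near1k (s : R) : s1 <= s -> `|1 - A s| <= k s / 16.
Proof.
move=> ss; rewrite distrC; apply: le_trans (A_near1 ss) _.
have := S_small ss; have := k0 ss.
have : 0 <= C * S s * (B - 1) by apply: mulr_ge0; [exact: CS0|slra].
have := CS0 ss.
by slra.
Qed.

Let A_gt0 (s : R) : s1 <= s -> 2^-1 <= A s <= 2.
Proof.
move=> ss; have /andP[] := ler_norm_bound (A_near1k ss).
by have := k_small ss; slra.
Qed.

Let A_inv (s : R) : s1 <= s -> `|(A s)^-1| <= 2.
Proof.
move=> /A_gt0/andP[A2 _]; have A0 : 0 < A s by apply: lt_le_trans A2; rewrite invr_gt0.
by rewrite gtr0_norm ?invr_gt0// -[leRHS]invrK lef_pV2 ?posrE ?invr_gt0.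
Qed.

Let lam s x := x - ln (A s).
Let N (s x y : R) := Num.sqrt (lam s x ^+ 2 + B * s * y ^+ 2).
Let E (s x y : R) := lam s x ^+ 2 + B * s * y ^+ 2 - lam s x * y.
Let dlam (s x y : R) := rhs1 s x y - dA s / A s.
Let dE (s x y : R) := 2 * lam s x * dlam s x y + B * y ^+ 2
  + 2 * (B * s) * y * rhs2 s x y - dlam s x y * y - lam s x * rhs2 s x y.

Let N2 (s x y : R) : s1 <= s -> N s x y ^+ 2 = lam s x ^+ 2 + (y / k s) ^+ 2.
Proof.
move=> ss; rewrite /N sqr_sqrtr; last exact: addr_ge0 (sqr_ge0 _) (Bsy0 y ss).
congr (_ + _); have := k2 ss; have := k0 ss.
by move: (k s) (B * s) => q p q0 e; rewrite exprMn exprVn; apply: (mulfI (x := q ^+ 2));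
  [rewrite gt_eqF// exprn_gt0|rewrite mulrA e mul1r mulrCA divff ?mulr1// gt_eqF// exprn_gt0].
Qed.

Let N0 (s x y : R) : 0 <= N s x y. Proof. exact: sqrtr_ge0. Qed.

Let lamN (s x y : R) : s1 <= s -> `|lam s x| <= N s x y.
Proof.
move=> ss; rewrite -(ler_pXn2r (n := 2))// ?nnegrE ?N0// real_normK ?num_real//.
by rewrite N2// lerDl sqr_ge0.
Qed.

Let yN (s x y : R) : s1 <= s -> `|y / k s| <= N s x y.
Proof.
move=> ss; rewrite -(ler_pXn2r (n := 2))// ?nnegrE ?N0// real_normK ?num_real//.
by rewrite N2// lerDr sqr_ge0.
Qed.

Let yN' s x y : s1 <= s -> `|y| <= k s * N s x y.
Proof.
move=> ss; rewrite -[X in `|X|](divfK (x := k s)) ?gt_eqF ?k0//.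
rewrite normrM mulrC (gtr0_norm (k0 ss)) ler_wpM2l ?yN// ltW// k0//.
Qed.

Let unclamped (s x y : R) : s1 <= s -> N s x y <= k s / 384 -> `|x| <= 1 /\ `|y| <= 1.
Proof.
move=> ss Nk; have hk := k_small ss; have hk0 := k0 ss; have [hA _] := andP (A_gt0 ss).
have hl := ln_near1 hA; have hA1 := A_near1k ss; rewrite distrC in hA1.
split.
  rewrite -[x](subrK (ln (A s))); apply: le_trans (ler_normD _ _) _.
  by have := lamN x y ss; rewrite /lam; slra.
apply: le_trans (yN' x y ss) _.
have : k s * N s x y <= 1 * N s x y by apply: ler_wpM2r; [exact: N0|slra].
by slra.
Qed.

Let energy_equiv (s x y : R) : s1 <= s ->
  N s x y ^+ 2 / 2 <= E s x y <= 2 * N s x y ^+ 2.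
Proof.
move=> ss; rewrite /E.
rewrite (_ : lam s x ^+ 2 + B * s * y ^+ 2 = N s x y ^+ 2); last first.
  by rewrite /N sqr_sqrtr//; exact: addr_ge0 (sqr_ge0 _) (Bsy0 y ss).
have := ler_norm_bound (ler_normM_bound (lamN x y ss) (yN' x y ss)).
have : k s * N s x y ^+ 2 <= 2^-1 * N s x y ^+ 2.
  by apply: ler_wpM2r; [rewrite sqr_ge0|have := k_small ss; slra].
by have := sqr_ge0 (N s x y); rewrite expr2 => ? ? /andP[? ?]; apply/andP; split; lra.
Qed.

(** The forcing term l = A' / A is at most 2 C S / s, and 1 / s = B k^2. The lower bound of
    [energy_derivative_ge] therefore becomes k^2 N (N - 12 C B S) / 2. *)
Let energy_increasing (s x y : R) : s1 <= s -> N s x y <= k s / 384 ->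
  12 * C * B * S s < N s x y -> 0 < dE s x y.
Proof.
move=> ss Nk SN; have [x1 y1] := unclamped ss Nk.
have hk := k_small ss; have hk0 := k0 ss.
have [hA hA2] := andP (A_gt0 ss).
have clx : cl x = x by rewrite /cl clamp_id// -ler_norml.
have cly : cl y = y by rewrite /cl clamp_id// -ler_norml.
have ms : Num.max s s1 = s by apply/max_idPl.
set w := lam s x - 2 * y.
set r1 := expR (- y) - 1 + y.
set r2 := expR w - 1 - w.
set l := dA s / A s.
have E1 : rhs1 s x y = y - r1 by rewrite /rhs1 cly /r1; ring.
have E2 : (B * s) * rhs2 s x y = - (A s * (w + r2)).
  rewrite /rhs2 ms clx cly mulrC divfK ?gt_eqF ?Bs0//.
  have -> : x - 2 * y = ln (A s) + w by rewrite /w /lam; ring.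
  rewrite expRD lnK ?posrE; last by slra.
  by rewrite /r2; ring.
have E3 : rhs2 s x y = - (A s * (w + r2)) * k s ^+ 2.
  by rewrite -E2 mulrAC [_ * k s ^+ 2]mulrC k2// mul1r.
have Nk1 : N s x y <= 384^-1 by slra.
have hx := lamN x y ss; have hy := yN' x y ss; have N0' := N0 s x y.
have hy1 : `|y| <= N s x y.
  apply: le_trans hy _; rewrite -[leRHS]mul1r; apply: ler_wpM2r => //; slra.
have hr1 : `|r1| <= k s ^+ 2 * N s x y ^+ 2.
  have -> : r1 = expR (- y) - 1 - - y by rewrite /r1; ring.
  apply: le_trans (expR_remainder2 _) _; first by rewrite normrN.
  rewrite sqrrN -exprMn -(real_normK (num_real y)) ler_pXn2r// nnegrE.
  by rewrite mulr_ge0// ltW.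
have hw : `|w| <= 2 * N s x y.
  apply: le_trans (ler_normB _ _) _; rewrite normrM gtr0_norm//.
  have : k s * N s x y <= 32^-1 * N s x y by apply: ler_wpM2r.
  by slra.
have hr2 : `|r2| <= 4 * N s x y ^+ 2.
  apply: le_trans (expR_remainder2 _) _; first by slra.
  rewrite (_ : 4 * N s x y ^+ 2 = (2 * N s x y) ^+ 2); last by ring.
  by rewrite -(real_normK (num_real w)) ler_pXn2r// nnegrE ?mulr_ge0.
have hl : `|l| <= 2 * C * S s / s.
  rewrite /l normrM; apply: le_trans (_ : (C * S s / s) * 2 <= _).
    by apply: ler_pM => //; [exact: dA_small|exact: A_inv].
  by rewrite le_eqVlt; apply/orP; left; apply/eqP; ring.
have := @energy_derivative_ge R B (A s) (k s) (lam s x) (y / k s) l r1 r2 (N s x y)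
  B1 _ (A_near1k ss) _ (N2 x y ss) hr1 hr2.
rewrite hk0 hk N0' Nk => /(_ isT isT).
set rhs := (X in _ <= X).
have -> : rhs = dE s x y.
  have e2 : 2 * (B * s) * y * rhs2 s x y = 2 * y * (B * s * rhs2 s x y) by ring.
  rewrite /rhs /dE /dlam E1 e2 E2 E3 -/l /w.
  by move: hk0 => /gt_eqF/negbT kn0; field.
apply: lt_le_trans.
have h1 : 3 * N s x y * `|l| <= 3 * N s x y * (2 * C * S s / s).
  by apply: ler_wpM2l => //; slra.
have s0 := s_gt0 ss.
have h2 : s^-1 = B * k s ^+ 2.
  by apply: (mulfI (x := s)); rewrite ?gt_eqF// divff ?gt_eqF// mulrA -(k2 ss); ring.
have h3 : 0 < k s ^+ 2 * N s x y * (N s x y - 12 * C * B * S s).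
  have SNp : 0 <= 12 * C * B * S s.
    by rewrite -!mulrA mulr_ge0// mulrA CBS0.
  apply: mulr_gt0; last by rewrite subr_gt0.
  by apply: mulr_gt0; [exact: exprn_gt0|slra].
by move: h1; rewrite h2; slra.
Qed.

Section Approximation.
Variables (n : R) (X Y : R -> R).
Hypothesis sn : s1 <= n.
Hypothesis X_derive : forall s : R, is_derive s 1 X (rhs1 s (X s) (Y s)).
Hypothesis Y_derive : forall s : R, is_derive s 1 Y (rhs2 s (X s) (Y s)).
Hypotheses (Xn : X n = ln (A n)) (Yn : Y n = 0).

Let e (s : R) := E s (X s) (Y s).

Let e_derive (s : R) : s1 <= s -> is_derive s (1 : R) e (dE s (X s) (Y s)).
Proof.
move=> ss; have hA : 0 < A s by have := A_gt0 ss; slra.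
have dl : is_derive s (1 : R) (fun s => lam s (X s)) (dlam s (X s) (Y s)).
  have := is_derive_Bl (X_derive s) (is_derive_lnl hA (A_derive ss)).
  by rewrite mulrC.
have := is_derive_Bl (is_derive_Dl (is_derive_sqrl dl) (is_derive_Ml
  (is_derive_Ml (is_derive_cstl B s (1 : R)) (is_derive_idl s))
  (is_derive_sqrl (Y_derive s)))) (is_derive_Ml dl (Y_derive s)).
by move/is_derive_eq; apply; rewrite /dE; ring.
Qed.

Let en : e n = 0.
Proof. by rewrite /e /E /lam Xn Yn subrr; ring. Qed.

(** Keeping the energy below k^2 / (2 * 384^2) gives N <= k / 384. Since k^2 = 1 / (B s),
    multiplying by s turns this into a level that does not depend on s, as the barrier argument
    requires. *)
Let kap := (2 * 384 ^+ 2 * B)^-1.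
Let kap0 : 0 < kap. Proof. by rewrite /kap invr_gt0; apply: mulr_gt0; slra. Qed.
Let kapB (s : R) : s1 <= s -> kap = s * (k s ^+ 2 / (2 * 384 ^+ 2)).
Proof.
move=> ss; have B0 : B != 0 by rewrite gt_eqF//; slra.
transitivity (k s ^+ 2 * (B * s) * kap); first by rewrite k2// mul1r.
by rewrite /kap; move: (k s) => q; field.
Qed.

Let small_of_e (s : R) : s1 <= s -> s * e s <= kap -> N s (X s) (Y s) <= k s / 384.
Proof.
move=> ss; rewrite (kapB ss) ler_pM2l; last exact: s_gt0.
move=> h; have /andP[h1 _] := energy_equiv (X s) (Y s) ss.
apply: ler_of_sqr; first by have := k0 ss; lra.
by rewrite expr_div_n; move: h1 h; rewrite /e; lra.
Qed.

Lemma profile_approx_small (s : R) : s1 <= s <= n -> N s (X s) (Y s) <= k s / 384.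
Proof.
move=> /andP[s1s sn']; apply: small_of_e => //; apply: ltW.
apply: (@barrier_backward R (fun s => s * e s)
  (fun s => 1 * e s + s * dE s (X s) (Y s)) s1 n kap sn).
- by rewrite en mulr0 kap0.
- by move=> t /andP[s1t _]; exact: (is_derive_Ml (is_derive_idl t) (e_derive s1t)).
- move=> t /andP[s1t tn] ht.
  have hN : N t (X t) (Y t) <= k t / 384 by apply: small_of_e => //; rewrite ht.
  have t0 := s_gt0 s1t.
  have e0 : 0 < e t by rewrite -(pmulr_rgt0 _ t0) ht.
  have /andP[_ h2] := energy_equiv (X t) (Y t) s1t.
  have hE : e t = k t ^+ 2 / (2 * 384 ^+ 2).
    by apply: (mulfI (x := t)); rewrite ?gt_eqF// ht (kapB s1t).
  have kt := k0 s1t.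
  (* At the exit level N is still at least k / 768, as the energy is at most 2 N^2. The constant
     1536 in [S_small] is twice 768, which leaves 12 C B S strictly below N. *)
  have hN2 : k t / 768 <= N t (X t) (Y t).
    apply: ler_of_sqr; first exact: N0.
    by move: h2; rewrite -/(e t) hE expr_div_n; lra.
  have : 0 < dE t (X t) (Y t).
    by apply: energy_increasing => //; have := S_small s1t; slra.
  by move=> /(mulr_gt0 t0); slra.
- by rewrite s1s.
Qed.

(** Suppose the energy at s exceeded 2 (12 C B S(s))^2. At any later time with the same energy N
    would exceed 12 C B S, as S is nonincreasing, and the energy would be increasing. The barrier at
    the level [e s], the value at the left end itself, then gives the absurd [e s < e s]. *)
Lemma profile_approx_bound (s : R) : s1 <= s <= n ->
  N s (X s) (Y s) <= 24 * C * B * S s.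
Proof.
move=> /andP[s1s sn']; have CB0 : 0 < C * B by apply: mulr_gt0; slra.
have SCB := CBS0 s1s.
suff : e s <= 2 * (12 * C * B * S s) ^+ 2.
  have /andP[h1 _] := energy_equiv (X s) (Y s) s1s.
  move=> h2; apply: ler_of_sqr; first by lra.
  apply: le_trans (_ : 2 * e s <= _); first by rewrite /e; slra.
  by apply: le_trans (ler_wpM2l _ h2) _ => //; rewrite le_eqVlt; apply/orP; left; apply/eqP; ring.
rewrite leNgt; apply/negP => hc.
have e0 : 0 <= 2 * (12 * C * B * S s) ^+ 2 by rewrite mulr_ge0// sqr_ge0.
have H : e n < e s by rewrite en (le_lt_trans e0).
have de t : s <= t <= n -> is_derive t (1 : R) e (dE t (X t) (Y t)).
  by move=> /andP[st _]; exact: e_derive (le_trans s1s st).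
suff : e s < e s by rewrite ltxx.
apply: (@barrier_backward R e _ s n (e s) sn' H de); last by rewrite lexx sn'.
move=> t /andP[st tn] et; have s1t := le_trans s1s st.
apply: energy_increasing => //; first by apply: profile_approx_small; rewrite s1t ltW.
have /andP[_ h2] := energy_equiv (X t) (Y t) s1t.
rewrite ltNge; apply/negP => hN.
have : N t (X t) (Y t) ^+ 2 <= (12 * C * B * S s) ^+ 2.
  apply: le_trans (_ : (12 * C * B * S t) ^+ 2 <= _).
    by rewrite ler_sqr// nnegrE ?N0//; have := CBS0 s1t; lra.
  rewrite ler_sqr ?nnegrE; last 2 first.
  - by have := CBS0 s1t; lra.
  - by lra.
  by have := ler_wpM2l (ltW CB0) (S_decr s1s st); lra.
by move: h2 hc; rewrite -/(e t) et; lra.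
Qed.

End Approximation.

Let Lip := 2 * expR 3 : R.

Let max_ge (s : R) : s1 <= Num.max s s1. Proof. by rewrite le_max lexx orbT. Qed.

Let BM (s : R) : 0 < (B * Num.max s s1)^-1 <= 1.
Proof.
have := Bs0 (max_ge s); have := max_ge s; move: (Num.max s s1) => m sm Bm.
rewrite invr_gt0 Bm invf_le1//=.
apply: le_trans (_ : 1 * m <= _); first by slra.
by apply: ler_wpM2r; slra.
Qed.

Let cl_itv x : -1 <= cl x <= 1. Proof. by apply: clamp_itv; slra. Qed.

Let lip1 (t x y x' y' : R) :
  `|rhs1 t x y - rhs1 t x' y'| <= Lip * (`|x - x'| + `|y - y'|).
Proof.
have -> : rhs1 t x y - rhs1 t x' y' = expR (- cl y') - expR (- cl y).
  by rewrite /rhs1; ring.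
have := cl_itv y; have := cl_itv y' => /andP[? ?] /andP[? ?].
apply: le_trans (@expR_lip R _ _ 3 _ _) _; [slra|slra|].
have -> : - cl y' - - cl y = cl y - cl y' by ring.
have h := clamp_lip (-1) 1 y y'; have e3 := expR_ge0 (3 : R).
have := ler_wpM2l e3 h; have := mulr_ge0 e3 (normr_ge0 (x - x')).
have := mulr_ge0 e3 (normr_ge0 (y - y')); rewrite /Lip -/cl; slra.
Qed.

Let lip2 (t x y x' y' : R) :
  `|rhs2 t x y - rhs2 t x' y'| <= Lip * (`|x - x'| + `|y - y'|).
Proof.
have -> : rhs2 t x y - rhs2 t x' y' = (expR (cl x' - 2 * cl y') -
   expR (cl x - 2 * cl y)) * (B * Num.max t s1)^-1 by rewrite /rhs2; ring.
have /andP[b0 b1] := BM t.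
have := cl_itv y; have := cl_itv y' => /andP[? ?] /andP[? ?].
have := cl_itv x; have := cl_itv x' => /andP[? ?] /andP[? ?].
rewrite normrM (gtr0_norm b0) -[leRHS]mulr1; apply: ler_pM => //; first exact: ltW.
apply: le_trans (@expR_lip R _ _ 3 _ _) _; [slra|slra|].
have -> : cl x' - 2 * cl y' - (cl x - 2 * cl y) = - (cl x - cl x') + 2 * (cl y - cl y') by ring.
have e3 := expR_ge0 (3 : R).
rewrite (_ : Lip * _ = expR 3 * (2 * (`|x - x'| + `|y - y'|))); last first.
  by rewrite /Lip; ring.
apply: ler_wpM2l => //.
apply: le_trans (ler_normD _ _) _; rewrite normrN normrM gtr0_norm//.
have := clamp_lip (-1) 1 y y'; have := clamp_lip (-1) 1 x x'.
by rewrite -/cl; have := normr_ge0 (x - x'); slra.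
Qed.

Let bnd1 (t x y : R) : `|rhs1 t x y| <= 2 + expR 3.
Proof.
rewrite /rhs1; apply: le_trans (ler_normB _ _) _.
rewrite normr1 ger0_norm ?expR_ge0//.
have : expR (- cl y) <= expR 3 by rewrite ler_expR; have := cl_itv y; slra.
by slra.
Qed.

Let bnd2 (t x y : R) : `|rhs2 t x y| <= 2 + expR 3.
Proof.
rewrite /rhs2; have /andP[b0 b1] := BM t.
rewrite normrM (gtr0_norm b0) -[leRHS]mulr1; apply: ler_pM => //; first exact: ltW.
apply: le_trans (ler_normB _ _) _; rewrite [`|expR _|]ger0_norm ?expR_ge0//.
have /andP[? ?] := A_gt0 (max_ge t).
apply: lerD; first by rewrite ger0_norm; slra.
by rewrite ler_expR; have := cl_itv y; have := cl_itv x; slra.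
Qed.

Let cl_cont (X : R -> R) (t : R) : continuous X -> {for t, continuous (fun t => cl (X t))}.
Proof. by move=> cX; apply (@cont_comp R R); [exact: cX|exact: clamp_continuous]. Qed.

Let cont1 (X Y : R -> R) : continuous X -> continuous Y ->
  continuous (fun t => rhs1 t (X t) (Y t)).
Proof.
move=> cX cY t; rewrite /rhs1; apply (@cont_sub R R); first exact: cont_cst.
apply (@cont_comp R R); last exact: continuous_expR.
by apply (@cont_opp R R); exact: cl_cont.
Qed.

Let max_cont : continuous (fun t : R => Num.max t s1).
Proof.
apply: (@lip_continuous _ _ 1) => x y; rewrite mul1r.
have h1 := ler_norm (x - y); have h2 := ler_norm (y - x).
rewrite distrC in h2; rewrite ler_norml.
by case: (leP x s1) => ?; case: (leP y s1) => ?; apply/andP; split; lra.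
Qed.

Let cont2 (X Y : R -> R) : continuous X -> continuous Y ->
  continuous (fun t => rhs2 t (X t) (Y t)).
Proof.
move=> cX cY t; rewrite /rhs2; apply (@cont_mul R R); last first.
  apply (@cont_inv R R); first by rewrite gt_eqF// Bs0.
  by apply (@cont_mul R R); [exact: cont_cst|exact: max_cont].
apply (@cont_sub R R).
  apply (@cont_comp R R); first exact: max_cont.
  by apply: is_derive_cont; exact: A_derive.
apply (@cont_comp R R); last exact: continuous_expR.
apply (@cont_sub R R); first exact: cl_cont.
by apply (@cont_mul R R); [exact: cont_cst|exact: cl_cont].
Qed.

Let solve t0 x0 y0 : exists X Y : R -> R, [/\ X t0 = x0, Y t0 = y0,
  forall s : R, is_derive s 1 X (rhs1 s (X s) (Y s)) &
  forall s : R, is_derive s 1 Y (rhs2 s (X s) (Y s))].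
Proof.
have [||||Z [Z0 dZ]] := @picard_exists R (fun b => if b then rhs1 else rhs2) Lip
  (2 + expR 3) t0 (fun b => if b then x0 else y0).
- by rewrite /Lip mulr_gt0 ?expR_gt0.
- by case=> X Y cX cY; [exact: cont1|exact: cont2].
- by case=> t x y x' y'; [exact: lip1|exact: lip2].
- by case=> t; [exact: bnd1|exact: bnd2].
exists (Z true), (Z false); split; first exact: (Z0 true).
- exact: (Z0 false).
- exact: (dZ true).
- exact: (dZ false).
Qed.

(* c is del truncated, so that mu is differentiable on the whole line. *)
Lemma singular_profile_exists : exists mu c del : R -> R,
  [/\ forall s, s1 <= s -> `|mu s| <= 26 * C * B * S s,
      forall s, s1 <= s -> [/\ `|mu s| <= 1, `|del s| <= 1 & c s = del s],
      forall s, `|c s| <= 1,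
      forall s : R, is_derive s 1 mu (1 - expR (- c s)) &
      forall s : R, s1 <= s ->
        is_derive s 1 del ((A s - expR (mu s - 2 * del s)) / (B * s))].
Proof.
pose sol (n : nat) := solve (s1 + n%:R) (ln (A (s1 + n%:R))) 0.
pose Xn n := projT1 (cid (sol n)).
pose Yn n := projT1 (cid (projT2 (cid (sol n)))).
have XYn n : [/\ Xn n (s1 + n%:R) = ln (A (s1 + n%:R)), Yn n (s1 + n%:R) = 0,
  forall s : R, is_derive s 1 (Xn n) (rhs1 s (Xn n s) (Yn n s)) &
  forall s : R, is_derive s 1 (Yn n) (rhs2 s (Xn n s) (Yn n s))].
  exact: projT2 (cid (projT2 (cid (sol n)))).
have good n s : s1 <= s <= s1 + n%:R ->
    [/\ `|Xn n s| <= 26 * C * B * S s, `|Xn n s| <= 1 & `|Yn n s| <= 1].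
  move=> h; have [e1 e2 d1 d2] := XYn n; have /andP[s1s sn] := h.
  have nn : s1 <= s1 + n%:R by rewrite lerDl.
  have sm := profile_approx_small nn d1 d2 e1 e2 h.
  have bd := profile_approx_bound nn d1 d2 e1 e2 h.
  have [? ?] := unclamped s1s sm; split => //.
  (* |mu| <= |lam| + |log A| <= 24 C B S + 2 C S, and B >= 1 gives the constant 26. *)
  rewrite -[Xn n s](subrK (ln (A s))); apply: le_trans (ler_normD _ _) _.
  have := lamN (Xn n s) (Yn n s) s1s; rewrite /lam.
  have [hA _] := andP (A_gt0 s1s); have := ln_near1 hA; have := A_near1 s1s.
  have : 0 <= C * S s * (B - 1) by apply: mulr_ge0; [exact: CS0|slra].
  by slra.
have s1n (n : nat) : s1 <= s1 <= s1 + n%:R by apply/andP; split; rewrite ?lexx ?lerDl ?ler0n.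
have [a [b cl_ab]] : exists a b, forall e m, 0 < e -> exists n,
    [/\ (m <= n)%N, `|Xn n s1 - a| < e & `|Yn n s1 - b| < e].
  by apply: bounded_pair_cluster => n; have [] := good n s1 (s1n n).
have [X [Y [X1 Y1 dX dY]]] := solve s1 a b.
(* The limit is taken through the data at [s1] only: for fixed s, Gronwall's factor G on [s1, s] is
   fixed too, so an approximation whose data are within e / (2 G) of the cluster point is within e
   of the limit solution at s. All closed bounds then pass to the limit. *)
have approx s e : s1 <= s -> 0 < e -> exists n,
    [/\ s1 <= s <= s1 + n%:R, `|X s - Xn n s| <= e & `|Y s - Yn n s| <= e].
  move=> s1s e0; pose G := expR (4 * Lip * (s - s1)).
  have G1 : 1 <= G.
    rewrite -[leLHS]expR0 ler_expR mulr_ge0 ?subr_ge0//.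
    by rewrite mulr_ge0// /Lip mulr_ge0// expR_ge0.
  have G0 : 0 < G by exact: lt_le_trans G1.
  have d0 : 0 < e / (2 * G) by rewrite divr_gt0// mulr_gt0.
  have [n [mn h1 h2]] := cl_ab (e / (2 * G)) (Num.truncn (s - s1)).+1 d0.
  have hn : s <= s1 + n%:R.
    rewrite -lerBlDl; apply: le_trans (ltW (truncnS_gt _)) _.
    by rewrite ler_nat.
  exists n; have [_ _ d1 d2] := XYn n.
  have Lip0 : 0 <= Lip by rewrite /Lip mulr_ge0 ?expR_ge0.
  have := @gronwall_pair R rhs1 rhs2 Lip lip1 lip2 X Y (Xn n) (Yn n) s1 s s1s
    Lip0 (fun t _ => dX t) (fun t _ => dY t) (fun t _ => d1 t) (fun t _ => d2 t).
  rewrite X1 Y1 -/G.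
  have sq (u v : R) : `|u - v| < e / (2 * G) -> (v - u) ^+ 2 <= (e / (2 * G)) ^+ 2.
    move=> h; rewrite -(real_normK (num_real _)) distrC ler_pXn2r// ?nnegrE//; exact: ltW.
  have := sq _ _ h1; have := sq _ _ h2 => q1 q2 q3.
  have q4 : (X s - Xn n s) ^+ 2 + (Y s - Yn n s) ^+ 2 <= e ^+ 2.
    apply: le_trans q3 _; apply: le_trans (_ : (2 * (e / (2 * G)) ^+ 2) * G <= _).
      by apply: ler_wpM2r; [exact: ltW|rewrite mulr_natl mulr2n; exact: lerD].
    rewrite (_ : 2 * (e / (2 * G)) ^+ 2 * G = e ^+ 2 / (2 * G)); last first.
      by field; rewrite gt_eqF.
    have G2 : 1 <= 2 * G by rewrite mulr_natl mulr2n (le_trans G1)// lerDl ltW.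
    by rewrite ler_pdivrMr ?(lt_le_trans _ G2)// ler_peMr ?sqr_ge0.
  have norm_le (u : R) : u ^+ 2 <= e ^+ 2 -> `|u| <= e.
    by rewrite -(real_normK (num_real u)) ler_pXn2r// nnegrE ltW.
  split; first by rewrite s1s.
  - by apply: norm_le; apply: le_trans q4; rewrite lerDl sqr_ge0.
  - by apply: norm_le; apply: le_trans q4; rewrite lerDr sqr_ge0.
have limle (u : R) (v : nat -> R) M : (forall e, 0 < e -> exists n, `|u - v n| <= e /\ `|v n| <= M) ->
    `|u| <= M.
  move=> h; rewrite leNgt; apply/negP => Mu.
  have [n [h1 h2]] := h ((`|u| - M) / 2) ltac:(slra).
  have : `|u| <= `|u - v n| + `|v n| by rewrite -[X in `|X| <= _](subrK (v n)) ler_normD.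
  by slra.
exists X, (fun s => cl (Y s)), Y; split.
- move=> s s1s; apply: (limle _ (fun n => Xn n s)) => e e0.
  by have [n [h1 h2 h3]] := approx s e s1s e0; exists n; split => //; have [] := good n s h1.
- move=> s s1s.
  have hY : `|Y s| <= 1.
    apply: (limle _ (fun n => Yn n s)) => e e0.
    by have [n [h1 h2 h3]] := approx s e s1s e0; exists n; split => //; have [] := good n s h1.
  split=> //; last by rewrite /cl clamp_id// -ler_norml.
  apply: (limle _ (fun n => Xn n s)) => e e0.
  by have [n [h1 h2 h3]] := approx s e s1s e0; exists n; split => //; have [] := good n s h1.
- by move=> s; rewrite ler_norml; exact: cl_itv.
- exact: dX.
- move=> s s1s.
  have hY : `|Y s| <= 1.
    apply: (limle _ (fun n => Yn n s)) => e e0.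
    by have [n [h1 h2 h3]] := approx s e s1s e0; exists n; split => //; have [] := good n s h1.
  have hX : `|X s| <= 1.
    apply: (limle _ (fun n => Xn n s)) => e e0.
    by have [n [h1 h2 h3]] := approx s e s1s e0; exists n; split => //; have [] := good n s h1.
  have := dY s; rewrite /rhs2 (max_idPl s1s) /cl !clamp_id//; rewrite -ler_norml//.
Qed.

End SingularProfile.

(** * The tail integral and its inverse *)

Section TailIntegral.
Variables (R : realType) (f : R -> R).
Local Notation mu := (@lebesgue_measure R).
Hypothesis f_gt0 : forall s : R, 0 < s -> 0 < f s.
Hypothesis f_tail : forall s : R, 0 < s -> (tailint f s < +oo)%E.
Hypothesis f_cont : forall s : R, 0 < s -> {for s, continuous f}.

Let h (s : R) := (f s)^-1.

Let h_cont (s : R) : 0 < s -> {for s, continuous h}.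
Proof.
by move=> s0; apply: cont_inv; [rewrite gt_eqF// f_gt0|exact: f_cont].
Qed.

Let h_ge0 (s : R) : 0 < s -> 0 <= h s.
Proof. by move=> s0; rewrite invr_ge0 ltW// f_gt0. Qed.

Let h_int (s : R) : 0 < s -> mu.-integrable `[s, +oo[ (EFin \o h).
Proof.
move=> s0; apply/integrableP; split.
  have mh : measurable_fun (`]0, +oo[%classic : set (measurableTypeR R)) h.
    apply: open_continuous_measurable_fun; first exact: interval_open.
    by move=> x; rewrite inE/= in_itv/= andbT; exact: h_cont.
  apply/measurable_EFinP; apply: (measurable_funS _ _ mh) => //.
  by move=> x /=; rewrite !in_itv/= !andbT; exact: lt_le_trans.
have := f_tail s0; rewrite /tailint; congr (_ < _)%E.
apply: eq_integral => x; rewrite inE/= in_itv/= andbT => sx.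
by rewrite ger0_norm// h_ge0// (lt_le_trans s0).
Qed.

Lemma Fint_sub (a s : R) : 0 < a -> a < s ->
  Fint f s = Fint f a - \int[mu]_(t in `[a, s]) (f t)^-1.
Proof.
move=> a0 as_; have := @Rintegral_itvB R h (BLeft a) +oo%O s (h_int a0) _ _.
rewrite !bnd_simp ltW// => /(_ isT isT).
rewrite (@Rintegral_itv_obnd_cbnd R s +oo%O h); first by move/esym; exact.
apply: integrableS (h_int a0) => //.
by move=> x /=; rewrite !in_itv/= !andbT => /ltW; apply: le_trans; exact: ltW.
Qed.

Lemma is_derive_Fint (s : R) : 0 < s -> is_derive s 1 (Fint f) (- (f s)^-1).
Proof.
move=> s0; pose a := s / 2.
have a0 : 0 < a by rewrite /a divr_gt0.
have as_ : a < s by rewrite /a; lra.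
have hi : mu.-integrable `[a, s + 1] (EFin \o h).
  apply: integrableS (h_int a0) => //.
  by move=> x /=; rewrite !in_itv/= andbT => /andP[].
have [dG GE] := @continuous_FTC1_closed _ h a s (s + 1) ltac:(lra) hi as_ (h_cont s0).
have dG' : is_derive s 1 (fun u => \int[mu]_(t in `[a, u]) h t) (h s).
  by split; [exact: dG|rewrite -derive1E; exact: GE].
apply: (@near_eq_is_derive _ _ _ (fun u => Fint f a - \int[mu]_(t in `[a, u]) h t)).
  near=> u; rewrite (@Fint_sub a u)//.
  by near: u; exact: lt_nbhsr.
rewrite -[X in is_derive _ _ _ X]add0r; apply: is_derive_Bl.
Unshelve. all: by end_near. Qed.

Lemma Fint_decr (s t : R) : 0 < s -> s < t -> Fint f t < Fint f s.
Proof.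
move=> s0 st; rewrite -ltrN2.
apply: (@is_derive_gt0_lt _ (fun x => - Fint f x) (fun x => (f x)^-1)) => //.
- move=> x /andP[sx _]; rewrite -[(f x)^-1]opprK; apply: is_derive_Nl.
  by apply: is_derive_Fint; exact: lt_le_trans sx.
- by move=> x /andP[sx _]; rewrite invr_gt0 f_gt0// (lt_trans s0).
Qed.

Lemma Fint_gt0 (s : R) : 0 < s -> 0 < Fint f s.
Proof.
move=> s0; have s1 : 0 < s + 1 by lra.
apply: le_lt_trans (_ : Fint f (s + 1) < _); last by apply: Fint_decr => //; lra.
rewrite /Fint fine_ge0// integral_ge0// => x /=; rewrite in_itv/= andbT => sx.
by rewrite lee_fin h_ge0// (lt_le_trans s1).
Qed.

(** -F is monotone and bounded, so it has some limit l; the fundamental theorem on [1, +oo[ then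
    reads F(1) = l + F(1), whence l = 0. *)
Lemma Fint_cvg0 : Fint f s @[s --> +oo] --> 0.
Proof.
(* F is known to be decreasing only on ]0, +oo[; the maximum makes the function monotone on the
   whole line without changing it near +oo. *)
pose m (s : R) := - Fint f (Num.max s 1).
have m0 (s : R) : 0 < Num.max s 1 by rewrite lt_max ltr01 orbT.
have mnd : nondecreasing_fun m.
  move=> x y xy; rewrite /m lerN2.
  have : Num.max x 1 <= Num.max y 1 by rewrite ge_max !le_max xy lexx !orbT.
  rewrite le_eqVlt => /predU1P[->//|/Fint_decr/ltW]; exact.
have mub : has_ubound (range m).
  by exists 0 => _ [s _ <-]; rewrite /m oppr_le0 ltW// Fint_gt0.
have mcvg := nondecreasing_cvgr mnd mub.
set l := sup _ in mcvg.
have Fcvg : - Fint f s @[s --> +oo] --> l.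
  apply: cvg_trans mcvg; apply: near_eq_cvg; near=> s.
  rewrite /m (max_idPl _)//; near: s; exact: nbhs_pinfty_ge.
have FE : (\int[mu]_(x in `[1%R, +oo[) (h x)%:E = l%:E - (- Fint f 1%R)%R%:E)%E.
  have dF (x : R) : 0 < x -> is_derive x 1 (fun s => - Fint f s) (h x).
    by move=> x0; rewrite -[h x]opprK; apply: is_derive_Nl; exact: is_derive_Fint.
  apply: (@ge0_continuous_FTC2y R h (fun s => - Fint f s) 1 l) => //.
  - by move=> x x1; rewrite h_ge0//; lra.
  - apply: continuous_in_subspaceT => x; rewrite inE/= in_itv/= andbT => x1.
    by apply: h_cont; lra.
  - by move=> x x1; have [] := dF x ltac:(lra).
  - apply: cvg_at_right_filter; apply: (@is_derive_cont R _ 1 (h 1)).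
    by apply: dF; lra.
  - move=> x; rewrite in_itv/= andbT => x1.
    by rewrite derive1E; have [_ ->] := dF x ltac:(lra).
have F1 : tailint f 1 = (Fint f 1)%:E.
  rewrite /Fint fineK// ge0_fin_numE; first by apply: f_tail; lra.
  apply: integral_ge0 => x /=; rewrite in_itv/= andbT => x1.
  by rewrite lee_fin h_ge0//; lra.
have l0 : l = 0.
  move: FE; rewrite -/(tailint f 1) F1 -EFinB => -[]; rewrite opprK => e.
  by apply/eqP; rewrite -(addrK (Fint f 1) l) -e subrr.
rewrite -[X in _ --> X]oppr0 -l0.
have -> : Fint f = (fun s => - - Fint f s) by apply/funext => s; rewrite opprK.
exact: cvgN Fcvg.
Unshelve. all: by end_near. Qed.

Lemma Fint_inj : {in `]0, +oo[ &, injective (Fint f)}.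
Proof.
move=> s t; rewrite !in_itv/= !andbT => s0 t0 E; apply/eqP; rewrite eq_le !leNgt.
apply/andP; split; apply/negP => st.
  by have := Fint_decr t0 st; rewrite E ltxx.
by have := Fint_decr s0 st; rewrite E ltxx.
Qed.

Lemma FintK (s : R) : 0 < s -> Finv f (Fint f s) = s.
Proof.
move=> s0; rewrite /Finv.
apply: pinvKV; last by rewrite inE/= in_itv/= s0.
by move=> x y; rewrite !inE; exact: Fint_inj.
Qed.

Lemma Fint_attained (s y : R) : 0 < s -> 0 < y -> y < Fint f s ->
  exists2 t, s < t & Fint f t = y.
Proof.
move=> s0 y0 ys.
have /cvgrPdist_lt/(_ _ y0)[M [_ HM]] := Fint_cvg0.
pose t := Num.max (s + 1) (M + 1).
have st : s + 1 <= t by rewrite /t le_max lexx.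
have Mt : M < t by apply: lt_le_trans (_ : M + 1 <= _); [lra|rewrite /t le_max lexx orbT].
have t0 : 0 < t by lra.
have := HM _ Mt; rewrite /= sub0r normrN gtr0_norm ?Fint_gt0// => Ft.
have [|||c] := @IVT R (Fint f) s t y.
- by lra.
- apply: is_derive_within => x; rewrite in_itv/= => /andP[sx _].
  by apply: is_derive_Fint; lra.
- rewrite ge_min le_max; apply/andP; split; apply/orP; first by right; exact: ltW.
  by left; exact: ltW.
rewrite in_itv/= => /andP[sc _] Fc; exists c => //.
by rewrite lt_neqAle sc andbT; apply/eqP => e; move: ys; rewrite e Fc ltxx.
Qed.

Lemma is_derive_Finv (s : R) : 0 < s -> is_derive (Fint f s) 1 (Finv f) (- f s).
Proof.
move=> s0; rewrite -[f s]invrK -invrN.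
apply: (@is_derive_inverse R (Fint f)).
- near=> x; apply: FintK; near: x; exact: lt_nbhsr.
- near=> x; apply: is_derive_cont; apply: is_derive_Fint; near: x; exact: lt_nbhsr.
- exact: is_derive_Fint.
- by rewrite oppr_eq0 invr_eq0 gt_eqF// f_gt0.
Unshelve. all: by end_near. Qed.

End TailIntegral.

(** * The model nonlinearity *)

Section Coefficient.
Variables (R : realType) (B : R).
Implicit Types (phi ut : R -> R) (s : R).

(* [Gmodel s] is G(v(x)), and [Wmodel] is -[Gmodel]', at s = log(1/|x|^2). *)
Definition Gmodel s : R := B / 4 * ((s + 1) * expR (- s)).
Definition Wmodel s : R := B / 4 * (s * expR (- s)).

Lemma is_derive_Gmodel s : is_derive s 1 Gmodel (- Wmodel s).
Proof.
have := is_derive_Ml (is_derive_cstl (B / 4) s (1 : R)) (is_derive_Ml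
  (is_derive_Dl (is_derive_idl s) (is_derive_cstl 1 s (1 : R)))
  (is_derive_expRl (is_derive_Nl (is_derive_idl s)))).
by move/is_derive_eq; apply; rewrite /Wmodel; ring.
Qed.

Lemma is_derive_Wmodel s : s != 0 ->
  is_derive s 1 Wmodel (Wmodel s * (s^-1 - 1)).
Proof.
move=> s0; have := is_derive_Ml (is_derive_cstl (B / 4) s (1 : R)) (is_derive_Ml
  (is_derive_idl s) (is_derive_expRl (is_derive_Nl (is_derive_idl s)))).
by move/is_derive_eq; apply; rewrite /Wmodel; field.
Qed.

Lemma Wmodel_gt0 s : 0 < B -> 0 < s -> 0 < Wmodel s.
Proof. by move=> B0 s0; rewrite /Wmodel !pmulr_rgt0 ?divr_gt0 ?expR_gt0. Qed.

Lemma Gmodel_gt0 s : 0 < B -> 0 < s -> 0 < Gmodel s.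
Proof.
move=> B0 s0; rewrite /Gmodel pmulr_rgt0 ?divr_gt0// pmulr_rgt0 ?expR_gt0//.
by rewrite addr_gt0.
Qed.

Lemma WmodelE s : s + 1 != 0 -> Wmodel s = s / (s + 1) * Gmodel s.
Proof. by move=> s1; rewrite /Wmodel /Gmodel; field. Qed.

(** Where F(ut) = G this is 1 - phi' F at ut, which is 1/B_1 up to the factor -log G. *)
Definition defect phi ut s : R := 1 - derive1 phi (ut s) * Gmodel s.

(* [coefA] is -B s ut'' / ut' when ut' = phi(ut) Wmodel; it is identically 1
   for the model nonlinearity. *)
Definition coefA phi ut s : R :=
  - (B / (s + 1)) + B * defect phi ut s * (s ^+ 2 / (s + 1)).

Definition slope phi ut s : R := phi (ut s) * Wmodel s.

Lemma is_derive_slope phi ut s : B != 0 -> 0 < s -> derivable phi (ut s) 1 ->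
  is_derive s 1 ut (slope phi ut s) ->
  is_derive s 1 (slope phi ut) (- (coefA phi ut s / (B * s)) * slope phi ut s).
Proof.
move=> B0 s0 dphi dut.
have dphi' : is_derive (ut s) 1 phi (derive1 phi (ut s)).
  by split; [exact: dphi|exact: (esym (derive1E phi (ut s)))].
have sn0 : s != 0 by rewrite gt_eqF.
have s1 : s + 1 != 0 by rewrite gt_eqF// addr_gt0.
have := is_derive_Ml (is_derive_compl dut dphi') (is_derive_Wmodel sn0).
move/is_derive_eq; apply.
rewrite /slope /coefA /defect (WmodelE s1).
by field; rewrite B0 s1 sn0.
Qed.

(** The derivative is - phi' W (phi phi'' G / phi' - 1), by ut' = phi(ut) W; the bracket is the one
    in 1/B_2, and W = s / (s + 1) * G supplies the rest. *)
Lemma is_derive_defect phi ut s : 0 < B -> 0 < s ->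
  derivable phi (ut s) 1 -> derivable (derive1 phi) (ut s) 1 ->
  derive1 phi (ut s) != 0 -> is_derive s 1 ut (slope phi ut s) ->
  Fint phi (ut s) = Gmodel s -> ln (Gmodel s) != 0 ->
  is_derive s 1 (defect phi ut)
    (- (s / (s + 1)) * ((B2 phi (ut s))^-1 / ln (Gmodel s) ^+ 2)).
Proof.
move=> B0 s0 dphi d2phi p0 dut FG lG0.
have d2phi' : is_derive (ut s) 1 (derive1 phi) (derive1n 2 phi (ut s)).
  by split; [exact: d2phi|exact: (esym (derive1E (derive1 phi) (ut s)))].
have := is_derive_Bl (is_derive_cstl 1 s (1 : R)) (is_derive_Ml
  (is_derive_compl dut d2phi') (is_derive_Gmodel s)).
have s1 : s + 1 != 0 by rewrite gt_eqF// addr_gt0.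
move/is_derive_eq; apply; rewrite /B2 invrK FG /slope (WmodelE s1).
by field; rewrite p0 lG0 s1.
Qed.

End Coefficient.

Section Model.
Variable R : realType.
Implicit Types (B s p : R).

Lemma hconjE B : 1 < B -> hconj B = B / (B - 1).
Proof.
move=> B1; have B0 : 0 < B by lra.
rewrite /hconj /hoelder_conjugate eqe (gt_eqF B0).
by rewrite -EFinB inver subr_eq0 (gt_eqF B1).
Qed.

Lemma is_derive_invl s : 0 < s -> is_derive s 1 (fun u : R => u^-1) (- 1 / s ^+ 2).
Proof.
by move=> s0; apply: (@is_derive_Vl R R (fun u => u)); rewrite gt_eqF.
Qed.

Definition model_vs B s : R :=
  if B == 1 then ln s else s `^ (hconj B)^-1.

(** Both model nonlinearities are known through an explicit logarithmic derivative m; one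
    differentiation of m gives the second derivative of g. *)
Lemma derive1_logderiv (g m : R -> R) s dm :
  (\forall t \near s, is_derive (t : R) 1 g (g t * m t)) -> is_derive s 1 m dm ->
  [/\ derivable g s 1, derive1 g s = g s * m s & derivable (derive1 g) s 1].
Proof.
move=> near_g dm_; have gs := nbhs_singleton near_g.
split; first by case: gs.
  by rewrite derive1E; case: gs.
have [] // := @near_eq_is_derive _ _ _ (fun t => g t * m t) (derive1 g) s 1 _ _
  (is_derive_Ml gs dm_).
by near=> t; rewrite derive1E; have [] // : is_derive (t : R) 1 g (g t * m t) by near: t.
Unshelve. all: by end_near. Qed.

Lemma expN_lin_le (y : R) : 0 <= y -> (y + 1) * expR (- y) <= 2 / (1 + y / 2).
Proof.
move=> y0; rewrite expRN ler_pdivlMr; last by lra.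
rewrite mulrAC ler_pdivrMr ?expR_gt0//.
have e2 : 1 + y / 2 <= expR (y / 2) by exact: expR_ge1Dx.
have eE : expR y = expR (y / 2) * expR (y / 2) by rewrite -expRD; congr expR; lra.
have : (1 + y / 2) * (1 + y / 2) <= expR y by rewrite eE; apply: ler_pM => //; lra.
have : (1 + y / 2) * y >= 0 by apply: mulr_ge0; lra.
by lra.
Qed.

Lemma tail_cvg0 (y : R -> R) (c : R) : 0 <= c ->
  (forall M, \forall s \near +oo, M <= y s) ->
  c * ((y s + 1) * expR (- y s)) @[s --> +oo] --> 0.
Proof.
move=> c0 yoo; apply/cvgrPdist_lt => e e0; near=> s.
have ys : 4 * c / e <= y s by near: s; apply: yoo.
have y0 : 0 <= y s by apply: le_trans ys; rewrite divr_ge0// ?mulr_ge0// ltW.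
rewrite sub0r normrN ger0_norm; last first.
  by rewrite mulr_ge0// mulr_ge0 ?expR_ge0// addr_ge0.
apply: le_lt_trans (ler_wpM2l c0 (expN_lin_le y0)) _.
rewrite mulrA ltr_pdivrMr; last by lra.
move: ys; rewrite ler_pdivrMr// => ys; lra.
Unshelve. all: by end_near. Qed.

(** The equation for y says [Wmodel B (y s)] * y' = 1 / g, so that -G(y) is a primitive of 1 / g. It
    is applied with y = exp if B = 1 and y = s^B' if B > 1, which treats both models by one
    computation. *)
Lemma model_tail (g y : R -> R) (dom a B : R) : 0 < B -> dom < a ->
  (forall s, dom < s -> 0 < y s /\ is_derive s 1 y (4 * expR (y s) / (B * y s * g s))) ->
  (forall s, dom < s -> 0 < g s /\ {for s, continuous g}) ->
  (forall M, \forall s \near +oo, M <= y s) ->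
  Fint g a = Gmodel B (y a).
Proof.
move=> B0 da dy gp yoo; rewrite /Fint /tailint.
have dG s : dom < s -> is_derive s 1 (fun s => - Gmodel B (y s)) (g s)^-1.
  move=> ds; have [y0 dys] := dy _ ds; have [g0 _] := gp _ ds.
  have := is_derive_Nl (is_derive_compl dys (is_derive_Gmodel B (y s))).
  move/is_derive_eq; apply; rewrite /Wmodel expRN.
  by field; rewrite !gt_eqF ?expR_gt0.
have -> : (\int[lebesgue_measure]_(t in `[a, +oo[) ((g t)^-1)%:E =
    (- 0)%:E - (- Gmodel B (y a))%:E)%E.
  apply: (@ge0_continuous_FTC2y R (fun t => (g t)^-1) (fun s => - Gmodel B (y s))).
  - by move=> x ax; rewrite invr_ge0 ltW//; case: (gp x (lt_le_trans da ax)).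
  - apply: continuous_in_subspaceT => x; rewrite inE/= in_itv/= andbT => ax.
    by apply: cont_inv; have [g0 gc] := gp x (lt_le_trans da ax); rewrite ?gt_eqF.
  - by apply: cvgN; apply: tail_cvg0 => //; rewrite divr_ge0// ltW.
  - by move=> x ax; case: (dG x (lt_trans da ax)).
  - by apply: cvg_at_right_filter; apply: (is_derive_cont (dG a da)).
  - move=> x; rewrite in_itv/= andbT => ax.
    by rewrite derive1E; case: (dG x (lt_trans da ax)).
by rewrite -EFinB/= oppr0 sub0r opprK.
Qed.

(** What the two models have in common. The last field is v'' = - v' / (B s): in both cases v' is a
    constant multiple of s^(-1/B). The restriction 2 < s is due to B = 1, where g' / g = e^v - 2 = s
    - 2. *)
Record model_spec B (g : R -> R) s : Prop := ModelSpec {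
  model_tailE : Fint g (model_vs B s) = Gmodel B s;
  model_gt0 : 0 < g (model_vs B s);
  model_derivable : derivable g (model_vs B s) 1;
  model_derivable2 : derivable (derive1 g) (model_vs B s) 1;
  model_derive_neq0 : 2 < s -> derive1 g (model_vs B s) != 0;
  model_slope : is_derive s 1 (model_vs B) (slope B g (model_vs B) s);
  model_slope2 : is_derive s 1 (slope B g (model_vs B))
    (- (slope B g (model_vs B) s) / (B * s)) }.

Lemma model_spec1 s : 0 < s -> model_spec 1 (model_g 1) s.
Proof.
move=> s0; set g := model_g 1.
have vsE : model_vs 1 = @ln R by apply/funext => t; rewrite /model_vs eqxx.
have gE t : g t = 4 * (expR (expR t) / expR (2 * t)) by rewrite /g /model_g eqxx.
have g0 t : 0 < g t by rewrite gE mulr_gt0// divr_gt0 ?expR_gt0.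
have e2 t : expR (2 * t) = expR t ^+ 2 by rewrite expRM_natl.
have dg (t : R) : is_derive t 1 g (g t * (expR t - 2)).
  have := is_derive_Ml (is_derive_cstl 4 t (1 : R)) (is_derive_expRl (is_derive_Bl
    (is_derive_expRl (is_derive_idl t)) (is_derive_Ml (is_derive_cstl 2 t (1 : R)) (is_derive_idl t)))).
  have -> : (fun u : R => 4 * expR (expR u - 2 * u)) = g.
    by apply/funext => u; rewrite gE expRB.
  by move/is_derive_eq; apply; rewrite gE expRB; ring.
have dgn : \forall t \near ln s, is_derive (t : R) 1 g (g t * (expR t - 2)).
  by near=> t; exact: dg.
have [d1 d1E d2] := derive1_logderiv dgn (is_derive_Bl (is_derive_expRl (is_derive_idl _)) (is_derive_cstl _ _ _)).
have lnsK : expR (ln s) = s by rewrite lnK// posrE.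
have slE t : 0 < t -> slope 1 g (model_vs 1) t = t^-1.
  move=> t0; rewrite vsE /slope /Wmodel gE e2 lnK ?posrE// expRN.
  by field; rewrite !gt_eqF ?expR_gt0.
have slopeE : is_derive s 1 (model_vs 1) (slope 1 g (model_vs 1) s).
  by rewrite (slE s s0) vsE; exact: is_derive1_ln.
rewrite -vsE in d1 d1E d2 lnsK.
split; [|exact: g0|exact: d1|exact: d2| |exact: slopeE|].
- rewrite -{2}lnsK; apply: (@model_tail _ _ (model_vs 1 s - 1)).
  + exact: ltr01.
  + by lra.
  + move=> t _; split; first exact: expR_gt0.
    have := is_derive_expRl (is_derive_idl t); move/is_derive_eq; apply.
    rewrite /= gE e2; have := expR_gt0 t; have := expR_gt0 (expR t).
    by move=> u0 w0; field; rewrite !gt_eqF.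
  + by move=> t _; split => //; exact: is_derive_cont (dg t).
  + move=> M; near=> t; apply: le_trans (_ : 1 + t <= _); last exact: expR_ge1Dx.
    have : M <= t by near: t; apply: nbhs_pinfty_ge; exact: num_real.
    by lra.
- by move=> s2; rewrite d1E lnsK mulf_neq0// gt_eqF// subr_gt0.
- rewrite (slE s s0) mul1r.
  apply: (@near_eq_is_derive _ _ _ (fun t : R => t^-1)).
    by near=> t; rewrite slE; [|near: t; exact: lt_nbhsr].
  have := is_derive_invl s0.
  by move/is_derive_eq; apply; field; rewrite gt_eqF.
Unshelve. all: by end_near. Qed.

Lemma model_spec_gt1 B s : 1 < B -> 0 < s -> model_spec B (model_g B) s.
Proof.
move=> B1 s0; set g := model_g B; have B0 : 0 < B by lra.
have Bn1 : (B == 1) = false by rewrite gt_eqF.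
pose p := hconj B.
have pE : p = B / (B - 1) by rewrite /p hconjE.
have p1 : 1 < p by rewrite pE ltr_pdivlMr; lra.
have p0 : 0 < p by lra.
have pV : p^-1 = 1 - B^-1 by rewrite pE; field; rewrite !gt_eqF//; lra.
have vsE : model_vs B = (fun t => t `^ p^-1) by apply/funext => t; rewrite /model_vs Bn1.
have gE t : g t = 4 / (B * p) * t `^ (1 - 2 * p) * expR (t `^ p) by rewrite /g /model_g Bn1.
have c0 : 0 < 4 / (B * p) by rewrite divr_gt0// mulr_gt0.
have g0 t : 0 < t -> 0 < g t.
  move=> t0; rewrite gE; apply: mulr_gt0 (expR_gt0 _).
  exact: mulr_gt0 c0 (powR_gt0 _ t0).
have pw1 t a : 0 < t -> t `^ (a - 1) = t `^ a / t.
  by move=> t0; rewrite powRB ?(gt_eqF t0) ?implybT// powRr1// ltW.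
have dpw (t a : R) : 0 < t -> is_derive t 1 (fun u => u `^ a) (a * (t `^ a / t)).
  by move=> t0; rewrite -pw1//; exact: is_derive1_powR.
pose m t := (1 - 2 * p) / t + p * (t `^ p / t).
have dg (t : R) : 0 < t -> is_derive t 1 g (g t * m t).
  move=> t0; have := is_derive_Ml (is_derive_Ml (is_derive_cstl (4 / (B * p)) t (1 : R))
    (dpw t (1 - 2 * p) t0)) (is_derive_expRl (dpw t p t0)).
  have -> : (fun u : R => 4 / (B * p) * u `^ (1 - 2 * p) * expR (u `^ p)) = g.
    by apply/funext => u; rewrite gE.
  by move/is_derive_eq; apply; rewrite gE /m; ring.
have v0 t : 0 < t -> 0 < t `^ p^-1 by exact: powR_gt0.
have vK t : 0 < t -> (t `^ p^-1) `^ p = t.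
  by move=> t0; rewrite -powRrM mulVf ?gt_eqF// powRr1 ?ltW.
have dgn : \forall t \near s `^ p^-1, is_derive (t : R) 1 g (g t * m t).
  by near=> t; apply: dg; near: t; apply: lt_nbhsr; exact: v0.
have [d1 d1E d2] := derive1_logderiv dgn
  (is_derive_Dl (is_derive_Ml (is_derive_cstl (1 - 2 * p) _ (1 : R))
    (is_derive_invl (v0 _ s0)))
   (is_derive_Ml (is_derive_cstl p _ (1 : R)) (is_derive_Ml (dpw _ p (v0 _ s0))
    (is_derive_invl (v0 _ s0))))).
have pw2 t : 0 < t -> t `^ (1 - 2 * p) = t / (t `^ p) ^+ 2.
  move=> t0; rewrite powRB ?(gt_eqF t0) ?implybT// powRr1 ?ltW//; congr (_ / _).
  by rewrite mulrC powRrM powR_mulrn// powR_ge0.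
have slE t : 0 < t -> slope B g (model_vs B) t = p^-1 * (t `^ p^-1 / t).
  move=> t0; rewrite vsE /slope /Wmodel gE pw2 ?v0// vK// expRN.
  by field; rewrite !gt_eqF ?expR_gt0.
have slopeE : is_derive s 1 (model_vs B) (slope B g (model_vs B) s).
  by rewrite (slE s s0) vsE; exact: dpw.
have vs0 := v0 s s0; have vKs := vK s s0.
have vsEs : s `^ p^-1 = model_vs B s by rewrite vsE.
rewrite vsEs in d1 d1E d2 vs0 vKs.
split; [|exact: g0|exact: d1|exact: d2| |exact: slopeE|].
- rewrite -{2}vKs; apply: (@model_tail _ (fun t => t `^ p) 0).
  + exact: B0.
  + exact: vs0.
  + move=> t t0; split; first exact: powR_gt0.
    have := dpw t p t0; move/is_derive_eq; apply.
    rewrite /= gE pw2//; have := expR_gt0 (t `^ p); have := powR_gt0 p t0.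
    by move=> w0 u0; field; rewrite !gt_eqF.
  + by move=> t t0; split; [exact: g0|exact: is_derive_cont (dg t t0)].
  + move=> M; near=> t.
    have t1 : 1 <= t by near: t; exact: nbhs_pinfty_ge.
    apply: le_trans (le1r_powR t1 (ltW p1)).
    by near: t; apply: nbhs_pinfty_ge; exact: num_real.
(* Here g' / g = (1 - 2 p + p s) / v, which is positive once s > 2. *)
- move=> s2; rewrite d1E mulf_neq0 ?(gt_eqF (g0 _ vs0))// /m vKs mulrA -mulrDl.
  rewrite mulf_neq0 ?invr_eq0 ?(gt_eqF vs0)// gt_eqF//.
  have : p * 2 < p * s by rewrite ltr_pM2l.
  by lra.
- rewrite (slE s s0).
  apply: (@near_eq_is_derive _ _ _ (fun t : R => p^-1 * (t `^ p^-1 / t))).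
    by near=> t; rewrite slE; [|near: t; exact: lt_nbhsr].
  have := is_derive_Ml (is_derive_cstl p^-1 s (1 : R)) (is_derive_Ml (dpw s p^-1 s0)
    (is_derive_invl s0)).
  move/is_derive_eq; apply; rewrite pV.
  by field; rewrite !gt_eqF//; lra.
Unshelve. all: by end_near. Qed.

Lemma model_specP B s : 1 <= B -> 0 < s -> model_spec B (model_g B) s.
Proof.
by rewrite le_eqVlt => /predU1P[<-|]; [exact: model_spec1|exact: model_spec_gt1].
Qed.

(** v'' has two expressions, the general one in terms of [coefA] and the explicit - v' / (B s);
    comparing them and dividing by v' avoids computing g' G. *)
Lemma coefA_model B s : 1 <= B -> 0 < s -> coefA B (model_g B) (model_vs B) s = 1.
Proof.
move=> B1 s0; have [_ g0 d1 _ _ d dd] := model_specP B1 s0.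
have B0 : 0 < B by lra.
have [_ E1] := is_derive_slope (lt0r_neq0 B0) s0 d1 d; have [_] := dd.
rewrite E1; set A := coefA _ _ _ _; have sl0 : slope B (model_g B) (model_vs B) s != 0.
  by rewrite /slope mulf_neq0 ?gt_eqF// Wmodel_gt0.
move=> E; apply/eqP; rewrite -subr_eq0; apply/eqP.
apply: (mulIf sl0); rewrite mul0r.
have : - (A / (B * s)) * slope B (model_g B) (model_vs B) s * (- (B * s)) =
  - slope B (model_g B) (model_vs B) s / (B * s) * (- (B * s)) by rewrite E.
have sn : s != 0 by rewrite gt_eqF.
have Bn : B != 0 by rewrite gt_eqF.
move: (slope _ _ _ _) => q h.
transitivity (- (A / (B * s)) * q * (- (B * s)) - q); first by field; rewrite ?Bn ?sn.
by rewrite h; field; rewrite ?Bn ?sn.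
Qed.

End Model.

(** * Continuous differentiability of f up to 0 *)

Section C1Nonlinearity.
Variables (R : realType) (f : R -> R).
Hypothesis f_C1 : C1_ge0 f.
Hypothesis f_incr : forall s : R, 0 < s -> 0 < derive1 f s.

Lemma C1_ge0_quotient : exists2 df : R -> R,
  {within `[0, +oo[, continuous df} &
  forall s e : R, 0 <= s -> 0 < e -> exists2 d, 0 < d &
    forall t, 0 <= t -> t != s -> `|s - t| < d ->
      `|df s - (f t - f s) / (t - s)| < e.
Proof.
have [df cdf H] := f_C1; exists df => // s e s0 e0.
have /cvgrPdist_lt/(_ _ e0) := H s s0.
move=> [d /= d0 Hd]; exists d => // t t0 ts st.
by apply: (Hd t st ts); rewrite /= in_itv/= t0.
Qed.

Lemma C1_derivative : exists2 df : R -> R, {within `[0, +oo[, continuous df} &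
  forall s : R, 0 < s -> is_derive s 1 f (df s).
Proof.
have [df cdf H] := C1_ge0_quotient; exists df => // s s0.
have lim : h^-1 *: (f (h *: 1 + s) - f s) @[h --> (0 : R)^'] --> df s.
  apply/cvgrPdist_lt => e e0; have [d d0 Hd] := H s e (ltW s0) e0.
  (* Increments smaller than s stay in the half-line, so for s > 0 the relative derivative is the
     two-sided one. *)
  exists (Num.min d s) => /=; first by rewrite lt_min d0.
  move=> h /=; rewrite sub0r normrN lt_min => /andP[hd hs] h0.
  have hsE : h *: 1 + s - s = h by rewrite -[h *: 1]/(h * 1) mulr1 addrK.
  have := Hd (h *: 1 + s); rewrite hsE mulrC; apply.
  - rewrite -[h *: 1]/(h * 1) mulr1.
    by move: hs; rewrite ltr_norml => /andP[]; lra.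
  - by rewrite -subr_eq0 hsE.
  - by rewrite distrC hsE.
split; first by apply/cvg_ex; exists (df s).
exact: cvg_lim lim.
Qed.

Lemma C1_derivable (s : R) : 0 < s -> derivable f s 1.
Proof. by move=> s0; have [df _ /(_ s s0)[]] := C1_derivative. Qed.

Lemma C1_cont (s : R) : 0 < s -> {for s, continuous f}.
Proof. by move=> s0; have [df _ /(_ s s0)/is_derive_cont] := C1_derivative. Qed.

Lemma C1_incr (s t : R) : 0 < s -> s <= t -> f s <= f t.
Proof.
move=> s0 st; apply: (@is_derive_ge0_le R f (derive1 f)) => // x /andP[sx _].
  split; [exact: C1_derivable (lt_le_trans s0 sx)|exact: (esym (derive1E f x))].
by apply/ltW/f_incr; exact: lt_trans sx.
Qed.

(** The two-sided mean value theorem is available on ]0, M] only. To reach 0, the increment is split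
    at a point [a] so small that the one-sided difference quotient at 0 makes the piece on [0, a]
    cost at most e, for arbitrary e. *)
Lemma C1_lipschitz (M : R) : 0 < M -> exists2 L : R, 0 < L &
  forall s t, 0 <= s <= M -> 0 <= t <= M -> `|f s - f t| <= L * `|s - t|.
Proof.
move=> M0; have [df cdf dfE] := C1_derivative.
have cdfM : {within `[0, M], continuous df}.
  apply: continuous_subspaceW cdf => x /=.
  by rewrite !in_itv/= andbT => /andP[].
have [c cM Hc] := EVT_max (ltW M0) cdfM.
have df_gt0 s : 0 < s -> 0 < df s.
  by move=> s0; have := f_incr s0; rewrite derive1E; have [_ ->] := dfE s s0.
pose L := Num.max (df c) 1.
have L0 : 0 < L by rewrite lt_max ltr01 orbT.
have pos s t : 0 < s -> s <= t -> t <= M -> `|f t - f s| <= L * (t - s).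
  move=> s0 st tM; apply: (is_derive_dist_le st (df := df)).
    by move=> x /andP[sx _]; apply: dfE; exact: lt_le_trans sx.
  move=> x /andP[sx xt]; have x0 := lt_trans s0 sx.
  rewrite gtr0_norm ?df_gt0// le_max Hc// in_itv/= ltW//=.
  exact: le_trans (ltW xt) tM.
have lip0 s t : 0 <= s -> s <= t -> t <= M -> `|f t - f s| <= L * (t - s).
  rewrite le_eqVlt => /predU1P[<-|]; last exact: pos.
  rewrite le_eqVlt => /predU1P[<-|t0 tM]; first by rewrite !subrr normr0 mulr0.
  rewrite subr0; apply/ler_addgt0Pl => e e0.
  have [dg _ Hq] := C1_ge0_quotient.
  have [d d0 Hd] := Hq 0 1 (lexx _) ltr01.
  pose N := `|dg 0| + 1; have N0 : 0 < N by rewrite ltr_wpDl.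
  pose a := Num.min (d / 2) (Num.min t (e / N)).
  have a0 : 0 < a by rewrite !lt_min t0 divr_gt0//= divr_gt0.
  have ad : a <= d / 2 by rewrite /a ge_min lexx.
  have [at_ ae] : a <= t /\ a <= e / N.
    have : a <= Num.min t (e / N) by rewrite /a ge_min lexx orbT.
    by rewrite le_min => /andP[].
  have Ha : `|f a - f 0| <= N * a.
    have := Hd a (ltW a0); rewrite gt_eqF// sub0r normrN gtr0_norm// subr0.
    move=> /(_ isT) h; have {}h : `|dg 0 - (f a - f 0) / a| < 1 by apply: h; lra.
    have : `|(f a - f 0) / a| <= N.
      rewrite -[X in `|X|](subKr (dg 0)) /N; apply: le_trans (ler_normB _ _) _.
      by rewrite lerD2l ltW.
    by rewrite normrM normfV (gtr0_norm a0) ler_pdivrMr.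
  have := pos a t a0 at_ tM => Ht.
  rewrite -[X in `|X|](subrKA (f a)).
  apply: le_trans (ler_normD _ _) _; rewrite addrC; apply: lerD.
    apply: le_trans Ha _; rewrite mulrC; move: ae; rewrite ler_pdivlMr//.
  apply: le_trans Ht _; apply: ler_wpM2l; first exact: ltW.
  by lra.
exists L => // s t /andP[s0 sM] /andP[t0 tM].
have [st|/ltW ts] := leP s t.
  have e : `|s - t| = t - s by rewrite distrC ger0_norm// subr_ge0.
  by rewrite e distrC; exact: lip0.
by rewrite [`|s - t|]ger0_norm ?subr_ge0//; exact: lip0.
Qed.

Lemma C1_ge0_at0 : (forall s : R, 0 < s -> 0 < f s) -> 0 <= f 0.
Proof.
move=> fpos; have [L L0 HL] := @C1_lipschitz 1 ltr01.
rewrite leNgt; apply/negP => f0.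
pose a := Num.min 1 (- f 0 / L).
have a0 : 0 < a by rewrite lt_min ltr01 divr_gt0// oppr_gt0.
have a1 : a <= 1 by rewrite ge_min lexx.
have aL : a <= - f 0 / L by rewrite ge_min lexx orbT.
have := HL 0 a; rewrite lexx ler01 (ltW a0) a1 sub0r normrN (gtr0_norm a0) => /(_ isT isT).
have := fpos a a0; move: aL; rewrite ler_pdivlMr// => h1 h2.
rewrite ler_norml => /andP[]; lra.
Qed.

End C1Nonlinearity.

(** * The remainders *)

Section Coefficients.
Variables (R : realType) (f : R -> R) (B : R).

Definition usigma (s : R) : R := Finv f (Gmodel B s).

Definition rem1 (s : R) : R :=
  `|(B1 f (usigma s))^-1 - (B1 (model_g B) (model_vs B s))^-1|.

Definition rem2 (s : R) : R :=
  `|(B2 f (usigma s))^-1 - (B2 (model_g B) (model_vs B s))^-1|.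

Definition remsup (s : R) : R :=
  sup [set rem1 t + rem2 t | t in [set t | s <= t]].

Hypothesis B_ge1 : 1 <= B.
Hypothesis f_C1 : C1_ge0 f.
Hypothesis f_pos : forall s : R, 0 < s ->
  [/\ 0 < f s, (tailint f s < +oo)%E & 0 < derive1 f s].
Variable s0 : R.
Hypothesis s0_gt0 : 0 < s0.
Hypothesis f_C2 : C2_above s0 f.

Let B0 : 0 < B. Proof. exact: lt_le_trans B_ge1. Qed.
Let fp (s : R) : 0 < s -> 0 < f s. Proof. by move=> /f_pos[]. Qed.
Let ft (s : R) : 0 < s -> (tailint f s < +oo)%E. Proof. by move=> /f_pos[]. Qed.
Let fc (s : R) : 0 < s -> {for s, continuous f}. Proof. exact: C1_cont. Qed.

(** Hence -log G >= s / 2, which replaces the logarithms in 1/B_1 and 1/B_2 by powers of s. *)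
Lemma Gmodel_le (s : R) : 4 * B <= s -> Gmodel B s <= expR (- (s / 2)).
Proof.
move=> sB; have B1 := B_ge1; have sp : 0 < s by lra.
have e4 : 1 + s / 4 <= expR (s / 4) by exact: expR_ge1Dx.
have e2 : (1 + s / 4) * (1 + s / 4) <= expR (s / 2).
  have -> : expR (s / 2) = expR (s / 4) * expR (s / 4).
    by rewrite -expRD; congr (expR _); lra.
  by apply: ler_pM => //; lra.
have : B / 4 * (s + 1) <= expR (s / 2).
  apply: le_trans e2; have : 0 <= s * (s - 4 * B) by apply: mulr_ge0; lra.
  by lra.
move=> /(ler_wpM2r (expR_ge0 (- s))); rewrite -expRD /Gmodel mulrA => /le_trans; apply.
by rewrite ler_expR; lra.
Qed.

Lemma usigma_spec : exists2 m : R, 2 < m & forall s : R, m <= s ->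
  [/\ s0 < usigma s, Fint f (usigma s) = Gmodel B s,
      is_derive s 1 usigma (slope B f usigma s) & ln (Gmodel B s) <= - (s / 2)].
Proof.
have B1 := B_ge1; have s00 := s0_gt0.
have Fs0 := Fint_gt0 fp ft fc s00.
(* The second entry forces G(s) < F(s0), so that [usigma s] exceeds [s0] and lies where f is twice
   differentiable. *)
pose m := Num.max (4 * B) (- 2 * ln (Fint f s0) + 1).
exists m; first by rewrite lt_max; apply/orP; left; lra.
move=> s; rewrite ge_max => /andP[s4B sF]; have sp : 0 < s by lra.
have G0 := Gmodel_gt0 B0 sp.
have Gle := Gmodel_le s4B.
have GF : Gmodel B s < Fint f s0.
  apply: le_lt_trans Gle _; rewrite -[ltRHS]lnK ?posrE// ltr_expR; lra.
have [t s0t FtE] := Fint_attained fp ft fc s00 G0 GF.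
have t0 : 0 < t by lra.
have utE : usigma s = t by rewrite /usigma -FtE (FintK fp ft fc).
split; rewrite ?utE//.
- have dF := is_derive_Finv fp ft fc t0; rewrite FtE in dF.
  have := is_derive_compl (is_derive_Gmodel B s) dF.
  by move/is_derive_eq; apply; rewrite /slope utE; ring.
- by rewrite -[leRHS]expRK ler_ln ?posrE ?expR_gt0.
Qed.

Let g := model_g B.
Let vs := model_vs B.

Lemma is_derive_coefA (phi ut : R -> R) (s dQ : R) : 0 < s ->
  is_derive s 1 (defect B phi ut) dQ ->
  is_derive s 1 (coefA B phi ut) (B / (s + 1) ^+ 2 + (B * dQ * (s ^+ 2 / (s + 1))
    + B * defect B phi ut s * ((s ^+ 2 + 2 * s) / (s + 1) ^+ 2))).
Proof.
move=> sp dQ_; have s1 : 0 < s + 1 by rewrite addr_gt0.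
have s1n : s + 1 != 0 by rewrite gt_eqF.
have dI : is_derive s 1 (fun t => (t + 1)^-1) (- 1 / (s + 1) ^+ 2).
  have := is_derive_compl (is_derive_Dl (is_derive_idl s) (is_derive_cstl 1 s (1 : R)))
    (is_derive_invl s1).
  by move/is_derive_eq; apply; ring.
have := is_derive_Dl (is_derive_Nl (is_derive_Ml (is_derive_cstl B s (1 : R)) dI))
  (is_derive_Ml (is_derive_Ml (is_derive_cstl B s (1 : R)) dQ_)
  (is_derive_Ml (is_derive_sqrl (is_derive_idl s)) dI)).
by move/is_derive_eq; apply; field.
Qed.

(** For the model, [coefA] is 1 and its derivative 0. Subtracting the model cancels the explicit
    terms in s and leaves the difference of the two defects, at most 2 R_1 / s, and that of their
    derivatives, at most 4 R_2 / s^2. *)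
Lemma coefA_bounds : exists2 m : R, 2 < m & forall s : R, m <= s ->
  [/\ s0 < usigma s, Fint f (usigma s) = Gmodel B s,
      is_derive s 1 usigma (slope B f usigma s),
      `|coefA B f usigma s - 1| <= 4 * B * (rem1 s + rem2 s) &
      exists2 dA, is_derive s 1 (coefA B f usigma) dA &
        `|dA| <= 4 * B * (rem1 s + rem2 s) / s].
Proof.
have [m m2 Hm] := usigma_spec; exists m => // s ms.
have B1 := B_ge1; have s00 := s0_gt0.
have [us FE dus lG] := Hm s ms.
have s2 : 2 < s := lt_le_trans m2 ms; have sp : 0 < s := lt_trans (ltr0Sn _ 1) s2.
have sp1 : 0 < s + 1 := addr_gt0 sp ltr01.
have lGs : s / 2 <= - ln (Gmodel B s) by rewrite lerNr.
have s20 : 0 <= s / 2 := divr_ge0 (ltW sp) (ler0n _ 2).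
have lG0 : 0 <= - ln (Gmodel B s) := le_trans s20 lGs.
have ss1 : 0 <= s ^+ 2 / (s + 1) <= s.
  by rewrite divr_ge0 ?sqr_ge0 ?(ltW sp1)// ler_pdivrMr// mulrDr mulr1 -expr2 lerDl ltW.
split => //.
- have [GE _ _ _ _ _ _] := model_specP B1 sp.
  rewrite -[X in `|_ - X|](coefA_model B1 sp) /coefA.
  set p := defect B f usigma s; set q := defect B (model_g B) (model_vs B) s.
  have r1E : rem1 s = - ln (Gmodel B s) * `|p - q|.
    by rewrite -(ger0_norm lG0) -normrM mulrBr /rem1 /B1 !invrK FE GE.
  have rem20 : 0 <= rem2 s by exact: normr_ge0.
  have pq : s / 2 * `|p - q| <= rem1 s by rewrite r1E; exact: ler_wpM2r.
  have -> : - (B / (s + 1)) + B * p * (s ^+ 2 / (s + 1)) -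
    (- (B / (s + 1)) + B * q * (s ^+ 2 / (s + 1))) = B * (s ^+ 2 / (s + 1)) * (p - q) by ring.
  move/andP: ss1 => [h1 h2].
  rewrite normrM ger0_norm; last by apply: mulr_ge0; [lra|].
  have := ler_wpM2r (normr_ge0 (p - q)) (ler_wpM2l (ltW B0) h2).
  have := ler_wpM2l (ltW B0) pq; have := mulr_ge0 (ltW B0) rem20.
  have := mulr_ge0 (ltW B0) (normr_ge0 _ : 0 <= rem1 s); lra.
- have [GE g0 d1g d2g dg0 dvs _] := model_specP B1 sp.
  have [d1f d2f _] := f_C2 us.
  have usp : 0 < usigma s by lra.
  have [f0 _ f'0] := f_pos usp.
  have lGn : ln (Gmodel B s) != 0 by rewrite lt_eqF//; lra.
  have dQf := is_derive_defect B0 sp d1f d2f (lt0r_neq0 f'0) dus FE lGn.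
  have dQg := is_derive_defect B0 sp d1g d2g (dg0 ltac:(lra)) dvs GE lGn.
  set ef := - (s / (s + 1)) * _ in dQf; set eg := - (s / (s + 1)) * _ in dQg.
  have dAf := is_derive_coefA sp dQf; have dAg := is_derive_coefA sp dQg.
  have dA1 : is_derive s 1 (coefA B g vs) 0.
    apply: (near_eq_is_derive _ (is_derive_cstl (1 : R) s (1 : R))).
    near=> t; rewrite coefA_model//; near: t; exact: lt_nbhsr.
  have [_ e1] := dAg; have [_] := dA1; rewrite e1 => eqg.
  eexists; first exact: dAf.
  set p := defect B f usigma s in dAf *; set q := defect B (model_g B) (model_vs B) s in eqg *.
  have r1E : rem1 s = - ln (Gmodel B s) * `|p - q|.
    by rewrite -(ger0_norm lG0) -normrM mulrBr /rem1 /B1 !invrK FE GE.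
  have efE : `|ef - eg| = s / (s + 1) * (rem2 s / ln (Gmodel B s) ^+ 2).
    have h1 : 0 <= s / (s + 1) by rewrite divr_ge0// ltW.
    have h2 : 0 <= (ln (Gmodel B s) ^+ 2)^-1 by rewrite invr_ge0 sqr_ge0.
    by rewrite /ef /eg -mulrBr -mulrBl normrM normrN (ger0_norm h1) normrM (ger0_norm h2).
  have rem20 : 0 <= rem2 s by exact: normr_ge0.
  have rem10 : 0 <= rem1 s by exact: normr_ge0.
  have pq : `|p - q| <= 2 * rem1 s / s.
    rewrite ler_pdivlMr// mulrC.
    have : s / 2 * `|p - q| <= rem1 s by rewrite r1E; exact: ler_wpM2r.
    by lra.
  have efg : `|ef - eg| <= 4 * rem2 s / s ^+ 2.
    rewrite efE; apply: le_trans (_ : 1 * (rem2 s / ln (Gmodel B s) ^+ 2) <= _).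
      apply: ler_wpM2r; first by rewrite divr_ge0 ?sqr_ge0.
      by rewrite ler_pdivrMr// mul1r lerDl.
    have s24 : s ^+ 2 / 4 <= ln (Gmodel B s) ^+ 2.
      have : (s / 2) ^+ 2 <= (- ln (Gmodel B s)) ^+ 2.
        by rewrite ler_sqr.
      by rewrite sqrrN expr_div_n; lra.
    have sq0 : 0 < s ^+ 2 / 4 by rewrite divr_gt0// exprn_gt0.
    rewrite mul1r (_ : 4 * rem2 s / s ^+ 2 = rem2 s * (s ^+ 2 / 4)^-1).
      by apply: ler_wpM2l => //; rewrite lef_pV2// posrE (lt_le_trans sq0).
    by field; rewrite gt_eqF.
  set x := B / (s + 1) ^+ 2; set a := s ^+ 2 / (s + 1); set b := (s ^+ 2 + 2 * s) / _.
  (* The same expression for the model vanishes by [eqg] and is subtracted, which removes x. *)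
  have -> : x + (B * ef * a + B * p * b) = B * a * (ef - eg) + B * b * (p - q).
    by transitivity (x + (B * ef * a + B * p * b) - (x + (B * eg * a + B * q * b)));
      [rewrite eqg subr0|ring].
  have s12 : 0 < (s + 1) ^+ 2 by rewrite exprn_gt0.
  have b1 : 0 <= b <= 1.
    apply/andP; split; last by rewrite /b ler_pdivrMr//; lra.
    by apply: divr_ge0 (ltW s12); rewrite addr_ge0 ?sqr_ge0 ?mulr_ge0// ltW.
  move/andP: ss1 => [a0 as_]; move/andP: b1 => [b0 b1].
  apply: le_trans (ler_normD _ _) _.
  have Bn : `|B| <= B by rewrite ger0_norm// ltW.
  have an : `|a| <= s by rewrite ger0_norm.
  have bn : `|b| <= 1 by rewrite ger0_norm.
  have h1 := ler_normM_bound (ler_normM_bound Bn an) efg.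
  have h2 := ler_normM_bound (ler_normM_bound Bn bn) pq.
  apply: le_trans (lerD h1 h2) _.
  have sn : s != 0 by rewrite gt_eqF.
  rewrite (_ : _ + _ = (4 * B * (rem1 s + rem2 s) - 2 * B * rem1 s) / s); last by field.
  rewrite ler_pM2r ?invr_gt0// gerBl mulr_ge0// mulr_ge0//; exact: ltW.
Unshelve. all: by end_near. Qed.

Hypothesis rem_small : forall e : R, 0 < e -> exists m : R,
  forall s, m <= s -> Num.sqrt s * (rem1 s + rem2 s) <= e.

Let rem_ge0 s : 0 <= rem1 s + rem2 s.
Proof. exact: addr_ge0 (normr_ge0 _) (normr_ge0 _). Qed.

(** [sup] is meaningful only for bounded sets, which the decay hypothesis ensures from m on. The
    decay rate survives the supremum because sqrt s <= sqrt t for t >= s. *)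
Lemma remsup_spec : exists2 m : R, 1 <= m & [/\
  forall s, m <= s -> rem1 s + rem2 s <= remsup s,
  forall s, m <= s -> 0 <= remsup s,
  forall s t, m <= s -> s <= t -> remsup t <= remsup s &
  forall e, 0 < e -> exists n, forall s, n <= s -> Num.sqrt s * remsup s <= e].
Proof.
have [m0 Hm0] := rem_small ltr01.
pose m := Num.max m0 1.
have m1 : 1 <= m by rewrite /m le_max lexx orbT.
have bnd s : m <= s -> has_sup [set rem1 t + rem2 t | t in [set t | s <= t]].
  rewrite ge_max => /andP[ms s1]; split; first by exists (rem1 s + rem2 s), s => /=.
  exists 1 => _ [t /= st <-].
  have := Hm0 t (le_trans ms st).
  have t1 : 1 <= Num.sqrt t by rewrite -[leLHS]sqrtr1 ler_wsqrtr// (le_trans s1).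
  by apply: le_trans; rewrite ler_peMl// rem_ge0.
have le_sup t : m <= t -> rem1 t + rem2 t <= remsup t.
  by move=> mt; have [_ ub] := bnd t mt; apply: (ub_le_sup ub); exists t => /=.
exists m => //; split => //.
- by move=> s ms; exact: le_trans (rem_ge0 s) (le_sup s ms).
- move=> s t ms st; apply: ge_sup.
    by exists (rem1 t + rem2 t), t => /=.
  move=> _ [x /= tx <-]; apply: (ub_le_sup (bnd _ ms).2).
  by exists x => //=; exact: le_trans tx.
- move=> e e0; have [n Hn] := rem_small e0; exists (Num.max n 1) => s.
  rewrite ge_max => /andP[ns s1].
  have q0 : 0 < Num.sqrt s by rewrite sqrtr_gt0; lra.
  rewrite mulrC -ler_pdivlMr//; apply: ge_sup.
    by exists (rem1 s + rem2 s), s => /=.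
  move=> _ [t /= st <-]; rewrite ler_pdivlMr// mulrC.
  apply: le_trans (Hn t (le_trans ns st)).
  by apply: ler_wpM2r; [exact: rem_ge0|exact: ler_wsqrtr].
Qed.

End Coefficients.

(** * The radial solution *)

Section Inverse.
Variable R : realType.

Lemma derive_ge_inverse (rho drho : R -> R) (m : R) : 0 < m ->
  (forall s : R, is_derive s 1 rho (drho s)) -> (forall s, m <= drho s) ->
  exists sig : R -> R, [/\ forall y, rho (sig y) = y, forall s, sig (rho s) = s &
    forall y : R, is_derive y 1 sig (drho (sig y))^-1].
Proof.
move=> m0 dr dm.
have grow s t : s <= t -> m * (t - s) <= rho t - rho s.
  move=> st; suff: rho s - m * s <= rho t - m * t by lra.
  apply: (@is_derive_ge0_le R (fun t => rho t - m * t) (fun t => drho t - m)) => //.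
    move=> x _; have := is_derive_Bl (dr x) (is_derive_Ml (is_derive_cstl m x (1 : R)) (is_derive_idl x)).
    by move/is_derive_eq; apply; ring.
  by move=> x _; rewrite subr_ge0.
have inj s t : rho s = rho t -> s = t.
  move=> e; have [st|ts|//] := ltgtP s t.
    by have := grow s t (ltW st); rewrite e subrr pmulr_rle0// subr_le0 leNgt st.
  by have := grow t s (ltW ts); rewrite e subrr pmulr_rle0// subr_le0 leNgt ts.
have surj y : exists s, rho s = y.
  pose T := `|y - rho 0| / m + 1.
  have T0 : 0 <= T by rewrite /T addr_ge0// divr_ge0// ltW.
  have mT : `|y - rho 0| <= m * T.
    rewrite /T mulrDr mulrC divfK ?gt_eqF// mulr1; lra.
  have h1 := grow 0 T T0; have h2 := grow (- T) 0 ltac:(lra).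
  have /andP[h3 h4] := ler_norm_bound mT.
  have [||c _ cy] := @IVT R rho (- T) T y ltac:(lra).
  - by apply: is_derive_within => x _; exact: dr.
  - by rewrite ge_min le_max; apply/andP; split; apply/orP; [left|right]; lra.
  by exists c.
pose sig y := projT1 (cid (surj y)).
have sigK y : rho (sig y) = y by rewrite /sig; case: cid.
have rhoK s : sig (rho s) = s by apply: inj; rewrite sigK.
exists sig; split=> // y; rewrite -[X in is_derive X](sigK y).
apply: (@is_derive_inverse R rho).
- by near=> x; exact: rhoK.
- by near=> x; apply: is_derive_cont; exact: dr.
- by rewrite gt_eqF// (lt_le_trans m0).
Unshelve. all: by end_near. Qed.

End Inverse.

Section Branch.
Variable R : realType.

(** Since A >= 1/2, the function D(s) s^(1 / (2 B)) is nonincreasing; P is its logarithm. *)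
Lemma log_decay (D : R -> R) (B s1 : R) (A : R -> R) : 1 <= B -> 1 <= s1 ->
  (forall s, s1 <= s -> 0 < D s) -> (forall s, s1 <= s -> 2^-1 <= A s) ->
  (forall s : R, s1 <= s -> is_derive s 1 D (- (A s / (B * s)) * D s)) ->
  forall e, 0 < e -> exists n, forall s, n <= s -> D s <= e.
Proof.
move=> B1 s11 D0 A2 dD e e0.
pose a := (2 * B)^-1; have a0 : 0 < a by rewrite invr_gt0; lra.
pose P s := ln (D s) + a * ln s.
have Pdecr s : s1 <= s -> P s <= P s1.
  move=> ss; rewrite -lerN2.
  apply: (@is_derive_ge0_le R (fun s => - P s) (fun s => - (- (A s / (B * s)) + a * s^-1))) => //.
    move=> t /andP[s1t _]; have t0 : 0 < t by lra.
    have Dt := D0 t s1t.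
    have := is_derive_Nl (is_derive_Dl (is_derive_lnl Dt (dD t s1t))
      (is_derive_Ml (is_derive_cstl a t (1 : R)) (is_derive1_ln t0))).
    by move/is_derive_eq; apply; field; rewrite !gt_eqF//; lra.
  move=> t /andP[s1t _]; have t0 : 0 < t by lra.
  have -> : - (- (A t / (B * t)) + a * t^-1) = (A t - 2^-1) / (B * t).
    by rewrite /a; field; rewrite !gt_eqF//; lra.
  apply: divr_ge0; first by have := A2 t (ltW s1t); lra.
  by apply: mulr_ge0; lra.
exists (Num.max s1 (expR ((P s1 - ln e) / a))) => s.
rewrite ge_max => /andP[ss sE]; have sp : 0 < s by lra.
have : (P s1 - ln e) / a <= ln s by rewrite -[leLHS]expRK ler_ln ?posrE ?expR_gt0.
rewrite ler_pdivrMr// mulrC => h.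
rewrite -[leLHS]lnK ?posrE ?D0// -[leRHS]lnK ?posrE// ler_expR.
by have := Pdecr s ss; rewrite {1}/P; lra.
Qed.

Lemma singular_branch (f ut D A mu c del : R -> R) (B s1 : R) :
  1 <= B -> 1 <= s1 ->
  (forall s : R, s1 <= s -> is_derive s 1 ut (D s)) ->
  (forall s, s1 <= s -> D s = f (ut s) * Wmodel B s) ->
  (forall s, s1 <= s -> 0 < D s) ->
  (forall s : R, s1 <= s -> is_derive s 1 D (- (A s / (B * s)) * D s)) ->
  (forall s, s1 <= s -> 2^-1 <= A s <= 2) ->
  (forall s, s1 <= s -> [/\ `|mu s| <= 1, `|del s| <= 1 & c s = del s]) ->
  (forall s, `|c s| <= 1) ->
  (forall s : R, is_derive s 1 mu (1 - expR (- c s))) ->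
  (forall s : R, s1 <= s ->
     is_derive s 1 del ((A s - expR (mu s - 2 * del s)) / (B * s))) ->
  exists (u v : R -> R) (y0 : R),
  [/\ forall y : R, y0 <= y -> [/\ is_derive y 1 u (v y),
        is_derive y 1 v (- (expR (- y) * f (u y) / 4)) & 0 < v y],
      forall y, y0 <= y -> exists2 s, s1 <= s & u y = ut s,
      forall e, 0 < e -> exists n, forall y, n <= y -> v y <= e &
      forall y, s1 + 9 <= y -> `|u y - ut y| <= expR 21 * D y * `|mu y|].
Proof.
move=> B1 s11 dut DE D0 dD A2 mud c1 dmu ddel.
have B0 : 0 < B by exact: lt_le_trans B1.
have sp0 t : s1 <= t -> 0 < t by move=> s1t; exact: lt_le_trans (lt_le_trans ltr01 s11) s1t.
(* The change of variable. Its derivative is exp(-c) with c in [-1, 1] everywhere, so it is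
   invertible on the whole line. *)
pose rho s := s - mu s.
have drho (s : R) : is_derive s 1 rho (expR (- c s)).
  have := is_derive_Bl (is_derive_idl s) (dmu s).
  by move/is_derive_eq; apply; ring.
have [sig [sigK rhoK dsig]] := @derive_ge_inverse R rho (fun s => expR (- c s)) (expR (-1))
  (expR_gt0 _) drho (fun s => ltac:(rewrite ler_expR; have /andP[] := ler_norm_bound (c1 s); lra)).
have dsig' (y : R) : is_derive y 1 sig (expR (c (sig y))).
  by have := dsig y; rewrite -expRN opprK.
have sig_mono x y : x <= y -> sig x <= sig y.
  by move=> xy; apply: (is_derive_ge0_le xy (fun t _ => dsig' t)) => t _; rewrite expR_ge0.
pose y0 := rho s1.
have sigy0 y : y0 <= y -> s1 <= sig y.
  by move=> h; rewrite -(rhoK s1); exact: sig_mono.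
pose u y := ut (sig y); pose v y := D (sig y) * expR (del (sig y)).
(* y = sig(rho y), and y differs from rho y by mu y, while the derivative of sig is at most e. *)
have sig_dist y : s1 <= y -> `|sig y - y| <= expR 1 * `|mu y|.
  move=> s1y; have e : `|y - rho y| = `|mu y| by rewrite /rho subKr.
  rewrite -[X in sig y - X]rhoK -e.
  have H a b : a <= b -> `|sig b - sig a| <= expR 1 * (b - a).
    move=> ab; apply: (is_derive_dist_le ab (fun t _ => dsig' t)) => t _.
    rewrite ger0_norm ?expR_ge0// ler_expR.
    by have /andP[] := ler_norm_bound (c1 (sig t)).
  have [h|/ltW h] := leP (rho y) y.
    by rewrite [`|y - rho y|]ger0_norm ?subr_ge0//; exact: H.
  by rewrite distrC [`|y - rho y|]distrC [`|rho y - y|]ger0_norm ?subr_ge0//; exact: H.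
exists u, v, y0; split.
- move=> y yy; have s1s := sigy0 y yy; set s := sig y in s1s *.
  have [_ _ cs] := mud s s1s.
  have sp := sp0 s s1s.
  split.
  + have := is_derive_compl (dsig' y) (dut _ s1s).
    by move/is_derive_eq; apply; rewrite -/s cs.
  + have := is_derive_Ml (is_derive_compl (dsig' y) (dD _ s1s))
      (is_derive_expRl (is_derive_compl (dsig' y) (ddel _ s1s))).
    move/is_derive_eq; apply; rewrite -/s cs.
    (* This uses y = rho s = s - mu s; it is where the system for (mu, del) turns back into the
       radial equation. *)
    have E : expR (mu s - 2 * del s) * (expR (del s) * expR (del s)) = expR s * expR (- y).
      rewrite -!expRD; congr (expR _).
      by rewrite -[y in RHS]sigK -/s /rho; ring.
    have E2 : expR s * expR (- s) = 1 by rewrite expRxMexpNx_1.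
    have -> : expR (- y) * f (u y) / 4 = (D s / (B * s)) * (expR s * expR (- y)).
      rewrite (DE _ s1s) /Wmodel /u -/s.
      transitivity (expR (- y) * f (ut s) / 4 * (expR s * expR (- s))); first by rewrite E2 mulr1.
      by field; rewrite !gt_eqF.
    rewrite -E; field; rewrite !gt_eqF//.
  + by rewrite mulr_gt0 ?expR_gt0// D0.
- by move=> y /sigy0 h; exists (sig y).
- move=> e e0; have ee : 0 < e / expR 1 by rewrite divr_gt0// expR_gt0.
  have [n Hn] := log_decay B1 s11 D0 (fun s h => proj1 (andP (A2 s h))) dD ee.
  exists (rho (Num.max s1 n)) => y ny.
  have h : Num.max s1 n <= sig y by rewrite -(rhoK (Num.max s1 n)); exact: sig_mono.
  move: h; rewrite ge_max => /andP[h1 h2].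
  rewrite /v; apply: le_trans (_ : e / expR 1 * expR 1 <= _); last first.
    by rewrite divfK// gt_eqF// expR_gt0.
  apply: ler_pM; rewrite ?expR_ge0 ?(ltW (D0 _ h1)) ?Hn// ler_expR.
  by have [_ /ler_norm_bound/andP[]] := mud _ h1.
- move=> y sy; have s1y : s1 <= y by lra.
  have [muy _ _] := mud y s1y.
  (* A crude bound is enough: as |mu| <= 1, it gives |sig y - y| <= 9, and y >= s1 + 9 then keeps
     sig y beyond s1. *)
  have e3 : expR 1 <= 9 :> R.
    have -> : (1 : R) = 2^-1 + 2^-1 by lra.
    rewrite expRD; have h : expR (- 2^-1) >= 2^-1 :> R.
      by have := expR_ge1Dx (- 2^-1 : R); lra.
    have e0 := expR_gt0 (2^-1 : R).
    have : expR (2^-1) <= 2 :> R.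
      by rewrite -[leRHS]invrK -[leLHS]invrK lef_pV2 ?posrE ?invr_gt0// -expRN.
    by move=> h2; have := ler_pM (ltW e0) (ltW e0) h2 h2; lra.
  have dist := sig_dist y s1y.
  have dist9 : `|sig y - y| <= 9.
    apply: le_trans dist _; apply: le_trans (_ : 9 * 1 <= _); last by lra.
    by apply: ler_pM => //; exact: expR_ge0.
  have Dy0 := D0 y s1y.
  (* D' / D lies in [-2, 0], so going back by at most 9 multiplies D by at most e^18. With the
     factor e of [sig_dist], the rounded bound e^20 gives e^21. *)
  have Dbound x : s1 <= x -> y - 9 <= x -> D x <= expR 20 * D y.
    move=> s1x yx.
    have E20 : 1 <= expR 20 :> R by rewrite -[leLHS]expR0 ler_expR; lra.
    have [xy|/ltW yx'] := leP x y.
      have mono : D x * expR (2 * x) <= D y * expR (2 * y).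
        apply: (@is_derive_ge0_le R (fun t => D t * expR (2 * t))
          (fun t => (2 - A t / (B * t)) * (D t * expR (2 * t)))) => //.
          move=> t /andP[xt _]; have s1t : s1 <= t by lra.
          have := is_derive_Ml (dD t s1t) (is_derive_expRl (is_derive_Ml
            (is_derive_cstl 2 t (1 : R)) (is_derive_idl t))).
          by move/is_derive_eq; apply; ring.
        move=> t /andP[xt _]; have s1t : s1 <= t by lra.
        apply: mulr_ge0; last by rewrite mulr_ge0 ?expR_ge0// ltW// D0.
        rewrite subr_ge0 ler_pdivrMr; last by rewrite mulr_gt0// sp0.
        have /andP[_ h2] := A2 t s1t.
        have : 1 * 1 <= B * t by apply: ler_pM => //; exact: le_trans s1t.
        by lra.
      have : D x <= D y * expR (2 * (y - x)).
        rewrite (_ : 2 * (y - x) = 2 * y + - (2 * x)); last by ring.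
        rewrite expRD mulrA expRN ler_pdivlMr ?expR_gt0//.
      move=> /le_trans; apply; rewrite mulrC; apply: ler_wpM2r; first exact: ltW.
      by rewrite ler_expR; lra.
    have : D x <= D y.
      rewrite -lerN2; apply: (is_derive_ge0_le (f := fun t => - D t)
          (df := fun t => - (- (A t / (B * t)) * D t)) yx').
        by move=> t /andP[yt _]; apply: is_derive_Nl; apply: dD; lra.
      move=> t /andP[yt _]; have s1t : s1 <= t by lra.
      rewrite mulNr opprK; apply: mulr_ge0; last exact/ltW/D0.
      have /andP[h1 _] := A2 t s1t.
      apply: divr_ge0; first by apply: le_trans h1; rewrite invr_ge0.
      by rewrite mulr_ge0 ?ltW// sp0.
    by move=> /le_trans; apply; rewrite ler_peMl// ltW.
  have /andP[d1 d2] := ler_norm_bound dist9.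
  have s1sy : s1 <= sig y by lra.
  have e20 : 0 <= expR 20 * D y by rewrite mulr_ge0 ?expR_ge0// ltW.
  have HD a b : y - 9 <= a -> a <= b -> s1 <= a -> `|ut b - ut a| <= (expR 20 * D y) * (b - a).
    move=> ya ab s1a; apply: (is_derive_dist_le ab (df := D)).
      by move=> t /andP[at_ _]; apply: dut; lra.
    by move=> t /andP[at_ _]; rewrite gtr0_norm ?D0 ?Dbound//; lra.
  suff H : `|u y - ut y| <= expR 20 * D y * `|sig y - y|.
    have E21 : expR 21 = expR 20 * expR 1 :> R by rewrite -expRD; congr (expR _); lra.
    have -> : expR 21 * D y * `|mu y| = expR 20 * D y * (expR 1 * `|mu y|).
      by rewrite E21; ring.
    apply: le_trans H _.
    exact: ler_wpM2l.
  rewrite /u; have [h|/ltW h] := leP y (sig y).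
    by rewrite [`|sig y - y|]ger0_norm ?subr_ge0//; apply: HD => //; lra.
  by rewrite distrC [`|sig y - y|]distrC [`|y - sig y|]ger0_norm ?subr_ge0//; apply: HD => //; lra.
Qed.

End Branch.

(** * Continuation to the left down to a zero *)

Section Extension.
Variables (R : realType) (f : R -> R).
Hypothesis f_C1 : C1_ge0 f.
Hypothesis f_gt0 : forall s : R, 0 < s -> 0 < f s.
Hypothesis f_incr : forall s : R, 0 < s -> 0 < derive1 f s.

(* To the left of y0 the equation is solved with the nonlinearity frozen
   outside [0, u(y0 + 1)] and the weight frozen below ya; the solution is
   concave with positive slope, hence vanishes before these changes matter. *)
Lemma extend_left (u v : R -> R) (y0 : R) :
  (forall y : R, y0 <= y -> [/\ is_derive y 1 u (v y),
     is_derive y 1 v (- (expR (- y) * f (u y) / 4)), 0 < v y & 0 < u y]) ->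
  exists (U V W : R -> R) (r0 : R),
  [/\ U r0 = 0,
      forall y : R, is_derive y 1 U (V y) /\ is_derive y 1 V (W y),
      continuous W,
      forall y, r0 < y -> [/\ 0 < U y, 0 < V y & W y = - (expR (- y) * f (U y) / 4)] &
      forall y, y0 + 1 <= y -> U y = u y /\ V y = v y].
Proof.
move=> uv; pose y2 := y0 + 1; pose M := u y2; pose c0 := v y0; pose u0 := u y0.
have [c00 u00] : 0 < c0 /\ 0 < u0 by case: (uv y0 (lexx _)).
have y02 : y0 <= y2 by rewrite /y2; lra.
have umono a b : y0 <= a -> a <= b -> u a <= u b.
  move=> ya ab; apply: (@is_derive_ge0_le R u v) => // t /andP[at_ _].
    by case: (uv t ltac:(lra)).
  by apply/ltW; case: (uv t ltac:(lra)).
have M0 : 0 < M by case: (uv y2 y02).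
have u0M : u0 <= M by apply: umono; rewrite // lexx.
(* The line through (y0, u0) with slope c0 has the value -c0 at ya, and a concave continuation lies
   below it; a zero is therefore met between ya and y0. *)
pose ya := y0 - (u0 / c0 + 1).
have ya0 : ya < y0 by rewrite /ya; have := divr_gt0 u00 c00; lra.
have [L L0 HL] := C1_lipschitz f_C1 f_incr M0.
pose fM x := f (clamp 0 M x).
have clM x : 0 <= clamp 0 M x <= M by apply: clamp_itv; exact: ltW.
have fM_lip x x' : `|fM x - fM x'| <= L * `|x - x'|.
  apply: le_trans (HL _ _ (clM x) (clM x')) _.
  by apply: ler_wpM2l; [exact: ltW|exact: clamp_lip].
have fM_ge0 x : 0 <= fM x.
  rewrite /fM; have /andP[] := clM x; rewrite le_eqVlt => /predU1P[<- _|/f_gt0/ltW//].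
  exact: C1_ge0_at0.
pose N := fM 0 + L * M.
have fM_le x : fM x <= N.
  have h : `|fM x - fM 0| <= L * M.
    rewrite /fM (@clamp_id R 0 M 0); last by rewrite lexx ltW.
    apply: le_trans (HL _ _ (clM x) _) _; first by rewrite lexx ltW.
    have /andP[h1 h2] := clM x.
    by rewrite subr0 ger0_norm//; apply: ler_wpM2l => //; exact: ltW.
  by have /andP[_] := ler_norm_bound h; rewrite /N; lra.
have N0 : 0 <= N by exact: le_trans (fM_le 0).
pose E := expR (- ya).
pose e t := expR (- Num.max t ya) / 4.
have e0 t : 0 <= e t by rewrite /e divr_ge0// expR_ge0.
have eE t : e t <= E.
  rewrite /e /E; have : expR (- Num.max t ya) <= expR (- ya).
    by rewrite ler_expR lerN2 le_max lexx orbT.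
  have := expR_ge0 (- Num.max t ya); lra.
have E0 : 0 <= E by exact: expR_ge0.
have emax_cont : continuous e.
  move=> t; rewrite /e; apply (@cont_mul R R); last exact: cont_cst.
  apply (@cont_comp R R); last exact: continuous_expR.
  apply (@cont_opp R R); apply: (@lip_continuous _ _ 1) => x y; rewrite mul1r.
  have h1 := ler_norm (x - y); have h2 := ler_norm (y - x).
  rewrite distrC in h2; rewrite ler_norml.
  clear -h1 h2.
  by case: (leP x ya) => ?; case: (leP y ya) => ?; apply/andP; split; lra.
have fM_cont : continuous fM by exact: lip_continuous fM_lip.
pose K := 1 + E * L.
have EL : 0 <= E * L by rewrite mulr_ge0// ltW.
have K1 : 1 <= K by rewrite /K; lra.
pose F1 (t x y : R) := y; pose F2 (t x y : R) := - (e t * fM x).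
have lip1 t x y x' y' : `|F1 t x y - F1 t x' y'| <= K * (`|x - x'| + `|y - y'|).
  rewrite /F1; apply: le_trans (_ : 1 * (`|x - x'| + `|y - y'|) <= _).
    by have := normr_ge0 (x - x'); lra.
  by apply: ler_wpM2r => //; rewrite addr_ge0.
have lip2 t x y x' y' : `|F2 t x y - F2 t x' y'| <= K * (`|x - x'| + `|y - y'|).
  rewrite /F2 -opprD normrN -mulrBr normrM (ger0_norm (e0 t)).
  apply: le_trans (ler_pM (e0 t) (normr_ge0 _) (eE t) (fM_lip x x')) _.
  rewrite mulrA; apply: ler_pM => //; first by rewrite /K; lra.
  by have := normr_ge0 (y - y'); lra.
have [|||t|Z [Z0 dZ]] := @picard_exists R (fun b => if b then F1 else F2) K
  (c0 + E * N) y0 (fun b => if b then u0 else c0).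
- by lra.
- case=> X Y cX cY //.
  move=> t; rewrite /F2; apply (@cont_opp R R); apply (@cont_mul R R).
    exact: emax_cont.
  by apply (@cont_comp R R); [exact: cX|exact: fM_cont].
- by case; [exact: lip1|exact: lip2].
- case: t => t; rewrite /F1 /F2.
    by rewrite gtr0_norm//; have := mulr_ge0 E0 N0; lra.
  rewrite normrN ger0_norm ?mulr_ge0//.
  by have := ler_pM (e0 t) (fM_ge0 u0) (eE t) (fM_le u0); lra.
pose w := Z true; pose z := Z false.
have w0 : w y0 = u0 := Z0 true.
have z0 : z y0 = c0 := Z0 false.
have dw (t : R) : is_derive t 1 w (z t) := dZ true t.
have dz (t : R) : is_derive t 1 z (- (e t * fM (w t))) := dZ false t.
have eqe t : ya <= t -> e t = expR (- t) / 4 by move=> h; rewrite /e (max_idPl h).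
have F2u t : y0 <= t <= y2 -> - (expR (- t) * f (u t) / 4) = F2 t (u t) (v t).
  move=> /andP[y0t ty2]; rewrite /F2 eqe; last by lra.
  rewrite /fM clamp_id; first by ring.
  by rewrite umono// andbT ltW//; case: (uv t y0t).
have same t : y0 <= t <= y2 -> w t = u t /\ z t = v t.
  move=> /andP[y0t ty2].
  have K0 : 0 <= K by exact: le_trans K1.
  have g1 (x : R) : y0 <= x <= t -> is_derive x 1 u (F1 x (u x) (v x)).
    by move=> /andP[y0x _]; case: (uv x y0x).
  have g2 (x : R) : y0 <= x <= t -> is_derive x 1 v (F2 x (u x) (v x)).
    move=> /andP[y0x xt]; rewrite -F2u ?y0x ?(le_trans xt)//.
    by case: (uv x y0x).
  have := @gronwall_pair R F1 F2 K lip1 lip2 u v w z y0 t y0t K0 g1 g2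
    (fun x _ => dw x) (fun x _ => dz x).
  rewrite -/u0 -/c0 w0 z0 !subrr expr0n/= addr0 mul0r => H.
  have := sqr_ge0 (u t - w t); have := sqr_ge0 (v t - z t) => h1 h2.
  have /eqP : (u t - w t) ^+ 2 = 0 by clear -H h1 h2; lra.
  have /eqP : (v t - z t) ^+ 2 = 0 by clear -H h1 h2; lra.
  by rewrite !sqrf_eq0 !subr_eq0 => /eqP-> /eqP->.
have z_ge t : t <= y0 -> c0 <= z t.
  move=> ty; rewrite -z0 -lerN2.
  apply: (is_derive_ge0_le ty (fun x _ => is_derive_Nl (dz x))) => x _.
  by rewrite opprK mulr_ge0.
have w_le t : t <= y0 -> w t <= u0 - c0 * (y0 - t).
  move=> ty; suff : w t - c0 * t <= w y0 - c0 * y0 by rewrite w0; lra.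
  have d (x : R) : is_derive x 1 (fun t => w t - c0 * t) (z x - c0).
    have := is_derive_Bl (dw x) (is_derive_Ml (is_derive_cstl c0 x (1 : R)) (is_derive_idl x)).
    by move/is_derive_eq; apply; ring.
  apply: (is_derive_ge0_le ty (fun x _ => d x)) => x /andP[_ xy].
  by rewrite subr_ge0 z_ge// ltW.
have wya : w ya < 0.
  apply: le_lt_trans (w_le ya (ltW ya0)) _.
  have -> : u0 - c0 * (y0 - ya) = - c0 by rewrite /ya; field; rewrite gt_eqF.
  by rewrite oppr_lt0.
have [||r0] := @IVT R w ya y0 0 (ltW ya0).
- by apply: is_derive_within => x _; exact: dw.
- by rewrite w0 ge_min le_max (ltW wya) (ltW u00) orbT.
rewrite in_itv/= => /andP[yar0 r0y0] wr0.
have w_mono a b : a < b -> b <= y0 -> w a < w b.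
  move=> ab bY; apply: (@is_derive_gt0_lt R w z) => // t /andP[_ tb].
  by apply: lt_le_trans c00 (z_ge t _); rewrite ltW// (lt_le_trans tb).
(* The two solutions agree on all of [y0, y2]. Switching strictly inside this overlap means that
   around every point one of the two formulas holds in a full neighbourhood, so derivatives need no
   matching. *)
pose ym := y0 + 2^-1.
have [y0m m2] : y0 < ym /\ ym <= y2 by rewrite /ym /y2 ltrDl invr_gt0 lerD2l invf_le1// ler1n.
have y0y2 : y0 < y0 + 1 by rewrite ltrDl.
clearbody ym y2.
pose U y := if y < ym then w y else u y.
pose V y := if y < ym then z y else v y.
pose W y := if y < ym then - (e y * fM (w y)) else - (expR (- y) * f (u y) / 4).
have right t : y0 < t -> [/\ U t = u t, V t = v t & W t = - (expR (- t) * f (u t) / 4)].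
  move=> y0t; rewrite /U /V /W; case: ltP => // tm.
  have ht : y0 <= t <= y2 by rewrite (ltW y0t) (le_trans (ltW tm)).
  by have [wE zE] := same t ht; split=> //; rewrite wE (F2u t ht).
have left t : t < ym -> [/\ U t = w t, V t = z t & W t = - (e t * fM (w t))].
  by move=> tm; rewrite /U /V /W tm.
have nearL y : y < ym -> \forall t \near y, t < ym by move=> h; exact: lt_nbhsl.
have nearR y : ym <= y -> \forall t \near y, y0 < t.
  by move=> h; apply: lt_nbhsr; exact: lt_le_trans h.
exists U, V, W, r0; split.
- by have [-> _ _] := left r0 (le_lt_trans r0y0 y0m).
- move=> y; have [ym_|ym_] := ltP y ym.
    have [_ -> ->] := left y ym_; split.
      apply: near_eq_is_derive (dw y); near=> t.
      by have [-> _ _] // : [/\ U t = w t, V t = z t & W t = - (e t * fM (w t))];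
        apply: left; near: t; exact: nearL.
    apply: near_eq_is_derive (dz y); near=> t.
    by have [_ -> _] // : [/\ U t = w t, V t = z t & W t = - (e t * fM (w t))];
      apply: left; near: t; exact: nearL.
  have y0y : y0 < y by exact: lt_le_trans ym_.
  have [_ -> ->] := right y y0y.
  have [du dv _ _] := uv y (ltW y0y); split.
    apply: near_eq_is_derive du; near=> t.
    have [-> //] : [/\ U t = u t, V t = v t & W t = - (expR (- t) * f (u t) / 4)].
    by apply: right; near: t; exact: nearR.
  apply: near_eq_is_derive dv; near=> t.
  have [_ -> //] : [/\ U t = u t, V t = v t & W t = - (expR (- t) * f (u t) / 4)].
  by apply: right; near: t; exact: nearR.
- move=> y; have [ym_|ym_] := ltP y ym.
    have c1 : {for y, continuous (fun t => - (e t * fM (w t)))}.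
      apply (@cont_opp R R); apply (@cont_mul R R); first exact: emax_cont.
      by apply (@cont_comp R R); [exact: is_derive_cont (dw y)|exact: fM_cont].
    rewrite /continuous_at; have [_ _ ->] := left y ym_.
    apply: cvg_trans c1; apply: near_eq_cvg; near=> t.
    have [_ _ -> //] : [/\ U t = w t, V t = z t & W t = - (e t * fM (w t))].
    by apply: left; near: t; exact: nearL.
  have y0y : y0 < y by exact: lt_le_trans ym_.
  have [du _ _ uy] := uv y (ltW y0y).
  have c1 : {for y, continuous (fun t => - (expR (- t) * f (u t) / 4))}.
    apply (@cont_opp R R); apply (@cont_mul R R); last exact: cont_cst.
    apply (@cont_mul R R).
      apply (@cont_comp R R); last exact: continuous_expR.
      by apply (@cont_opp R R); exact: cvg_id.
    by apply (@cont_comp R R); [exact: is_derive_cont du|exact: C1_cont].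
  rewrite /continuous_at; have [_ _ ->] := right y y0y.
  apply: cvg_trans c1; apply: near_eq_cvg; near=> t.
  have [_ _ -> //] : [/\ U t = u t, V t = v t & W t = - (expR (- t) * f (u t) / 4)].
  by apply: right; near: t; exact: nearR.
- move=> y r0y; have [yy|yy] := leP y y0.
    have [-> -> ->] := left y (le_lt_trans yy y0m).
    have wy : 0 < w y by rewrite -wr0; exact: w_mono.
    have wM : w y <= M.
      apply: le_trans u0M; apply: le_trans (w_le y yy) _.
      by rewrite lerBlDr lerDl mulr_ge0 ?(ltW c00)// subr_ge0.
    split => //; first exact: lt_le_trans c00 (z_ge y yy).
    rewrite /fM clamp_id ?eqe ?(ltW wy) ?wM//; last by rewrite (le_trans yar0)// ltW.
    by ring.
  by have [-> -> ->] := right y yy; case: (uv y (ltW yy)).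
- by move=> y yy; have [-> ->] := right y (lt_le_trans y0y2 yy).
Unshelve. all: by end_near. Qed.

End Extension.

Section Radial.
Variables (R : realType) (f : R -> R) (B : R).

Lemma inv_sqrt_le (s : R) : 1 <= B -> 32 * 32 <= s -> (Num.sqrt (B * s))^-1 <= 32^-1.
Proof.
move=> B1 s32; have s0 : 0 <= s by apply: le_trans s32; rewrite mulr_ge0.
have h : 32 <= Num.sqrt (B * s).
  apply: ler_of_sqr; first exact: sqrtr_ge0.
  rewrite sqr_sqrtr; last by rewrite mulr_ge0// (le_trans ler01).
  by apply: (le_trans s32); rewrite ler_peMl.
by rewrite lef_pV2 ?posrE// (lt_le_trans _ h).
Qed.

Lemma small_remainder (s S : R) : 1 <= B -> 1 <= s ->
  Num.sqrt s * S <= (48 * B * B * (1536 * B))^-1 ->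
  12 * (4 * B) * B * S <= (Num.sqrt (B * s))^-1 / 1536.
Proof.
move=> B1 s1 h3; have B0 : 0 < B by exact: lt_le_trans B1.
have sp : 0 < s by exact: lt_le_trans s1.
have q0 : 0 < Num.sqrt s by rewrite sqrtr_gt0.
have qB : Num.sqrt (B * s) <= B * Num.sqrt s.
  rewrite sqrtrM; last exact: ltW.
  apply: ler_wpM2r; first exact: ltW.
  apply: ler_of_sqr; first exact: ltW.
  by rewrite sqr_sqrtr ?(ltW B0)// expr2 ler_peMl// ltW.
have qBs : 0 < Num.sqrt (B * s) by rewrite sqrtr_gt0 mulr_gt0.
rewrite mulrC -ler_pdivlMr// in h3.
have c0 : 0 <= 12 * (4 * B) * B by have b0 := ltW B0; apply: mulr_ge0 => //; apply: mulr_ge0 => //; apply: mulr_ge0.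
apply: le_trans (ler_wpM2l c0 h3) _.
rewrite [leLHS](_ : _ = (B * Num.sqrt s)^-1 / 1536).
  by apply: ler_wpM2r; [rewrite invr_ge0 ler0n|rewrite lef_pV2// posrE mulr_gt0].
by field; rewrite !gt_eqF.
Qed.

Lemma near1_bounds (a : R) : `|a - 1| <= 2^-1 -> 2^-1 <= a <= 2.
Proof. by rewrite ler_norml => /andP[? ?]; apply/andP; split; lra. Qed.

Lemma half_bound (C S k : R) : 1 <= B -> 0 <= C * S -> 12 * C * B * S <= k / 1536 ->
  k <= 32^-1 -> C * S <= 2^-1.
Proof.
move=> B1 c0 h k32; have := mulr_ge0 c0 (ltac:(lra) : 0 <= B - 1); lra.
Qed.

Lemma radial_solution : hyp_f1 f -> 1 <= B -> C1_ge0 f ->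
  (forall s : R, 0 < s -> [/\ 0 < f s, (tailint f s < +oo)%E & 0 < derive1 f s]) ->
  (forall e : R, 0 < e -> exists m : R, forall s, m <= s ->
     Num.sqrt s * (rem1 f B s + rem2 f B s) <= e) ->
  exists (U V W : R -> R) (r0 K y3 : R),
  [/\ U r0 = 0,
      forall y : R, is_derive y 1 U (V y) /\ is_derive y 1 V (W y),
      continuous W,
      forall y, r0 < y -> [/\ 0 < U y, 0 < V y & W y = - (expR (- y) * f (U y) / 4)] &
      (forall e, 0 < e -> exists n, forall y, n <= y -> V y <= e) /\
      forall y, y3 <= y -> [/\ 0 < f (usigma f B y), 0 < Gmodel B y,
        Fint f (usigma f B y) = Gmodel B y &
        `|U y - usigma f B y| <= K * (f (usigma f B y) * Gmodel B y * remsup f B y)]].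
Proof.
move=> [s0 [s00 C2 _]] B1 C1 fpos small.
have B0 : 0 < B by exact: lt_le_trans B1.
have fp s : 0 < s -> 0 < f s by move=> /fpos[].
have fi s : 0 < s -> 0 < derive1 f s by move=> /fpos[].
have [m1 m12 H1] := coefA_bounds B1 C1 fpos s00 C2.
have [m2 m21 [Hle Hge Hdec Hsm]] := remsup_spec small.
(* With C = 4 B one has 12 C B = 48 B^2; the last factor B pays for sqrt(B s) <= B sqrt s. *)
pose e1 := (48 * B * B * (1536 * B))^-1.
have e10 : 0 < e1.
  by rewrite invr_gt0; apply: mulr_gt0; [apply: mulr_gt0; lra|lra].
have [m3 H3] := Hsm e1 e10.
pose s1 := Num.max (Num.max m1 m2) (Num.max m3 (32 * 32)).
have s1P s : s1 <= s -> [/\ m1 <= s, m2 <= s, m3 <= s & 32 * 32 <= s].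
  by rewrite !ge_max => /andP[/andP[? ?] /andP[? ?]].
have s11 : 1 <= s1.
  by have [_ _ _] := s1P s1 (lexx _); apply: le_trans; lra.
have sp s : s1 <= s -> 0 < s by move=> ss; exact: lt_le_trans (lt_le_trans ltr01 s11) ss.
clearbody s1.
(* The derivative of A is known to exist for large s only; 'D_1 turns it into a total function. *)
pose A := coefA B f (usigma f B); pose dA s := 'D_1 A s; pose C := 4 * B.
pose S := remsup f B.
have C0 : 0 < C by rewrite mulr_gt0.
have dAP (s : R) : s1 <= s -> is_derive s 1 A (dA s).
  by move=> /s1P[h _ _ _]; have [_ _ _ _ [d []]] := H1 s h; split.
have S0 s : s1 <= s -> 0 <= S s by move=> /s1P[_ h _ _]; exact: Hge.
have Sd s t : s1 <= s -> s <= t -> S t <= S s by move=> /s1P[_ h _ _]; exact: Hdec.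
have A1 s : s1 <= s -> `|A s - 1| <= C * S s.
  move=> /s1P[h h2 _ _]; have [_ _ _ hA _] := H1 s h; apply: le_trans hA _.
  by apply: ler_wpM2l; [exact: ltW|exact: Hle].
have dA1 s : s1 <= s -> `|dA s| <= C * S s / s.
  move=> ss; have [h h2 _ h4] := s1P s ss.
  have [_ _ _ _ [d [_ dE]] hd] := H1 s h.
  rewrite /dA dE; apply: le_trans hd _; apply: ler_wpM2r; first by rewrite invr_ge0 ltW// sp.
  by apply: ler_wpM2l; [exact: ltW|exact: Hle].
have ks s : s1 <= s -> (Num.sqrt (B * s))^-1 <= 32^-1.
  by move=> /s1P[_ _ _]; exact: inv_sqrt_le.
have Ss s : s1 <= s -> 12 * C * B * S s <= (Num.sqrt (B * s))^-1 / 1536.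
  move=> ss; have [_ _ h3 _] := s1P s ss.
  by apply: small_remainder => //; [exact: le_trans ss|exact: H3].
have [mu [c [del [mu1 mu2 c1 dmu ddel]]]] :=
  singular_profile_exists B1 C0 s11 dAP S0 Sd A1 dA1 ks Ss.
have A2 s : s1 <= s -> 2^-1 <= A s <= 2.
  move=> ss; have CS : 0 <= C * S s by apply: mulr_ge0; [exact: ltW|exact: S0].
  have := le_trans (A1 s ss) (half_bound B1 CS (Ss s ss) (ks s ss)).
  by exact: near1_bounds.
pose ut := usigma f B; pose D := slope B f ut.
have utP (s : R) : s1 <= s -> [/\ s0 < ut s, Fint f (ut s) = Gmodel B s & is_derive s 1 ut (D s)].
  by move=> /s1P[h _ _ _]; have [] := H1 s h.
have DE s : s1 <= s -> D s = f (ut s) * Wmodel B s by [].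
have D0 s : s1 <= s -> 0 < D s.
  move=> ss; have [h _ _] := utP s ss.
  by apply: mulr_gt0; [exact: fp (lt_trans s00 h)|apply: Wmodel_gt0 => //; exact: sp].
have dD (s : R) : s1 <= s -> is_derive s 1 D (- (A s / (B * s)) * D s).
  move=> ss; have [h _ dut] := utP s ss.
  apply: is_derive_slope => //; [by rewrite gt_eqF|exact: sp|].
  by apply: C1_derivable => //; exact: lt_trans s00 h.
have dut (s : R) : s1 <= s -> is_derive s 1 ut (D s) by move=> /utP[].
have [u [v [y0 [duv uut v0 est]]]] :=
  singular_branch B1 s11 dut DE D0 dD A2 mu2 c1 dmu ddel.
have uv (y : R) : y0 <= y -> [/\ is_derive y 1 u (v y),
     is_derive y 1 v (- (expR (- y) * f (u y) / 4)), 0 < v y & 0 < u y].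
  move=> yy; have [d1 d2 v00] := duv y yy; split => //.
  by have [s ss ->] := uut y yy; have [h _ _] := utP s ss; exact: lt_trans s00 h.
have [U [V [W [r0 [Ur0 dU cW pos UE]]]]] := extend_left C1 fp fi uv.
pose K := expR 21 * (26 * C * B).
exists U, V, W, r0, K, (Num.max (y0 + 1) (s1 + 9)); split => //; split.
  move=> e e0; have [n Hn] := v0 e e0; exists (Num.max n (y0 + 1)) => y.
  by rewrite ge_max => /andP[ny yy]; have [_ ->] := UE y yy; exact: Hn.
move=> y; rewrite ge_max => /andP[yy ys]; have [-> _] := UE y yy.
have ss : s1 <= y by apply: le_trans ys; rewrite lerDl.
have [h FE _] := utP y ss.
have fu : 0 < f (ut y) by exact: fp (lt_trans s00 h).
have Gy : 0 < Gmodel B y by apply: Gmodel_gt0 => //; exact: sp.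
split => //; apply: le_trans (est y ys) _.
(* D = f(ut) W with W = y / (y + 1) * G, and G = F(ut): this gives the form f F of the error
   term. *)
have DG : D y <= f (ut y) * Gmodel B y.
  apply: ler_wpM2l; first exact: ltW.
  have y1 : 0 < y + 1 by rewrite addr_gt0// sp.
  rewrite WmodelE; last by rewrite gt_eqF.
  by rewrite ler_piMl// ?(ltW Gy)// ler_pdivrMr// mul1r lerDl.
have -> : K * (f (ut y) * Gmodel B y * S y) =
    (expR 21 * (f (ut y) * Gmodel B y)) * (26 * C * B * S y) by rewrite /K; ring.
have a1 : 0 <= expR 21 * D y := mulr_ge0 (expR_ge0 _) (ltW (D0 y ss)).
have a2 : expR 21 * D y <= expR 21 * (f (ut y) * Gmodel B y) :=
  ler_wpM2l (expR_ge0 _) DG.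
exact: ler_pM a1 (normr_ge0 _) a2 (mu1 y ss).
Qed.

End Radial.

(** * Regularised radial functions in the plane *)

Section Plane.
Variable R : realType.
Local Notation plane := (R * R)%type.
Implicit Types (x v w : plane) (e r : R).

Definition sqn x : R := x.1 ^+ 2 + x.2 ^+ 2.
Definition inner v x : R := v.1 * x.1 + v.2 * x.2.

Lemma sqn_ge0 x : 0 <= sqn x. Proof. by rewrite addr_ge0 ?sqr_ge0. Qed.

Lemma enorm_sqr x : enorm x ^+ 2 = sqn x.
Proof. by rewrite sqr_sqrtr// sqn_ge0. Qed.

Lemma is_derive_lim (h : plane -> R) x v (l : R) :
  (forall s : R, s != 0 -> s^-1 * (h (s *: v + x) - h x) = l) -> is_derive x v h l.
Proof.
move=> H; have lim : s^-1 *: ((h \o shift x) (s *: v) - h x) @[s --> (0 : R)^'] --> l.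
  have c : (fun _ : R => l) s @[s --> (0 : R)^'] --> l by exact: cvg_cst.
  apply: cvg_trans c; apply: near_eq_cvg.
  by exists 1 => //= s _ s0; rewrite -(H s s0).
by split; [apply/cvg_ex; exists l|exact: cvg_lim lim].
Qed.

Lemma is_derive_coord1 x v : is_derive x v (fun y : plane => y.1) v.1.
Proof.
by apply: is_derive_lim => s s0; rewrite /= addrK -[s *: v.1]/(s * v.1) mulrA mulVf// mul1r.
Qed.

Lemma is_derive_coord2 x v : is_derive x v (fun y : plane => y.2) v.2.
Proof.
by apply: is_derive_lim => s s0; rewrite /= addrK -[s *: v.2]/(s * v.2) mulrA mulVf// mul1r.
Qed.

Lemma is_derive_sqn x v : is_derive x v sqn (2 * inner v x).
Proof.
have := is_derive_Dl (is_derive_sqrl (is_derive_coord1 x v))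
  (is_derive_sqrl (is_derive_coord2 x v)).
by move/is_derive_eq; apply; rewrite /inner; ring.
Qed.

Lemma is_derive_inner x v w : is_derive x w (inner v) (inner v w).
Proof.
have := is_derive_Dl (is_derive_Ml (is_derive_cstl v.1 x w) (is_derive_coord1 x w))
  (is_derive_Ml (is_derive_cstl v.2 x w) (is_derive_coord2 x w)).
by move/is_derive_eq; apply; rewrite /inner; ring.
Qed.

Lemma cont_coord1 x : {for x, continuous (fun y : plane => y.1)}.
Proof. exact: cvg_fst. Qed.

Lemma cont_coord2 x : {for x, continuous (fun y : plane => y.2)}.
Proof. exact: cvg_snd. Qed.

Lemma cont_sqn x : {for x, continuous sqn}.
Proof.
apply (@cont_add R plane).
  apply (@cont_comp R plane (fun t => t ^+ 2)); first exact: cont_coord1.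
  exact: exprn_continuous.
apply (@cont_comp R plane (fun t => t ^+ 2)); first exact: cont_coord2.
exact: exprn_continuous.
Qed.

Lemma cont_inner v x : {for x, continuous (inner v)}.
Proof.
apply (@cont_add R plane); apply (@cont_mul R plane); try exact: cont_cst.
  exact: cont_coord1.
exact: cont_coord2.
Qed.

Section Regularized.
Variables (U V W : R -> R) (e : R).
Hypothesis dU : forall t : R, is_derive t 1 U (V t).
Hypothesis dV : forall t : R, is_derive t 1 V (W t).
Hypothesis cW : continuous W.

(* log(1/|x|^2), regularised by e at the origin. *)
Definition regtau x : R := - ln (sqn x + e).
(** One family for both uses: with e = 0 it is the solution itself, on the plane without the origin,
    and with e > 0 it is of class C^2 on the whole plane. [regdom] is the domain in either case. *)
Definition regsol x : R := U (regtau x).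
Definition regsol1 v x : R := V (regtau x) * (- (2 * inner v x) / (sqn x + e)).
Definition regsol2 v w x : R :=
  W (regtau x) * (4 * inner v x * inner w x / (sqn x + e) ^+ 2) +
  V (regtau x) * (4 * inner v x * inner w x / (sqn x + e) ^+ 2
                  - 2 * inner v w / (sqn x + e)).

Definition regdom : set plane := [set x | 0 < sqn x + e].

Lemma cont_shift x : {for x, continuous (fun y => sqn y + e)}.
Proof. apply (@cont_add R plane); [exact: cont_sqn|exact: cont_cst]. Qed.

Lemma regdom_near x : regdom x -> \forall y \near x, regdom y.
Proof.
move=> x0; have /cvgrPdist_lt/(_ _ x0) := @cont_shift x.
apply: filterS => y /=; rewrite ltr_norml => /andP[_]; rewrite /regdom/=; lra.
Qed.

Lemma is_derive_regtau x v : regdom x ->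
  is_derive x v regtau (- (2 * inner v x) / (sqn x + e)).
Proof.
move=> x0; have := is_derive_Nl (is_derive_lnl (f := fun y => sqn y + e) x0 (is_derive_Dl (is_derive_sqn x v)
  (is_derive_cstl e x v))).
by move/is_derive_eq; apply; rewrite addr0; ring.
Qed.

Lemma is_derive_regsol x v : regdom x -> is_derive x v regsol (regsol1 v x).
Proof. by move=> x0; apply: is_derive_compl (dU _); exact: is_derive_regtau. Qed.

Lemma is_derive_regsol1 x v w : regdom x ->
  is_derive x w (regsol1 v) (regsol2 v w x).
Proof.
move=> x0; have xn : sqn x + e != 0 by rewrite gt_eqF.
have := is_derive_Ml (is_derive_compl (is_derive_regtau w x0) (dV _))
  (is_derive_Ml (is_derive_Nl (is_derive_Ml (is_derive_cstl 2 x w) (is_derive_inner x v w)))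
   (is_derive_Vl (f := fun y => sqn y + e) xn (is_derive_Dl (is_derive_sqn x w) (is_derive_cstl e x w)))).
by move/is_derive_eq; apply; rewrite /regsol2; field.
Qed.

Lemma cont_regtau x : regdom x -> {for x, continuous regtau}.
Proof.
move=> x0; apply (@cont_opp R plane); apply (@cont_comp R plane); first exact: cont_shift.
exact: continuous_ln.
Qed.

Lemma cont_regsol x : regdom x -> {for x, continuous regsol}.
Proof.
move=> x0; apply (@cont_comp R plane); first exact: cont_regtau.
exact: is_derive_cont (dU _).
Qed.

Lemma cont_regsol1 v x : regdom x -> {for x, continuous (regsol1 v)}.
Proof.
move=> x0; apply (@cont_mul R plane).
  apply (@cont_comp R plane); first exact: cont_regtau.
  exact: is_derive_cont (dV _).
apply (@cont_mul R plane).
  apply (@cont_opp R plane); apply (@cont_mul R plane); first exact: cont_cst.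
  exact: cont_inner.
apply (@cont_inv R plane); first by rewrite gt_eqF.
exact: cont_shift.
Qed.

Lemma cont_regsol2 v w x : regdom x -> {for x, continuous (regsol2 v w)}.
Proof.
move=> x0.
have c1 : {for x, continuous (fun x => 4 * inner v x * inner w x / (sqn x + e) ^+ 2)}.
  apply (@cont_mul R plane).
    apply (@cont_mul R plane); last exact: cont_inner.
    by apply (@cont_mul R plane); [exact: cont_cst|exact: cont_inner].
  apply (@cont_inv R plane); first by rewrite expf_neq0// gt_eqF.
  apply (@cont_comp R plane (fun t => t ^+ 2)); first exact: cont_shift.
  exact: exprn_continuous.
apply (@cont_add R plane).
  apply (@cont_mul R plane) => //.
  by apply (@cont_comp R plane); [exact: cont_regtau|exact: cW].
apply (@cont_mul R plane).
  by apply (@cont_comp R plane); [exact: cont_regtau|exact: is_derive_cont (dV _)].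
apply (@cont_sub R plane) => //.
apply (@cont_mul R plane); first exact: cont_cst.
by apply (@cont_inv R plane); [rewrite gt_eqF|exact: cont_shift].
Qed.

Lemma near_D_regsol v x : regdom x ->
  \forall y \near x, regsol1 v y = 'D_v regsol y.
Proof.
move=> /regdom_near; apply: filterS => y y0.
by have [_ ->] := is_derive_regsol v y0.
Qed.

Lemma is_derive_D_regsol v w x : regdom x ->
  is_derive x w (fun y => 'D_v regsol y) (regsol2 v w x).
Proof.
by move=> x0; apply: near_eq_is_derive (is_derive_regsol1 v w x0); exact: near_D_regsol.
Qed.

Lemma cont_near_eq (h k : plane -> R) x : (\forall y \near x, h y = k y) ->
  {for x, continuous h} -> {for x, continuous k}.
Proof.
move=> hk ch; rewrite /prop_for /continuous_at -(nbhs_singleton hk).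
by apply: cvg_trans ch; apply: near_eq_cvg; apply: filterS hk.
Qed.

Lemma regsol_C1 v : Cn 1 regdom (fun y => 'D_v regsol y).
Proof.
have c2 w x : regdom x -> {for x, continuous (fun y => 'D_w (fun z => 'D_v regsol z) y)}.
  move=> x0; apply: (@cont_near_eq (regsol2 v w)); last exact: cont_regsol2.
  move/regdom_near : x0; apply: filterS => y y0.
  by have [_ ->] := is_derive_D_regsol v w y0.
split.
  move=> x x0; apply: (@cont_near_eq (regsol1 v)); first exact: near_D_regsol.
  exact: cont_regsol1.
split.
- move=> x x0; split.
    by have [] := is_derive_D_regsol v (1, 0) x0.
  by have [] := is_derive_D_regsol v (0, 1) x0.
- by split => // x; exact: c2.
- by split => // x; exact: c2.
Qed.

Lemma regsol_C2 : Cn 2 regdom regsol.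
Proof.
split; first by move=> x; exact: cont_regsol.
split; [|exact: regsol_C1|exact: regsol_C1].
move=> x x0; split.
  by have [] := is_derive_regsol (1, 0) x0.
by have [] := is_derive_regsol (0, 1) x0.
Qed.

Lemma laplacian_regsol x : regdom x ->
  laplacian regsol x = 4 * W (regtau x) * sqn x / (sqn x + e) ^+ 2
    - 4 * V (regtau x) * e / (sqn x + e) ^+ 2.
Proof.
move=> x0; rewrite /laplacian /d1 /d2.
have [_ E1] := is_derive_D_regsol (1, 0) (1, 0) x0.
have [_ E2] := is_derive_D_regsol (0, 1) (0, 1) x0.
apply: (etrans (congr2 +%R E1 E2)).
rewrite /regsol2 /inner /=; have xn : sqn x + e != 0 by rewrite gt_eqF.
by move: xn; rewrite /sqn => xn; field.
Qed.

End Regularized.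

Lemma Cn_subset n (W W' : set plane) (u : plane -> R) : W' `<=` W -> Cn n W u -> Cn n W' u.
Proof.
move=> s; elim: n u => [|n IH] u [cu H]; first by split=> // x /s; exact: cu.
have [du h1 h2] := H; split; first by move=> x /s; exact: cu.
by split; [move=> x /s; exact: du|exact: IH|exact: IH].
Qed.

End Plane.

(** * Integration over squares *)

Section PlaneMeasure.
Variable R : realType.
Local Notation plane := (R * R)%type.
Local Notation mplane := (measurableTypeR R * measurableTypeR R)%type.
Implicit Types (O : set plane) (h : plane -> R) (M : R).

(** The measure lives on the product of the two sigma-algebras, so open sets are written as
    countable unions of boxes with rational centres. *)
Lemma measurable_open_plane O : open O -> measurable (O : set mplane).
Proof.
move=> oO.
pose bx (q : rat * rat * nat) : set mplane :=
  [set` `]ratr q.1.1 - (q.2.+1%:R)^-1 : R, ratr q.1.1 + (q.2.+1%:R)^-1[] `*`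
  [set` `]ratr q.1.2 - (q.2.+1%:R)^-1 : R, ratr q.1.2 + (q.2.+1%:R)^-1[].
pose c q : set mplane := [set x | bx q x /\ bx q `<=` O].
have -> : O = \bigcup_q c q.
  rewrite eqEsubset; split=> [x Ox|x [q _ [bqx]]]; last exact.
  have /nbhs_ballP[r /= r0 br] : nbhs x O by apply: open_nbhs_nbhs.
  (* The factor 2: a box of half-width d that contains x lies within 2 d of x. *)
  have [n nr] : exists n, 2 * (n.+1%:R)^-1 < r.
    exists (Num.Def.truncn (2 / r)).
    by rewrite ltr_pdivrMr ?ltr0Sn// mulrC -ltr_pdivrMr// truncnS_gt.
  set d := (n.+1%:R)^-1 in nr; have d0 : 0 < d by rewrite invr_gt0.
  have xd (a : R) : exists q : rat, a \in `]ratr q - d, ratr q + d[.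
    have /rat_in_itvoo[q] : a - d < a + d by rewrite ltrBlDr -addrA ltrDl addr_gt0.
    by rewrite in_itv/= => /andP[h1 h2]; exists q; rewrite in_itv/= ltrBlDr ltrBlDr in h1 *; lra.
  have [q1 h1] := xd x.1; have [q2 h2] := xd x.2.
  exists (q1, q2, n) => //; split; first by split.
  move=> y [/= y1 y2]; apply: br; split; rewrite /ball/=.
    by rewrite -/d !in_itv/= in h1 y1; rewrite ltr_norml; lra.
  by rewrite -/d !in_itv/= in h2 y2; rewrite ltr_norml; lra.
apply: countable_bigcupT_measurable; first exact: countableP.
move=> q; have [sO|nO] := pselect (bx q `<=` O).
  rewrite (_ : c q = bx q); last by rewrite eqEsubset; split=> x; [case|].
  by apply: measurableX; exact: measurable_itv.
rewrite (_ : c q = set0); first exact: measurable0.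
by rewrite -subset0 => x [].
Qed.

Lemma measurable_cont_plane O h : open O ->
  (forall x, O x -> {for x, continuous h}) ->
  measurable_fun (O : set mplane) (h : mplane -> measurableTypeR R).
Proof.
move=> oO ch; apply: (measurability _ (RGenOpens.measurableE R)).
move=> _ [_ [a [b ->] <-]]; apply: measurable_open_plane.
rewrite openE => x [Ox hx]; apply: filterI; first exact: open_nbhs_nbhs.
by apply: ch => //; apply: open_nbhs_nbhs; split=> //; exact: interval_open.
Qed.

Lemma measurable_compact_plane O : compact O -> measurable (O : set mplane).
Proof.
move=> /compact_closed cO; rewrite (esym (setCK O)); apply: measurableC.
by apply: measurable_open_plane; apply: closed_openC; apply: cO; exact: norm_hausdorff.
Qed.

Definition box M : set plane := `[- M, M] `*` `[- M, M].

Lemma compact_box M : compact (box M).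
Proof. by apply: compact_setX; exact: segment_compact. Qed.

Lemma measurable_box M : measurable (box M : set mplane).
Proof. by apply: measurableX; exact: measurable_itv. Qed.

Lemma lebesgue2_box M : 0 < M -> lebesgue2 (box M) = ((2 * M) * (2 * M))%:E.
Proof.
move=> M0; have itvM : lebesgue_measure (`[- M, M]%classic : set R) = (2 * M)%:E.
  rewrite lebesgue_measure_itv/= lte_fin ifT; last lra.
  by rewrite -EFinD; congr (_%:E); lra.
rewrite /lebesgue2 product_measure1E; [|exact: measurable_itv|exact: measurable_itv].
by rewrite [X in (X * _)%E]itvM [X in (_ * X)%E]itvM.
Qed.

Lemma bounded_box M h : continuous h -> exists K, forall x, box M x -> `|h x| <= K.
Proof.
move=> ch; have /compact_bounded/pinfty_ex_gt0[K K0 hK] : compact (h @` box M).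
  by apply: continuous_compact; [exact: continuous_subspaceT|exact: compact_box].
by exists K => x bx; apply: hK; exists x.
Qed.

Lemma integrable_box M h : 0 < M -> continuous h ->
  (@lebesgue2 R).-integrable (box M : set mplane) (EFin \o h).
Proof.
move=> M0 ch; apply: measurable_bounded_integrable.
- exact: measurable_box.
- by rewrite [ltLHS](lebesgue2_box M0) ltry.
- apply: (measurable_funS measurableT) => //.
  by have := @measurable_cont_plane setT h openT; apply=> x _; exact: ch.
- have [K hK] := bounded_box M ch.
  by exists K; split; [exact: num_real|move=> k Kk x bx; apply: le_trans (ltW Kk); exact: hK].
Qed.

Lemma is_derive_slice1 (psi : plane -> R) (x : plane) (l : R) :
  is_derive x (1, 0) psi l -> is_derive x.1 1 (fun s => psi (s, x.2)) l.
Proof.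
case=> dpsi <-.
have E : (fun s : R => s^-1 *: (psi (s *: ((1, 0) : plane) + x) - psi x)) =
    (fun s : R => s^-1 *: (psi (s *: (1 : R) + x.1, x.2) - psi (x.1, x.2))).
  apply: funext => s; rewrite -surjective_pairing; congr (_ *: (psi _ - _)).
  by rewrite [LHS]surjective_pairing; congr pair; rewrite /= scaler0 add0r.
by split; move: dpsi; rewrite /derivable /derive /= E.
Qed.

Lemma is_derive_slice2 (psi : plane -> R) (x : plane) (l : R) :
  is_derive x (0, 1) psi l -> is_derive x.2 1 (fun s => psi (x.1, s)) l.
Proof.
case=> dpsi <-.
have E : (fun s : R => s^-1 *: (psi (s *: ((0, 1) : plane) + x) - psi x)) =
    (fun s : R => s^-1 *: (psi (x.1, s *: (1 : R) + x.2) - psi (x.1, x.2))).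
  apply: funext => s; rewrite -surjective_pairing; congr (_ *: (psi _ - _)).
  by rewrite [LHS]surjective_pairing; congr pair; rewrite /= scaler0 add0r.
by split; move: dpsi; rewrite /derivable /derive /= E.
Qed.

Lemma integral_derive (h dh : R -> R) M : 0 < M -> continuous dh ->
  (forall t : R, is_derive t 1 h (dh t)) ->
  (\int[@lebesgue_measure R]_(t in `[(- M)%R, M]) (dh t)%:E)%E = (h M - h (- M))%:E.
Proof.
move=> M0 cdh dh'; rewrite (@continuous_FTC2 _ _ h) //; first lra.
- exact: continuous_subspaceT.
- have ch t : {for t, continuous h} by exact: is_derive_cont (dh' t).
  split; first by move=> t _; have [] := dh' t.
  + exact: cvg_at_right_filter (ch _).
  + exact: cvg_at_left_filter (ch _).
- by move=> t _; rewrite derive1E; have [_ ->] := dh' t.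
Qed.

Lemma cont_pair1 (y s : R) : {for s, continuous (fun s : R => (s, y) : plane)}.
Proof. by apply: (@cvg_pair _ _ _ (nbhs s) (nbhs s) (nbhs y)); [exact: cvg_id|exact: cvg_cst]. Qed.

Lemma cont_pair2 (y s : R) : {for s, continuous (fun s : R => (y, s) : plane)}.
Proof. by apply: (@cvg_pair _ _ _ (nbhs s) (nbhs y) (nbhs s)); [exact: cvg_cst|exact: cvg_id]. Qed.

(** Fubini's theorem for the integrand extended by 0 outside the square, and the fundamental theorem
    of calculus on each slice. *)
Lemma integral_box1 (psi dpsi : plane -> R) M : 0 < M -> continuous dpsi ->
  (forall x : plane, is_derive x (1, 0) psi (dpsi x)) ->
  (\int[@lebesgue2 R]_(x in box M) (dpsi x)%:E =
   \int[@lebesgue_measure R]_(y in `[(- M)%R, M]) (psi (M, y) - psi ((- M)%R, y))%R%:E)%E.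
Proof.
move=> M0 cd dd; rewrite integral_mkcond.
have := integrable_box M0 cd; rewrite integrable_mkcond; last exact: measurable_box.
move/integral21_prod_meas1 => <-; rewrite [RHS]integral_mkcond.
apply: eq_integral => y _; rewrite /fubini_G /patch.
case: ifPn => [yM|yM].
  have c : continuous (fun s : R => dpsi (s, y)).
    by move=> s; apply: (@continuous_comp _ _ _ (fun s : R => (s, y) : plane) dpsi); [exact: cont_pair1|exact: cd].
  have d (s : R) : is_derive s 1 (fun s : R => psi (s, y)) (dpsi (s, y)).
    exact: (@is_derive_slice1 psi (s, y)).
  apply: (eq_trans _ (integral_derive M0 c d)).
  rewrite [RHS]integral_mkcond; apply: eq_integral => x _; rewrite /patch /=.
  by rewrite /box in_setX /= yM andbT; case: ifP.
apply: integral0_eq => x _; rewrite /= /box in_setX /=.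
by rewrite (negbTE yM) andbF.
Qed.

Lemma integral_box2 (psi dpsi : plane -> R) M : 0 < M -> continuous dpsi ->
  (forall x : plane, is_derive x (0, 1) psi (dpsi x)) ->
  (\int[@lebesgue2 R]_(x in box M) (dpsi x)%:E =
   \int[@lebesgue_measure R]_(y in `[(- M)%R, M]) (psi (y, M) - psi (y, (- M)%R))%R%:E)%E.
Proof.
move=> M0 cd dd; rewrite integral_mkcond.
have := integrable_box M0 cd; rewrite integrable_mkcond; last exact: measurable_box.
move/integral12_prod_meas1 => <-; rewrite [RHS]integral_mkcond.
apply: eq_integral => y _; rewrite /fubini_F /patch.
case: ifPn => [yM|yM].
  have c : continuous (fun s : R => dpsi (y, s)).
    by move=> s; apply: (@continuous_comp _ _ _ (fun s : R => (y, s) : plane) dpsi); [exact: cont_pair2|exact: cd].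
  have d (s : R) : is_derive s 1 (fun s : R => psi (y, s)) (dpsi (y, s)).
    exact: (@is_derive_slice2 psi (y, s)).
  apply: (eq_trans _ (integral_derive M0 c d)).
  rewrite [RHS]integral_mkcond; apply: eq_integral => x _; rewrite /patch /=.
  by rewrite /box in_setX /= yM; case: ifP.
apply: integral0_eq => x _; rewrite /= /box in_setX /=.
by rewrite (negbTE yM).
Qed.

End PlaneMeasure.

(** * Green's formula and the flux *)

Section Distribution.
Variable R : realType.
Local Notation plane := (R * R)%type.
Local Notation mplane := (measurableTypeR R * measurableTypeR R)%type.
Local Notation mu2 := (@lebesgue2 R).
Implicit Types (x v w : plane) (e m M : R) (phi : plane -> R).

Lemma sqn_gt0 x : x != 0 -> 0 < sqn x.
Proof.
move=> x0; rewrite lt_neqAle sqn_ge0 andbT eq_sym; apply: contra x0.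
rewrite paddr_eq0 ?sqr_ge0// !sqrf_eq0 => /andP[/eqP h1 /eqP h2].
by rewrite [x]surjective_pairing h1 h2.
Qed.

Lemma lebesgue2_set1 x : mu2 [set x] = 0%E.
Proof.
rewrite (_ : [set x] = [set x.1] `*` [set x.2] :> set plane).
  rewrite /lebesgue2 product_measure1E; [|exact: measurable_set1|exact: measurable_set1].
  by rewrite [X in (X * _)%E]lebesgue_measure_set1 mul0e.
by rewrite eqEsubset; split=> [y ->//|[y1 y2] [/= -> ->]]; rewrite /= -surjective_pairing.
Qed.

Lemma measurable_set1_plane x : measurable ([set x] : set mplane).
Proof. by apply: measurable_compact_plane; exact: compact_set1. Qed.

Lemma derive_near0 (h : plane -> R) x v : (\forall y \near x, h y = 0) -> 'D_v h x = 0.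
Proof.
move=> h0; have d : is_derive x v h 0; last by have [_ ->] := d.
by apply: (near_eq_is_derive _ (is_derive_cstl 0 x v)); move: h0; apply: filterS => y ->.
Qed.

Section Test.
Variables (phi : plane -> R).
Hypothesis phi_smooth : forall n, Cn n setT phi.
Local Notation K := (closure [set x | phi x != 0]).

Lemma test_d1 x : is_derive x (1, 0) phi (d1 phi x).
Proof. by have [_ [/(_ x I)[d _] _ _]] := phi_smooth 1; exact: derivableP. Qed.

Lemma test_d2 x : is_derive x (0, 1) phi (d2 phi x).
Proof. by have [_ [/(_ x I)[_ d] _ _]] := phi_smooth 1; exact: derivableP. Qed.

Lemma test_d11 x : is_derive x (1, 0) (d1 phi) (d1 (d1 phi) x).
Proof. by have [_ [_ [_ [/(_ x I)[d _] _ _]] _]] := phi_smooth 2; exact: derivableP. Qed.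

Lemma test_d22 x : is_derive x (0, 1) (d2 phi) (d2 (d2 phi) x).
Proof. by have [_ [_ _ [_ [/(_ x I)[_ d] _ _]]]] := phi_smooth 2; exact: derivableP. Qed.

Lemma test_cont : continuous phi.
Proof. by move=> x; have [c _] := phi_smooth 0; exact: c. Qed.

Lemma test_cont11 : continuous (d1 (d1 phi)).
Proof. by move=> x; have [_ [_ [_ [_ [c _] _]] _]] := phi_smooth 2; exact: c. Qed.

Lemma test_cont22 : continuous (d2 (d2 phi)).
Proof. by move=> x; have [_ [_ _ [_ [_ _ [c _]]]]] := phi_smooth 2; exact: c. Qed.

Lemma test_cont_laplacian : continuous (laplacian phi).
Proof. by move=> x; apply (@cont_add R plane); [exact: test_cont11|exact: test_cont22]. Qed.

Lemma test_near0 x : ~ K x -> \forall y \near x, phi y = 0.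
Proof.
move=> Kx; have : nbhs x (~` K).
  by apply: open_nbhs_nbhs; split=> //; exact/closed_openC/closed_closure.
apply: filterS => y nK; apply/eqP/negPn/negP => p0; apply: nK.
exact: subset_closure.
Qed.

Lemma test0 x : ~ K x -> phi x = 0.
Proof. by move/test_near0/nbhs_singleton. Qed.

Lemma test_near1 x v : ~ K x -> \forall y \near x, 'D_v phi y = 0.
Proof.
move=> Kx; have : \forall z \near x, \forall y \near z, phi y = 0 by exact: near_join (test_near0 Kx).
by apply: filterS => y; exact: derive_near0.
Qed.

Lemma test_d10 x : ~ K x -> d1 phi x = 0.
Proof. by move=> Kx; apply: derive_near0; exact: test_near0. Qed.

Lemma test_d20 x : ~ K x -> d2 phi x = 0.
Proof. by move=> Kx; apply: derive_near0; exact: test_near0. Qed.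

Lemma test_laplacian0 x : ~ K x -> laplacian phi x = 0.
Proof.
move=> Kx; rewrite /laplacian /d1 /d2 derive_near0 ?derive_near0 ?addr0//.
  exact: test_near1.
exact: test_near1.
Qed.

End Test.

Section Regularized.
Variables (U V W : R -> R).
Hypothesis dU : forall t : R, is_derive t 1 U (V t).
Hypothesis dV : forall t : R, is_derive t 1 V (W t).
Hypothesis cW : continuous W.

(* The two parts of the negative laplacian of [regsol U e]. *)
Definition density_a e x : R := - (4 * W (regtau e x) * sqn x / (sqn x + e) ^+ 2).
Definition density_b e x : R := 4 * V (regtau e x) * e / (sqn x + e) ^+ 2.

Lemma regsol2_trace e x : 0 < e ->
  regsol2 V W e (1, 0) (1, 0) x + regsol2 V W e (0, 1) (0, 1) x =
  - (density_a e x + density_b e x).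
Proof.
move=> e0; have : sqn x + e != 0 by rewrite gt_eqF// ltr_wpDl// sqn_ge0.
rewrite /regsol2 /density_a /density_b /inner /= /sqn => xn; by field.
Qed.

Lemma regdomT e x : 0 < e -> regdom e x.
Proof. by move=> e0; rewrite /regdom /= ltr_wpDl// sqn_ge0. Qed.

Lemma cont_density_b e : 0 < e -> continuous (density_b e).
Proof.
move=> e0 x; have x0 := regdomT x e0; apply (@cont_mul R plane).
  apply (@cont_mul R plane); last exact: cont_cst.
  apply (@cont_mul R plane); first exact: cont_cst.
  by apply (@cont_comp R plane); [exact: cont_regtau|exact: is_derive_cont (dV _)].
apply (@cont_inv R plane); first by rewrite expf_neq0// gt_eqF.
apply (@cont_comp R plane (fun t => t ^+ 2)); first exact: cont_shift.
exact: exprn_continuous.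
Qed.

Lemma cont_density_a e : 0 < e -> continuous (density_a e).
Proof.
move=> e0 x; have x0 := regdomT x e0; apply (@cont_opp R plane).
apply (@cont_mul R plane).
  apply (@cont_mul R plane); last exact: cont_sqn.
  apply (@cont_mul R plane); first exact: cont_cst.
  by apply (@cont_comp R plane); [exact: cont_regtau|exact: cW].
apply (@cont_inv R plane); first by rewrite expf_neq0// gt_eqF.
apply (@cont_comp R plane (fun t => t ^+ 2)); first exact: cont_shift.
exact: exprn_continuous.
Qed.

(** The integrand is the divergence of u grad phi - phi grad u for u = [regsol U e], and both phi
    and its gradient vanish on the sides of the square. *)
Lemma green_box e M phi : 0 < e -> 0 < M -> (forall n, Cn n setT phi) ->
  (forall x, closure [set x | phi x != 0] x -> `|x.1| < M /\ `|x.2| < M) ->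
  (\int[mu2]_(x in box M)
     (regsol U e x * laplacian phi x + (density_a e x + density_b e x) * phi x)%R%:E = 0)%E.
Proof.
move=> e0 M0 sphi hK.
have rd x : regdom e x := regdomT x e0.
have cu : continuous (regsol U e) by move=> x; exact: cont_regsol.
have c2 v : continuous (regsol2 V W e v v) by move=> x; exact: cont_regsol2.
pose p1 x := regsol U e x * d1 (d1 phi) x - phi x * regsol2 V W e (1, 0) (1, 0) x.
pose p2 x := regsol U e x * d2 (d2 phi) x - phi x * regsol2 V W e (0, 1) (0, 1) x.
have cp1 : continuous p1.
  move=> x; apply (@cont_sub R plane); apply (@cont_mul R plane).
  + exact: cu. + exact: test_cont11. + exact: test_cont. + exact: c2.
have cp2 : continuous p2.
  move=> x; apply (@cont_sub R plane); apply (@cont_mul R plane).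
  + exact: cu. + exact: test_cont22. + exact: test_cont. + exact: c2.
transitivity (\int[mu2]_(x in box M) ((p1 x)%:E + (p2 x)%:E))%E.
  apply: eq_integral => x _; rewrite -EFinD; congr (_%:E).
  rewrite -[density_a e x + _]opprK -(regsol2_trace x e0) /p1 /p2 /laplacian; ring.
rewrite integralD; [|exact: measurable_box|exact: integrable_box|exact: integrable_box].
have nK1 (s y : R) : `|s| = M -> ~ closure [set x | phi x != 0] ((s, y) : plane).
  by move=> sM /hK[]/=; rewrite sM ltxx.
have nK2 (s y : R) : `|s| = M -> ~ closure [set x | phi x != 0] ((y, s) : plane).
  by move=> sM /hK[_]/=; rewrite sM ltxx.
have nM : `|M| = M by rewrite gtr0_norm.
have nM' : `|- M| = M by rewrite normrN gtr0_norm.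
have dp1 x : is_derive x (1, 0) (fun x => regsol U e x * d1 phi x - phi x * regsol1 V e (1, 0) x) (p1 x).
  have := is_derive_Bl (is_derive_Ml (is_derive_regsol dU (1, 0) (rd x)) (test_d11 sphi x))
    (is_derive_Ml (test_d1 sphi x) (is_derive_regsol1 dV (1, 0) (1, 0) (rd x))).
  by move/is_derive_eq; apply; rewrite /p1; ring.
have dp2 x : is_derive x (0, 1) (fun x => regsol U e x * d2 phi x - phi x * regsol1 V e (0, 1) x) (p2 x).
  have := is_derive_Bl (is_derive_Ml (is_derive_regsol dU (0, 1) (rd x)) (test_d22 sphi x))
    (is_derive_Ml (test_d2 sphi x) (is_derive_regsol1 dV (0, 1) (0, 1) (rd x))).
  by move/is_derive_eq; apply; rewrite /p2; ring.
rewrite (integral_box1 M0 cp1 dp1) (integral_box2 M0 cp2 dp2).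
rewrite [X in (X + _)%E]integral0_eq; last first.
  by move=> y _; rewrite !(test_d10 (nK1 _ y nM)) !(test_d10 (nK1 _ y nM')) !(test0 (nK1 _ y nM)) !(test0 (nK1 _ y nM')); congr (_%:E); ring.
rewrite integral0_eq ?adde0// => y _.
by rewrite !(test_d20 (nK2 _ y nM)) !(test_d20 (nK2 _ y nM')) !(test0 (nK2 _ y nM)) !(test0 (nK2 _ y nM')); congr (_%:E); ring.
Qed.

Lemma regtau_ge e x (l : R) : 0 < e -> sqn x + e <= l -> - ln l <= regtau e x.
Proof.
move=> e0 h; have x0 : 0 < sqn x + e by rewrite ltr_wpDl// sqn_ge0.
by rewrite lerN2 ler_ln ?posrE// (lt_le_trans x0).
Qed.

Lemma sqn_box x m : box m x -> sqn x <= 2 * m ^+ 2.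
Proof.
have sq (a : R) : - m <= a <= m -> a ^+ 2 <= m ^+ 2.
  by rewrite -ler_norml -(real_normK (num_real a)) => am; rewrite lerXn2r ?nnegrE// (le_trans _ am).
by case; rewrite /= !in_itv/= => /sq h1 /sq h2; rewrite /sqn; lra.
Qed.

(** On a side, m^2 <= |x|^2 <= 2 m^2, and e <= m^2. Hence |x|^2 + e <= 3 m^2, where V is controlled,
    while 2 m / (|x|^2 + e) <= 2 / m. *)
Lemma flux_side e m c x w (sx : R) : 0 < m -> 0 < e <= m ^+ 2 ->
  (forall y, - ln (3 * m ^+ 2) <= y -> 0 <= V y <= c) ->
  box m x -> m ^+ 2 <= sqn x -> inner w x = sx * m -> sx ^+ 2 = 1 ->
  0 <= - (sx * regsol1 V e w x) <= 2 * c / m.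
Proof.
move=> m0 /andP[e0 em] hV bx mx wx s1; have := sqn_box bx => xm.
have x0 : 0 < sqn x + e by rewrite ltr_wpDl// sqn_ge0.
have /hV /andP[V0 Vc] : - ln (3 * m ^+ 2) <= regtau e x by apply: regtau_ge => //; lra.
have -> : - (sx * regsol1 V e w x) = sx ^+ 2 * (V (regtau e x) * (2 * m / (sqn x + e))).
  by rewrite /regsol1 wx; field; rewrite gt_eqF.
rewrite s1 mul1r; have q0 : 0 <= 2 * m / (sqn x + e) by rewrite divr_ge0 ?ltW ?mulr_gt0.
apply/andP; split; first by rewrite mulr_ge0.
have -> : 2 * c / m = c * (2 * m / m ^+ 2) by field; rewrite gt_eqF.
apply: ler_pM => //; rewrite ler_pM2l ?mulr_gt0// lef_pV2 ?posrE ?exprn_gt0//; lra.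
Qed.

(** The density is minus a divergence. Its integral is the flux through four sides of length 2 m,
    each with density at most 2 c / m, and 4 * 2 m * 2 c / m = 16 c, whatever m and e are. *)
Lemma flux_bound e m c : 0 < m -> 0 < e <= m ^+ 2 ->
  (forall y, - ln (3 * m ^+ 2) <= y -> 0 <= V y <= c) ->
  (\int[mu2]_(x in box m) (density_a e x + density_b e x)%R%:E <= (16 * c)%R%:E)%E.
Proof.
move=> m0 em hV; have /andP[e0 _] := em.
have rd x : regdom e x := regdomT x e0.
have c1 v : continuous (regsol1 V e v) by move=> x; exact: cont_regsol1.
have c2 v : continuous (fun x => - regsol2 V W e v v x).
  by move=> x; apply (@cont_opp R plane); exact: cont_regsol2.
have d2' v x : is_derive x v (fun x => - regsol1 V e v x) (- regsol2 V W e v v x).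
  exact: is_derive_Nl (is_derive_regsol1 dV v v (rd x)).
have -> : (\int[mu2]_(x in box m) (density_a e x + density_b e x)%R%:E)%E =
  (\int[mu2]_(x in box m) ((- regsol2 V W e (1, 0) (1, 0) x)%R%:E + (- regsol2 V W e (0, 1) (0, 1) x)%R%:E))%E.
  apply: eq_integral => x _; rewrite -EFinD; congr (_%:E).
  by rewrite -opprD regsol2_trace// opprK.
rewrite integralD; [|exact: measurable_box|exact: integrable_box|exact: integrable_box].
rewrite (integral_box1 m0 (c2 _) (d2' _)) (integral_box2 m0 (c2 _) (d2' _)).
have side (h : R -> R) : continuous h -> (forall y, `|y| <= m -> 0 <= h y <= 4 * c / m) ->
  (\int[@lebesgue_measure R]_(y in `[(- m)%R, m]) (h y)%:E <= (8 * c)%R%:E)%E.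
  move=> ch hh; apply: (@le_trans _ _ (\int[@lebesgue_measure R]_(y in `[(- m)%R, m]) (4 * c / m)%R%:E)%E).
    apply: ge0_le_integral => //.
    - by move=> y; rewrite /= in_itv/= -ler_norml lee_fin => /hh/andP[].
    - by apply/measurable_EFinP; apply: measurable_funS (continuous_measurable_fun ch).
    - by move=> y; rewrite /= in_itv/= -ler_norml lee_fin => /hh/andP[].
  have itvm : lebesgue_measure (`[- m, m]%classic : set R) = (2 * m)%:E.
    rewrite lebesgue_measure_itv/= lte_fin ifT; last by move: m0; lra.
    by rewrite -EFinD; congr (_%:E); lra.
  rewrite integral_cst// [X in (_ * X)%E]itvm -EFinM lee_fin le_eqVlt.
  by apply/orP; left; apply/eqP; field; rewrite gt_eqF.
have mm y : `|y| <= m -> `[- m, m]%classic y by rewrite /= in_itv/= -ler_norml.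
have am : `|m| <= m by rewrite gtr0_norm.
have am' : `|- m| <= m by rewrite normrN gtr0_norm.
have e16 : (16 * c)%:E = ((8 * c)%R%:E + (8 * c)%R%:E)%E by rewrite -EFinD; congr (_%:E); lra.
rewrite e16; apply: leeD; apply: side.
- move=> y; apply (@cont_sub R R); apply (@cont_opp R R).
    by apply: (@continuous_comp _ _ _ (fun s : R => (m, s) : plane)); [exact: cont_pair2|exact: c1].
  by apply: (@continuous_comp _ _ _ (fun s : R => (- m, s) : plane)); [exact: cont_pair2|exact: c1].
- move=> y ym.
  have := @flux_side e m c (m, y) (1, 0) 1 m0 em hV; rewrite mul1r => /(_ _ _ _ _)/andP h1.
  have := @flux_side e m c (- m, y) (1, 0) (- 1) m0 em hV; rewrite mulN1r opprK => /(_ _ _ _ _)/andP h2.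
  have [||||h11 h12] := h1; [by split; exact: mm|by rewrite /sqn/= lerDl sqr_ge0|by rewrite /inner/=; ring|by rewrite expr1n|].
  have [||||h21 h22] := h2; [by split; exact: mm|by rewrite /sqn/= sqrrN lerDl sqr_ge0|by rewrite /inner/=; ring|by rewrite sqrrN expr1n|].
  by apply/andP; split; lra.
- move=> y; apply (@cont_sub R R); apply (@cont_opp R R).
    by apply: (@continuous_comp _ _ _ (fun s : R => (s, m) : plane)); [exact: cont_pair1|exact: c1].
  by apply: (@continuous_comp _ _ _ (fun s : R => (s, - m) : plane)); [exact: cont_pair1|exact: c1].
- move=> y ym.
  have := @flux_side e m c (y, m) (0, 1) 1 m0 em hV; rewrite mul1r => /(_ _ _ _ _)/andP h1.
  have := @flux_side e m c (y, - m) (0, 1) (- 1) m0 em hV; rewrite mulN1r opprK => /(_ _ _ _ _)/andP h2.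
  have [||||h11 h12] := h1; [by split; exact: mm|by rewrite /sqn/= lerDr sqr_ge0|by rewrite /inner/=; ring|by rewrite expr1n|].
  have [||||h21 h22] := h2; [by split; exact: mm|by rewrite /sqn/= sqrrN lerDr sqr_ge0|by rewrite /inner/=; ring|by rewrite sqrrN expr1n|].
  by apply/andP; split; lra.
Qed.

End Regularized.

End Distribution.

(** * The distributional equation *)

Section WeakSolution.
Variable R : realType.
Local Notation plane := (R * R)%type.
Local Notation mplane := (measurableTypeR R * measurableTypeR R)%type.
Local Notation mu2 := (@lebesgue2 R).
Implicit Types (x v w : plane) (e m M : R) (phi : plane -> R).

Variables (f U V W : R -> R) (r0 : R).
Hypothesis dU : forall t : R, is_derive t 1 U (V t).
Hypothesis dV : forall t : R, is_derive t 1 V (W t).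
Hypothesis cW : continuous W.
Hypothesis UV_gt0 : forall y : R, r0 < y ->
  [/\ 0 < U y, 0 < V y & W y = - (expR (- y) * f (U y) / 4)].
Hypothesis V_cvg0 : forall e : R, 0 < e -> exists n : R, forall y : R, n <= y -> V y <= e.
Hypothesis f_gt0 : forall s : R, 0 < s -> 0 < f s.
Hypothesis f_tail : forall s : R, 0 < s -> (tailint f s < +oo)%E.
Hypothesis f_cont : forall s : R, 0 < s -> {for s, continuous f}.
Hypothesis f_incr : forall s t : R, 0 < s -> s <= t -> f s <= f t.

Local Notation r := (expR (- (r0 / 2))).
Local Notation P := (punctured_disk r).
Local Notation u := (regsol U 0).

Lemma U_le (a b : R) : r0 < a -> a <= b -> U a <= U b.
Proof.
move=> ra ab; apply: (is_derive_ge0_le ab (fun t _ => dU t)) => t /andP[ta _].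
by have [|_ /ltW] := @UV_gt0 t; first exact: lt_trans ta.
Qed.

Lemma sqn_enorm_lt x (s : R) : 0 <= s -> (enorm x < s) = (sqn x < s ^+ 2).
Proof. by move=> s0; rewrite -enorm_sqr ltr_sqr ?nnegrE ?sqrtr_ge0. Qed.

Lemma expR_half_sqr : r ^+ 2 = expR (- r0).
Proof. by rewrite -expRM_natl; congr expR; field. Qed.

Lemma enorm_gt0 x : (0 < enorm x) = (0 < sqn x).
Proof. by rewrite sqrtr_gt0. Qed.

Lemma regtau_gt e x (y : R) : 0 < sqn x + e -> (y < regtau e x) = (sqn x + e < expR (- y)).
Proof. by move=> x0; rewrite /regtau ltrNr -[in LHS](expRK (- y)) ltr_ln ?posrE ?expR_gt0. Qed.

Lemma punctured_disk_regtau x : P x <-> 0 < sqn x /\ r0 < regtau 0 x.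
Proof.
rewrite /punctured_disk/= enorm_gt0 sqn_enorm_lt ?expR_ge0// expR_half_sqr.
split=> [/andP[x0 xr]|[x0]]; first by split=> //; rewrite regtau_gt addr0.
by rewrite regtau_gt addr0// x0.
Qed.

Lemma open_punctured_disk (s : R) : open (punctured_disk s : set plane).
Proof.
have cE : continuous (@enorm R).
  move=> x; apply (@cont_comp R plane (fun t => Num.sqrt t)); first exact: cont_sqn.
  exact: sqrt_continuous.
rewrite (_ : punctured_disk s = @enorm R @^-1` `]0, s[%classic); last first.
  by apply/seteqP; split=> x; rewrite /punctured_disk /= in_itv.
by apply: open_comp => [x _|]; [exact: cE|exact: interval_open].
Qed.

Lemma cont_usol x : P x -> {for x, continuous u}.
Proof.
by move=> /punctured_disk_regtau[x0 _]; apply: cont_regsol => //; rewrite /regdom/= addr0.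
Qed.

Lemma usol_gt0 x : P x -> 0 < u x.
Proof. by move=> /punctured_disk_regtau[_ /UV_gt0[]]. Qed.

Lemma cont_fusol x : P x -> {for x, continuous (f \o u)}.
Proof.
move=> Px; apply: continuous_comp; first exact: cont_usol.
by apply: f_cont; exact: usol_gt0.
Qed.

Lemma expR_regtau e x : 0 < sqn x + e -> expR (- regtau e x) = sqn x + e.
Proof. by move=> x0; rewrite /regtau opprK lnK. Qed.

Lemma regtau_le0 e x : 0 <= e -> 0 < sqn x -> regtau e x <= regtau 0 x.
Proof. by move=> e0 x0; rewrite /regtau addr0 lerN2 ler_ln ?posrE; lra. Qed.

Lemma density_aE e x : 0 < sqn x + e -> r0 < regtau e x ->
  density_a W e x = f (U (regtau e x)) * (sqn x / (sqn x + e)).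
Proof.
move=> x0 /UV_gt0[_ _ Wx]; rewrite /density_a Wx expR_regtau//.
by field; rewrite gt_eqF.
Qed.

(** Regularising lowers the argument of U, and U and f are increasing: u and f(u) thus dominate
    uniformly in e, as Fatou's lemma and dominated convergence require. *)
Lemma density_bounds e x : 0 <= e -> 0 < sqn x -> r0 < regtau e x ->
  [/\ 0 < regsol U e x <= u x, 0 <= density_a W e x <= f (u x) & 0 <= density_b V e x].
Proof.
move=> e0 x0 rx; have xe : 0 < sqn x + e by lra.
have [U0 V0 _] := UV_gt0 rx; have ule := U_le rx (regtau_le0 e0 x0).
split; first by rewrite U0.
  rewrite density_aE//; have q1 : sqn x / (sqn x + e) <= 1 by rewrite ler_pdivrMr// mul1r lerDl.
  have q0 : 0 <= sqn x / (sqn x + e) by rewrite divr_ge0 ?ltW.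
  have fU := ltW (f_gt0 U0); rewrite mulr_ge0//=.
  by apply: (@le_trans _ _ (f (U (regtau e x)))); [rewrite ler_piMr|exact: f_incr].
apply: divr_ge0; last exact: sqr_ge0.
by apply: mulr_ge0 => //; apply: mulr_ge0 => //; exact: ltW.
Qed.

Lemma density_a0 x : P x -> density_a W 0 x = f (u x).
Proof.
move=> /punctured_disk_regtau[x0 rx]; by rewrite density_aE ?addr0// divff ?mulr1// gt_eqF.
Qed.

Lemma cont_regtau_eps x : 0 < sqn x -> {for (0 : R), continuous (fun e => regtau e x)}.
Proof.
move=> x0; apply (@cont_opp R R); apply (@cont_comp R R).
  by apply (@cont_add R R); [exact: cont_cst|exact: cvg_id].
by rewrite addr0; exact: continuous_ln.
Qed.

Lemma cont_regsol_eps x : 0 < sqn x -> {for (0 : R), continuous (fun e => regsol U e x)}.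
Proof.
move=> x0; apply (@cont_comp R R (fun t => U t)); first exact: cont_regtau_eps.
exact: is_derive_cont (dU _).
Qed.

Lemma cont_density_a_eps x : 0 < sqn x -> {for (0 : R), continuous (fun e => density_a W e x)}.
Proof.
move=> x0; apply (@cont_opp R R); apply (@cont_mul R R).
  apply (@cont_mul R R); last exact: cont_cst.
  apply (@cont_mul R R); first exact: cont_cst.
  by apply (@cont_comp R R (fun t => W t)); [exact: cont_regtau_eps|exact: cW].
apply (@cont_inv R R); first by rewrite addr0 expf_neq0// gt_eqF.
apply (@cont_comp R R (fun t => t ^+ 2)); last exact: exprn_continuous.
by apply (@cont_add R R); [exact: cont_cst|exact: cvg_id].
Qed.

Lemma small_box (c : R) : 0 < c -> exists m, [/\ 0 < m, m < 1 &
  forall y : R, - ln (3 * m ^+ 2) <= y -> r0 < y /\ 0 <= V y <= c].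
Proof.
move=> c0; have [n hn] := V_cvg0 c0.
(* m solves 3 m^2 = exp(-y1); the entry 0 in the maximum makes m < 1. *)
pose y1 := Num.max (Num.max n (r0 + 1)) 0; pose m := Num.sqrt (expR (- y1) / 3).
have m2 : 3 * m ^+ 2 = expR (- y1).
  by rewrite sqr_sqrtr ?divr_ge0 ?expR_ge0//; field.
have m0 : 0 < m by rewrite sqrtr_gt0 divr_gt0 ?expR_gt0.
exists m; split=> //.
  have e1 : expR (- y1) <= 1.
    by rewrite -[leRHS]expR0 ler_expR oppr_le0 le_max lexx orbT.
  rewrite ltNge; apply/negP => m1.
  have : 1 <= m ^+ 2 by exact: exprn_ege1.
  by move=> h; lra.
move=> y; rewrite m2 expRK opprK => yy.
have ny : n <= y by apply: le_trans yy; rewrite !le_max lexx.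
have ry : r0 + 1 <= y by apply: le_trans yy; rewrite !le_max lexx orbT.
have r0y : r0 < y by lra.
by split=> //; have [_ /ltW -> _] := UV_gt0 r0y; rewrite hn.
Qed.

Lemma disk_box (s : R) : disk s `<=` box s.
Proof.
move=> x xs.
have s0 : 0 <= s by apply: le_trans (ltW xs); exact: sqrtr_ge0.
have h := xs; rewrite /disk/= sqn_enorm_lt// /sqn in h.
have side (a b : R) : a ^+ 2 + b ^+ 2 < s ^+ 2 -> `|a| <= s.
  move=> ab; rewrite -ler_sqr ?nnegrE// real_normK ?num_real//.
  by have := sqr_ge0 b; lra.
split; rewrite /= in_itv/= -ler_norml; first exact: side h.
by apply: side; rewrite addrC; exact: h.
Qed.

Lemma notbox_sqn m x : 0 <= m -> ~ box m x -> m ^+ 2 <= sqn x.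
Proof.
move=> m0 nb; rewrite leNgt; apply/negP => xm; apply: nb.
by apply: disk_box; rewrite /disk/= sqn_enorm_lt.
Qed.

Lemma punctured_disk_subset (s : R) : punctured_disk s `<=` disk s.
Proof. by move=> x /andP[]. Qed.

Lemma measurable_P : measurable (P : set mplane).
Proof. by apply: measurable_open_plane; exact: open_punctured_disk. Qed.

Lemma measurable_usol : measurable_fun (P : set mplane) (u : mplane -> measurableTypeR R).
Proof. by apply: measurable_cont_plane; [exact: open_punctured_disk|exact: cont_usol]. Qed.

Lemma measurable_fusol : measurable_fun (P : set mplane) (f \o u : mplane -> measurableTypeR R).
Proof. by apply: measurable_cont_plane; [exact: open_punctured_disk|exact: cont_fusol]. Qed.

(** The convergence theorems for integrals are about sequences; this one tends to 0 inside ]0,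
    a]. *)
Definition epsn (a : R) (n : nat) : R := a * harmonic n.

Lemma epsn_bounds (a : R) n : 0 < a -> 0 < epsn a n <= a.
Proof.
move=> a0; have h0 : 0 < (harmonic n : R) by rewrite invr_gt0.
rewrite /epsn mulr_gt0//=; apply: ler_piMr; first exact: ltW.
by rewrite /harmonic/= invf_le1// ler1n.
Qed.

Lemma epsn_cvg (a : R) : epsn a n @[n --> \oo] --> 0.
Proof. by rewrite -(mulr0 a); apply: cvgM; [exact: cvg_cst|exact: cvg_harmonic]. Qed.

Lemma cvg_epsn (h : R -> R) (a : R) : {for 0, continuous h} -> h (epsn a n) @[n --> \oo] --> h 0.
Proof. by move=> ch; apply: cvg_comp (epsn_cvg a) ch. Qed.

Lemma limn_einf_le (w : (\bar R)^nat) (c : \bar R) : (forall n, w n <= c)%E -> (limn_einf w <= c)%E.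
Proof.
move=> wc; rewrite limn_einf_lim; apply: lime_le; first exact: is_cvg_einfs.
apply: nearW => n; apply: le_trans (wc n); apply: ereal_inf_lbound.
by exists n => //=.
Qed.

Local Notation pbox m := (box m `\ (0 : plane)).

Lemma measurable_pbox m : measurable (pbox m : set mplane).
Proof. by apply: measurableD; [exact: measurable_box|exact: measurable_set1_plane]. Qed.

Lemma pbox_sqn m x : pbox m x -> 0 < sqn x.
Proof. by case=> _ x0; apply: sqn_gt0; apply/eqP. Qed.

Lemma pbox_regtau m e x : 0 <= e <= m ^+ 2 -> pbox m x -> - ln (3 * m ^+ 2) <= regtau e x.
Proof.
move=> /andP[e0 em] bx; have x0 := pbox_sqn bx; have [/sqn_box xm _] := bx.
by rewrite /regtau lerN2 ler_ln ?posrE; lra.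
Qed.

Lemma measurable_cont_set (D : set mplane) (h : plane -> R) : measurable D -> continuous h ->
  measurable_fun D (fun x => (h x)%:E : \bar R).
Proof.
move=> mD ch; apply/measurable_EFinP; apply: (measurable_funS measurableT) => //.
by have := @measurable_cont_plane R setT h openT; apply=> x _; exact: ch.
Qed.

Lemma pbox_punctured_disk m : (forall y : R, - ln (3 * m ^+ 2) <= y -> r0 < y) ->
  pbox m `<=` P.
Proof.
move=> hm x bx; apply/punctured_disk_regtau; split; first exact: pbox_sqn bx.
by apply: hm; apply: pbox_regtau bx; rewrite lexx sqr_ge0.
Qed.

(* Fatou's lemma along eps -> 0, the flux bounding the regularised integrals. *)
Lemma integral_near_origin m (c : R) : 0 < m ->
  (forall y : R, - ln (3 * m ^+ 2) <= y -> r0 < y /\ 0 <= V y <= c) ->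
  (\int[mu2]_(x in pbox m) (f (u x))%:E <= (16 * c)%R%:E)%E.
Proof.
move=> m0 hm; have m20 : 0 < m ^+ 2 by rewrite exprn_gt0.
have hr y : - ln (3 * m ^+ 2) <= y -> r0 < y by case/hm.
pose en := epsn (m ^+ 2); have en0 n : 0 < en n <= m ^+ 2 by exact: epsn_bounds.
have bnd n x : pbox m x -> [/\ 0 < regsol U (en n) x <= u x,
    0 <= density_a W (en n) x <= f (u x) & 0 <= density_b V (en n) x].
  move=> bx; have /andP[e0 em] := en0 n; apply: density_bounds; first exact: ltW.
    exact: pbox_sqn bx.
  by apply: hr; apply: pbox_regtau bx; rewrite ltW.
have -> : (\int[mu2]_(x in pbox m) (f (u x))%:E =
    \int[mu2]_(x in pbox m) limn_einf (fun n => (density_a W (en n) x)%:E))%E.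
  apply: eq_integral => x /set_mem bx; apply: esym; apply: (cvg_limn_einf_sup _).1.
  apply: cvg_EFin; first by apply: nearW.
  rewrite -density_a0; last exact: pbox_punctured_disk bx.
  by apply: (@cvg_epsn (fun e => density_a W e x)); apply: cont_density_a_eps; exact: pbox_sqn bx.
have fm n : measurable_fun (pbox m : set mplane) (fun x => (density_a W (en n) x)%:E : \bar R).
  have /andP[e0 _] := en0 n; apply: measurable_cont_set; first exact: measurable_pbox.
  exact: cont_density_a.
have f0 n x : (pbox m : set mplane) x -> (0 <= (density_a W (en n) x)%:E)%E.
  by move=> /(bnd n)[_ /andP[h _] _]; rewrite lee_fin.
apply: (@le_trans _ _ (limn_einf (fun n => \int[mu2]_(x in pbox m) (density_a W (en n) x)%:E))%E).
  exact: (fatou mu2 (measurable_pbox m) fm f0).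
apply: limn_einf_le => n; have /andP[e0 em] := en0 n.
have ca := cont_density_a cW e0; have cb := cont_density_b dV e0.
have cab : continuous (fun x => density_a W (en n) x + density_b V (en n) x).
  by move=> x; apply (@cont_add R plane); [exact: ca|exact: cb].
apply: (@le_trans _ _ (\int[mu2]_(x in box m) (density_a W (en n) x + density_b V (en n) x)%R%:E)%E); last first.
  by apply: flux_bound => // y /hm[].
(* The flux concerns the full square, the pointwise bounds the square without its centre; the centre
   is a null set. *)
rewrite [leRHS](@negligible_integral _ _ _ _ _ [set (0 : mplane)]).
- apply: ge0_le_integral.
  + exact: measurable_pbox.
  + by move=> x /(bnd n)[_ /andP[h _] _]; rewrite lee_fin.
  + by apply: measurable_cont_set => //; exact: measurable_pbox.
  + by apply: measurable_cont_set => //; exact: measurable_pbox.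
  + by move=> x /(bnd n)[_ _ h]; rewrite lee_fin lerDl.
- exact: measurable_set1_plane.
- exact: measurable_box.
- exact: integrable_box.
- exact: lebesgue2_set1.
Qed.

Lemma lebesgue2_P_lty (A : set mplane) : measurable A -> A `<=` P -> (mu2 A < +oo)%E.
Proof.
move=> mA AP; apply: (@le_lt_trans _ _ (mu2 (box r))).
  apply: le_measure; rewrite ?inE//; first exact: measurable_box.
  by move=> x /AP /punctured_disk_subset; exact: disk_box.
by rewrite lebesgue2_box ?expR_gt0// ltry.
Qed.

Lemma integrable_fusol : mu2.-integrable (P : set mplane) (EFin \o (f \o u)).
Proof.
have [m [m0 m1 hm]] := small_box ltr01.
have m20 : 0 < m ^+ 2 by rewrite exprn_gt0.
have bP : pbox m `<=` P by apply: pbox_punctured_disk => y /hm[].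
have mf : measurable_fun (P : set mplane) (EFin \o (f \o u) : mplane -> \bar R).
  by apply/measurable_EFinP; exact: measurable_fusol.
have fu0 x : P x -> (0 <= (f (u x))%:E :> \bar R)%E.
  by move=> /usol_gt0/f_gt0/ltW; rewrite lee_fin.
pose A : set mplane := P `\` box m.
have mA : measurable A by apply: measurableD; [exact: measurable_P|exact: measurable_box].
have AP : A `<=` P by move=> x [].
have PE : P = pbox m `|` A :> set mplane.
  rewrite eqEsubset; split=> x; last by case=> [/bP|[]].
  move=> Px; have [bx|nbx] := pselect (box m x); [left; split=> //|by right].
  move=> x0; have [] := (punctured_disk_regtau x).1 Px.
  by rewrite x0 /sqn/= expr0n/= addr0 ltxx.
apply/integrableP; split; first exact: mf.
apply: (@le_lt_trans _ _ (\int[mu2]_(x in P) (f (u x))%:E)%E).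
  by apply: ge0_le_integral; [exact: measurable_P|by []|exact: measurableT_comp|exact: mf|
    move=> x /fu0 fx; rewrite gee0_abs].
rewrite PE ge0_integral_setU; [|exact: measurable_pbox|exact: mA|by rewrite -PE|by move=> x; rewrite -PE; exact: fu0|]; last first.
  by apply/disj_setPS => x [[bx _] []].
apply: lte_add_pinfty.
  apply: (@le_lt_trans _ _ (16 * 1)%R%:E); last by rewrite ltry.
  exact: integral_near_origin.
(* Outside the small square |x|^2 >= m^2, so log(1/|x|^2) <= y1 and f(u) <= f(U(y1)) by
   monotonicity. *)
pose y1 := Num.max (- ln (m ^+ 2)) (r0 + 1).
have y1r : r0 < y1 by rewrite lt_max ltrDl ltr01 orbT.
apply: (@le_lt_trans _ _ (\int[mu2]_(x in A) (f (U y1))%:E)%E).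
  apply: ge0_le_integral => //.
  - by move=> x /AP; exact: fu0.
  - by apply: (measurable_funS measurable_P AP).
  - move=> x [Px nb]; rewrite lee_fin; apply: f_incr; first exact: usol_gt0.
    apply: U_le; first by case/punctured_disk_regtau : Px.
    have mx := notbox_sqn (ltW m0) nb; have x0 : 0 < sqn x by lra.
    by rewrite le_max /regtau addr0 lerN2 ler_ln ?posrE// mx.
rewrite integral_cst//; have [U1 _ _] := UV_gt0 y1r.
by apply: lte_mul_pinfty; rewrite ?lee_fin ?ltW ?f_gt0// lebesgue2_P_lty.
Qed.

(** As f is increasing, F(s / 2) >= (s / 2) / f(s), and F(s / 2) <= F(1) for s > 2. Convergence of
    the tail integral thus makes f grow at least linearly, and integrability of u follows from that
    of f(u). *)
Lemma usol_le x : P x -> u x <= 2 + 2 * Fint f 1 * f (u x).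
Proof.
move=> /usol_gt0; set s := u x => s0.
have F0 t : 0 < t -> 0 < Fint f t by exact: Fint_gt0.
have F1 := F0 1 ltr01; have fs := f_gt0 s0.
have [s2|s2] := leP s 2.
  by apply: (le_trans s2); rewrite lerDl ltW// !mulr_gt0.
have h0 : s / 2 <= s by lra.
have d t : s / 2 <= t <= s -> is_derive t 1 (fun t : R => - Fint f t - t * (f s)^-1) ((f t)^-1 - (f s)^-1).
  move=> /andP[ht _]; have t0 : 0 < t by lra.
  have := is_derive_Bl (is_derive_Nl (is_derive_Fint f_gt0 f_tail f_cont t0))
    (is_derive_Ml (is_derive_idl t) (is_derive_cstl (f s)^-1 t (1 : R))).
  by move/is_derive_eq; apply; ring.
have hd (t : R) : s / 2 < t < s -> 0 <= (f t)^-1 - (f s)^-1.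
  move=> /andP[h1 h2]; have t0 : 0 < t by lra.
  by rewrite subr_ge0 lef_pV2 ?posrE ?f_gt0//; apply: f_incr => //; exact: ltW.
have key := is_derive_ge0_le h0 d hd.
have Fs := F0 _ s0.
have F2 : Fint f (s / 2) <= Fint f 1 by apply/ltW/Fint_decr => //; lra.
have : s / 2 * (f s)^-1 <= Fint f 1 by move: key; lra.
rewrite ler_pdivrMr// => h; rewrite -mulrA; lra.
Qed.

Lemma integrable_usol : mu2.-integrable (P : set mplane) (EFin \o u).
Proof.
have i2 : mu2.-integrable (P : set mplane) (EFin \o (fun=> 2)).
  apply: measurable_bounded_integrable => //; first exact: measurable_P.
    by apply: lebesgue2_P_lty => //; exact: measurable_P.
  by exists 2; split; [exact: num_real|move=> k /ltW k2 x _; rewrite /= ger0_norm].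
have if_ := integrableZl measurable_P (2 * Fint f 1) integrable_fusol.
apply: (le_integrable measurable_P _ _ (integrableD measurable_P i2 if_)).
  by apply/measurable_EFinP; exact: measurable_usol.
move=> x Px; have ux := ltW (usol_gt0 Px); have h := usol_le Px.
by rewrite /= lee_fin !ger0_norm//; apply: le_trans h.
Qed.

(** Inside the small square the flux gives 16 c. Outside it V stays bounded and the denominator is
    at least m^4, so the explicit factor e makes the density O(e), with a constant that depends on m
    but not on e. *)
Lemma density_b_integral (phi : plane -> R) M C m (c : R) :
  0 < m < 1 -> m <= M -> continuous phi -> 0 <= C -> (forall x, box M x -> `|phi x| <= C) ->
  (forall y : R, - ln (3 * m ^+ 2) <= y -> r0 < y /\ 0 <= V y <= c) ->
  exists C2 : R, forall e, 0 < e <= m ^+ 2 ->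
  (`|\int[mu2]_(x in box M) (density_b V e x * phi x)%R%:E| <= (C * (16 * c) + C2 * e)%R%:E)%E.
Proof.
move=> /andP[m0 m1] mM cphi C0 phiC hm.
have m20 : 0 < m ^+ 2 by rewrite exprn_gt0.
have m21 : m ^+ 2 <= 1 by rewrite expr_le1 ?ltW.
have [Cv [Cv0 hV]] : exists Cv, 0 <= Cv /\ forall t : R, - ln (2 * M ^+ 2 + 1) <= t <= - ln (m ^+ 2) -> `|V t| <= Cv.
  have /compact_bounded/pinfty_ex_gt0[Cv Cv0 h] : compact (V @` `[- ln (2 * M ^+ 2 + 1), - ln (m ^+ 2)]).
    apply: continuous_compact; last exact: segment_compact.
    by apply: continuous_subspaceT => t; exact: is_derive_cont (dV t).
  exists Cv; split=> [|t ht]; first exact: ltW.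
  by apply: h; exists t; rewrite //= in_itv.
pose Cst := C * (4 * Cv / (m ^+ 2) ^+ 2).
exists (Cst * (2 * M * (2 * M))) => e /andP[e0 em].
have cb := cont_density_b dV e0; have ca := cont_density_a cW e0.
have cab : continuous (fun x => density_a W e x + density_b V e x).
  by move=> x; apply (@cont_add R plane); [exact: ca|exact: cb].
have cbp : continuous (fun x => density_b V e x * phi x).
  by move=> x; apply (@cont_mul R plane); [exact: cb|exact: cphi].
have cabs : continuous (fun x => `|density_b V e x * phi x|).
  by move=> x; apply: cvg_norm; exact: cbp.
have bmM : box m `<=` box M.
  move=> x; case; rewrite /= !in_itv/= => /andP[h1 h2] /andP[h3 h4].
  by split; rewrite /= in_itv/=; lra.
have mD : measurable (box M `\` box m : set mplane).
  by apply: measurableD; exact: measurable_box.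
have xe x : 0 < sqn x + e by rewrite ltr_wpDl// sqn_ge0.
apply: (@le_trans _ _ (\int[mu2]_(x in box M) `|density_b V e x * phi x|%:E)%E).
  apply: (le_trans (le_abse_integral mu2 (measurable_box M) _)); last exact: lexx.
  by apply: measurable_cont_set; [exact: measurable_box|exact: cbp].
have -> : box M = box m `|` (box M `\` box m) by rewrite setUIr setUCr setIT; exact/esym/setUidr.
rewrite ge0_integral_setU; [|exact: measurable_box|exact: mD| | |]; last 3 first.
- by apply: measurable_cont_set => //; apply: measurableU => //; exact: measurable_box.
- by move=> x _; rewrite lee_fin.
- by apply/disj_setPS => x [? []].
rewrite EFinD; apply: leeD.
  apply: (@le_trans _ _ (\int[mu2]_(x in box m) (C%:E * (density_a W e x + density_b V e x)%R%:E))%E).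
    apply: ge0_le_integral.
    + exact: measurable_box.
    + by move=> x _; rewrite lee_fin.
    + by apply: measurable_cont_set => //; exact: measurable_box.
    + apply: (@measurable_cont_set _ (fun x => C * (density_a W e x + density_b V e x))).
        exact: measurable_box.
      by move=> x; apply (@cont_mul R plane); [exact: cont_cst|exact: cab].
    move=> x bx; have /hm[rt /andP[V0 _]] : - ln (3 * m ^+ 2) <= regtau e x.
      by apply: regtau_ge => //; have := sqn_box bx; lra.
    have a0 : 0 <= density_a W e x.
      rewrite density_aE//; have [/f_gt0/ltW fU _ _] := UV_gt0 rt.
      by rewrite mulr_ge0// divr_ge0 ?sqn_ge0// ltW.
    have b0 : 0 <= density_b V e x.
      apply: divr_ge0; last exact: sqr_ge0.
      by apply: mulr_ge0; [exact: mulr_ge0|exact: ltW].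
    rewrite -EFinM lee_fin normrM (ger0_norm b0) mulrC; apply: ler_pM => //.
      by apply: phiC; exact: bmM.
    by rewrite lerDr.
  rewrite integralZl; [|exact: measurable_box|exact: integrable_box].
  rewrite EFinM; apply: lee_wpmul2l; first by rewrite lee_fin.
  by apply: flux_bound => //; [rewrite e0|move=> y /hm[]].
apply: (@le_trans _ _ (\int[mu2]_(x in box M `\` box m) (Cst * e)%:E)%E).
  apply: ge0_le_integral.
  - exact: mD.
  - by move=> x _; rewrite lee_fin.
  - by apply: measurable_cont_set.
  - exact: measurable_cst.
  - move=> x [bx nbx]; rewrite lee_fin.
    have mx := notbox_sqn (ltW m0) nbx; have xM := sqn_box bx.
    have /hV hv : - ln (2 * M ^+ 2 + 1) <= regtau e x <= - ln (m ^+ 2).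
      rewrite regtau_ge//=; last by lra.
      by rewrite lerN2 ler_ln ?posrE//; lra.
    rewrite normrM mulrC /Cst -mulrA; apply: ler_pM => //; first exact: phiC.
    have -> : `|density_b V e x| = 4 * `|V (regtau e x)| * e / (sqn x + e) ^+ 2.
      by rewrite /density_b !normrM normfV (gtr0_norm e0) (gtr0_norm (exprn_gt0 2 (xe x))) (@gtr0_norm _ 4).
    have -> : 4 * Cv / (m ^+ 2) ^+ 2 * e = (4 * Cv * e) * ((m ^+ 2) ^+ 2)^-1 by rewrite mulrAC.
    have e4 : 0 <= 4 * e by lra.
    apply: ler_pM.
    + by rewrite -mulrA mulrCA mulr_ge0.
    + by rewrite invr_ge0 sqr_ge0.
    + by rewrite -!mulrA mulrCA [leRHS]mulrCA ler_wpM2r.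
    + rewrite lef_pV2 ?posrE ?exprn_gt0// ler_sqr ?nnegrE ?ltW//; lra.
rewrite integral_cst// [leRHS](_ : _ = (Cst * e)%:E * mu2 (box M))%E; last first.
  by rewrite lebesgue2_box -?EFinM; [congr (_%:E); ring|lra].
apply: lee_wpmul2l.
  by rewrite lee_fin mulr_ge0 ?(ltW e0)// mulr_ge0// divr_ge0 ?sqr_ge0// mulr_ge0.
by apply: le_measure; rewrite ?inE//; exact: measurable_box.
Qed.

(** The continuous function 1 / (E - |x|^2) is bounded on K. The gap leaves room for the
    regularisation: for e <= a the support of the test function stays where [regtau] exceeds r0. *)
Lemma compact_sqn_gap (K : set plane) (E : R) : compact K -> (forall x, K x -> sqn x < E) ->
  exists a : R, 0 < a /\ forall x, K x -> sqn x + a < E.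
Proof.
move=> cK KE.
have /compact_bounded/pinfty_ex_gt0[C C0 hC] : compact ((fun x => (E - sqn x)^-1) @` K).
  apply: continuous_compact => //; apply: continuous_in_subspaceT => x /set_mem /KE xE.
  apply (@cont_inv R plane); first by rewrite subr_eq0 gt_eqF.
  by apply (@cont_sub R plane); [exact: cont_cst|exact: cont_sqn].
exists (C^-1 / 2); split; first by rewrite divr_gt0 ?invr_gt0.
move=> x Kx; have d0 : 0 < E - sqn x by rewrite subr_gt0 KE.
have : `|(E - sqn x)^-1| <= C by apply: hC; exists x.
rewrite gtr0_norm ?invr_gt0// => h.
have : C^-1 <= E - sqn x by rewrite -[leRHS]invrK lef_pV2 ?posrE ?invr_gt0.
have : 0 < C^-1 by rewrite invr_gt0.
lra.
Qed.

Lemma bounded_support (K : set plane) (k : plane -> R) : compact K -> continuous k ->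
  (forall x, ~ K x -> k x = 0) -> exists C : R, 0 <= C /\ forall x, `|k x| <= C.
Proof.
move=> cK ck k0; have /compact_bounded/pinfty_ex_gt0[C C0 hC] : compact (k @` K).
  by apply: continuous_compact => //; exact: continuous_subspaceT.
exists C; split=> [|x]; first exact: ltW.
by have [Kx|/k0->] := pselect (K x); [apply: hC; exists x|rewrite normr0 ltW].
Qed.

Lemma integrable_mul_bounded (w k : plane -> R) (C : R) :
  mu2.-integrable (P : set mplane) (EFin \o w) -> continuous k -> (forall x, `|k x| <= C) ->
  mu2.-integrable (P : set mplane) (fun x => (w x * k x)%:E).
Proof.
move=> iw ck kC; have iC := integrableZl measurable_P C iw.
apply: (le_integrable measurable_P _ _ iC).
  apply/measurable_EFinP; apply: measurable_funM.
    by apply/measurable_EFinP; exact: measurable_int iw.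
  by apply/measurable_EFinP; apply: measurable_cont_set => //; exact: measurable_P.
move=> x Px; rewrite /= lee_fin !normrM mulrC ler_wpM2r//.
by apply: le_trans (kC x) _; exact: ler_norm.
Qed.

Lemma scaled_half (C d : R) : 0 <= C -> 0 < d -> C * (16 * (d / (32 * (C + 1)))) <= d / 2.
Proof.
move=> C0 d0; have C1 : 0 < C + 1 by rewrite ltr_wpDl.
have -> : C * (16 * (d / (32 * (C + 1)))) = d / 2 * (C / (C + 1)) by field; rewrite gt_eqF.
by rewrite ler_piMr ?divr_ge0 ?(ltW d0)// ler_pdivrMr// mul1r lerDl.
Qed.

Lemma weak_identity phi : (forall n, Cn n setT phi) ->
  compact (closure [set x | phi x != 0]) -> closure [set x | phi x != 0] `<=` disk r ->
  [/\ mu2.-integrable (P : set mplane) (fun x => (u x * laplacian phi x)%:E),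
      mu2.-integrable (P : set mplane) (fun x => (f (u x) * phi x)%:E) &
   (- (\int[mu2]_(x in P) (u x * laplacian phi x)%:E) =
    \int[mu2]_(x in P) (f (u x) * phi x)%:E)%E].
Proof.
move=> sphi; set K := closure _ => cK Kr.
have [a [a0 ha]] : exists a, 0 < a /\ forall x, K x -> sqn x + a < expR (- r0).
  by apply: compact_sqn_gap => // x /Kr; rewrite /disk/= sqn_enorm_lt ?expR_ge0// expR_half_sqr.
have phi0 x : ~ K x -> phi x = 0 := @test0 R phi x.
have lap0 x : ~ K x -> laplacian phi x = 0 := @test_laplacian0 R phi x.
have cphi := test_cont sphi; have clap := test_cont_laplacian sphi.
pose M := r + 1; have r_gt0 : 0 < r by exact: expR_gt0.
have M0 : 0 < M by rewrite /M; lra.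
have KM x : K x -> box M x.
  move=> /Kr xr; apply: disk_box; rewrite /disk/= in xr *.
  by rewrite (lt_trans xr)// ltrDl.
have KM2 x : K x -> `|x.1| < M /\ `|x.2| < M.
  by move=> /Kr/disk_box[]; rewrite /= !in_itv/= -!ler_norml => h1 h2; rewrite /M; split; lra.
have [C1 [C10 hC1]] := bounded_support cK cphi phi0.
have [C2 [C20 hC2]] := bounded_support cK clap lap0.
pose C := C1 + C2; have C0 : 0 <= C by rewrite addr_ge0.
have hp x : `|phi x| <= C by rewrite (le_trans (hC1 x))// lerDl.
have hl x : `|laplacian phi x| <= C by rewrite (le_trans (hC2 x))// lerDr.
pose en := epsn a; have en0 n : 0 < en n <= a by exact: epsn_bounds.
(* [density_b] is kept apart: u and f(u) dominate the other two terms, whereas [density_b] is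
   estimated through its integral. *)
pose h n x := regsol U (en n) x * laplacian phi x + density_a W (en n) x * phi x.
have ch n : continuous (h n).
  have /andP[e0 _] := en0 n; move=> x; apply (@cont_add R plane); apply (@cont_mul R plane).
  - by apply: cont_regsol => //; exact: regdomT.
  - exact: clap.
  - exact: cont_density_a.
  - exact: cphi.
have mu0 : mu2 [set (0 : plane)] = 0%E := lebesgue2_set1 0.
(* Outside P, apart from the origin, the points of the square miss the support of phi, and the
   origin is a null set. *)
have hP n : (\int[mu2]_(x in P) (h n x)%:E = \int[mu2]_(x in box M) (h n x)%:E)%E.
  transitivity (\int[mu2]_(x in pbox M) (h n x)%:E)%E; last first.
    apply: esym; apply: negligible_integral; last exact: mu0.
    - exact: measurable_set1_plane.
    - exact: measurable_box.
    - exact: integrable_box.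
  rewrite [LHS]integral_mkcond [RHS]integral_mkcond; apply: eq_integral => x _; rewrite /patch.
  case: ifPn => [/set_mem Px|nP].
    rewrite mem_set//; split.
      by move/punctured_disk_subset : Px => xr; apply: disk_box; rewrite /disk/= in xr *; rewrite (lt_trans xr)// ltrDl.
    move=> x0; have [] := (punctured_disk_regtau x).1 Px.
    by rewrite x0 /sqn/= expr0n/= addr0 ltxx.
  case: ifPn => // /set_mem bx.
  have nK : ~ K x.
    move=> Kx; move/negP : nP; apply; apply: mem_set.
    rewrite /punctured_disk/= enorm_gt0 (pbox_sqn bx)/=; exact: Kr.
  by rewrite /h phi0// lap0// !mulr0 addr0.
have hb n : (\int[mu2]_(x in P) (h n x)%:E =
    - \int[mu2]_(x in box M) (density_b V (en n) x * phi x)%R%:E)%E.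
  have /andP[e0 _] := en0 n.
  have cb : continuous (fun x => density_b V (en n) x * phi x).
    by move=> x; apply (@cont_mul R plane); [exact: cont_density_b|exact: cphi].
  have ib := integrable_box M0 cb.
  have := green_box dU dV cW e0 M0 sphi; move=> /(_ KM2).
  have -> : (\int[mu2]_(x in box M) (regsol U (en n) x * laplacian phi x +
      (density_a W (en n) x + density_b V (en n) x) * phi x)%R%:E =
      \int[mu2]_(x in box M) ((h n x)%:E + (density_b V (en n) x * phi x)%R%:E))%E.
    by apply: eq_integral => x _; rewrite -EFinD /h; congr (_%:E); ring.
  rewrite integralD; [|exact: measurable_box|exact: integrable_box|exact: ib].
  have f1 := integrable_fin_num (measurable_box M) (integrable_box M0 (ch n)).
  have f2 := integrable_fin_num (measurable_box M) ib.
  rewrite hP; rewrite -(fineK f1) -(fineK f2) -EFinD -EFinN => -[E]; congr (_%:E); lra.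
pose g x : \bar R := (C * (u x + f (u x)))%:E.
have iP : mu2.-integrable (P : set mplane) g.
  have i1 := integrableD measurable_P integrable_usol integrable_fusol.
  have i2 := integrableZl measurable_P C i1.
  exact: i2.
have hdom n x : P x -> `|h n x| <= C * (u x + f (u x)).
  move=> Px; have uf := usol_gt0 Px; have fu := f_gt0 uf.
  have [Kx|/[dup]/phi0 p0 /lap0 l0] := pselect (K x); last first.
    by rewrite /h p0 l0 !mulr0 addr0 normr0 mulr_ge0// addr_ge0 ?ltW.
  have /andP[e0 ea] := en0 n; have [x0 _] := (punctured_disk_regtau x).1 Px.
  have rt : r0 < regtau (en n) x.
    by rewrite regtau_gt; [have := ha x Kx|]; lra.
  have [/andP[U0 Ux] /andP[A0 Ax] _] := density_bounds (ltW e0) x0 rt.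
  rewrite /h [leRHS]mulrDr; apply: (le_trans (ler_normD _ _)); apply: lerD.
    by rewrite normrM (gtr0_norm U0) mulrC; apply: ler_pM => //; exact: ltW.
  by rewrite normrM (ger0_norm A0) mulrC; apply: ler_pM.
have cvh : (\int[mu2]_(x in P) (h n x)%:E)%E @[n --> \oo] -->
    (\int[mu2]_(x in P) (u x * laplacian phi x + f (u x) * phi x)%R%:E)%E.
  have mh n : measurable_fun (P : set mplane) (fun x => (h n x)%:E : \bar R).
    by apply: measurable_cont_set; [exact: measurable_P|exact: ch].
  have lh x : (P : set mplane) x -> (h n x)%:E @[n --> \oo] --> (u x * laplacian phi x + f (u x) * phi x)%:E.
    move=> Px; have [x0 _] := (punctured_disk_regtau x).1 Px.
    apply: cvg_EFin; first by apply: nearW.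
    apply: cvgD; apply: cvgM; try exact: cvg_cst.
      by apply: (@cvg_epsn (fun e => regsol U e x)); exact: cont_regsol_eps.
    rewrite -density_a0//.
    by apply: (@cvg_epsn (fun e => density_a W e x)); exact: cont_density_a_eps.
  have bh n x : (P : set mplane) x -> (`|(h n x)%:E| <= g x)%E.
    by move=> Px; rewrite /g lee_fin hdom.
  have fh x : (P : set mplane) x -> g x \is a fin_num by [].
  exact: (@dominated_cvg _ mplane R mu2 P measurable_P _ _ _ mh lh fh iP bh).
have i1 := integrable_mul_bounded integrable_usol clap hl.
have i2 := integrable_mul_bounded integrable_fusol cphi hp.
have fL : (\int[mu2]_(x in P) (u x * laplacian phi x + f (u x) * phi x)%R%:E)%E \is a fin_num.
  have i12 := integrableD measurable_P i1 i2.
  have i12' : mu2.-integrable (P : set mplane) (fun x => (u x * laplacian phi x + f (u x) * phi x)%:E) := i12.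
  by have := integrable_fin_num measurable_P i12'.
set L := (\int[mu2]_(x in P) _)%E in cvh fL.
have small (d : R) : 0 < d -> (`|L| <= d%:E)%E.
  (* With this c the flux contribution C * 16 c is at most d / 2; the O(e) part takes the other half
     once n is large. *)
  move=> d0; pose c := d / (32 * (C + 1)).
  have c0 : 0 < c by rewrite divr_gt0// mulr_gt0//; lra.
  have [m1 [m10 m11 hm]] := small_box c0.
  have mM : m1 <= M by rewrite /M; lra.
  have [C3 hC3] := @density_b_integral phi M C m1 c (introT andP (conj m10 m11)) mM cphi C0 (fun x _ => hp x) hm.
  have m20 : 0 < m1 ^+ 2 by rewrite exprn_gt0.
  have cva : (`|\int[mu2]_(x in P) (h n x)%:E|)%E @[n --> \oo] --> `|L|%E by exact: cvg_abse.
  rewrite -(cvg_lim _ cva)//; apply: lime_le; first by apply/cvg_ex; exists `|L|%E.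
  have cC3 : C3 * en n @[n --> \oo] --> 0.
    by rewrite -(mulr0 C3); apply: cvgM; [exact: cvg_cst|exact: epsn_cvg].
  have d2 : 0 < d / 2 by rewrite divr_gt0.
  move/cvgrPdist_lt : cC3 => /(_ _ d2) n1; have /cvgrPdist_lt/(_ _ m20) n2 := epsn_cvg a.
  near=> n; rewrite hb abseN; apply: (@le_trans _ _ (C * (16 * c) + C3 * en n)%:E).
    apply: hC3; have /andP[e0 _] := en0 n; rewrite e0/=.
    have : `|0 - en n| < m1 ^+ 2 by near: n.
    by rewrite sub0r normrN gtr0_norm// => /ltW.
  rewrite lee_fin; have : `|0 - C3 * en n| < d / 2 by near: n.
  rewrite sub0r normrN => /ltr_normlW hn.
  have hc : C * (16 * c) <= d / 2 by exact: scaled_half.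
  by rewrite [leRHS](splitr d) lerD// ltW.
split=> //; have L0 : L = 0%E.
  move: small; rewrite -(fineK fL) => small; congr (_%:E); apply/eqP; rewrite -normr_eq0.
  rewrite eq_le normr_ge0 andbT; apply/ler_addgt0Pr => d d0; rewrite add0r.
  by have := small d d0; rewrite lee_fin.
have E : L = (\int[mu2]_(x in P) (u x * laplacian phi x)%:E + \int[mu2]_(x in P) (f (u x) * phi x)%:E)%E.
  rewrite -integralD; [|exact: measurable_P|exact: i1|exact: i2].
  by apply: eq_integral => x _; rewrite EFinD.
move: E; rewrite L0 -(fineK (integrable_fin_num measurable_P i1)) -(fineK (integrable_fin_num measurable_P i2)).
by rewrite -EFinN -EFinD => -[E]; congr (_%:E); lra.
Unshelve. all: by end_near. Qed.

Lemma punctured_disk0 : ~ P 0.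
Proof. by rewrite punctured_disk_regtau /sqn/= expr0n/= addr0 ltxx => -[]. Qed.

Lemma punctured_diskE : disk r `\` [set (0 : plane)] = P.
Proof.
rewrite eqEsubset; split=> x.
  move=> [xr x0]; rewrite /punctured_disk/= enorm_gt0 sqn_gt0//; exact/eqP.
by move=> Px; split; [exact: punctured_disk_subset|move=> x0; apply: punctured_disk0; rewrite -x0].
Qed.

Lemma disk_setU : disk r = P `|` [set (0 : plane)].
Proof.
rewrite -punctured_diskE eqEsubset; split=> x.
  by move=> xr; have [x0|x0] := pselect (x = 0); [right|left].
by move=> [[]//|->]; rewrite /disk/= sqn_enorm_lt ?expR_ge0// /sqn/= expr0n/= addr0 exprn_gt0 ?expR_gt0.
Qed.

Lemma measurable_disk : measurable (disk r : set mplane).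
Proof. by rewrite disk_setU; apply: measurableU; [exact: measurable_P|exact: measurable_set1_plane]. Qed.

(** The value of w at the origin, where the singular solution has no meaningful one, is irrelevant
    because a point is a null set. *)
Lemma integrable_disk (w : plane -> R) : mu2.-integrable (P : set mplane) (EFin \o w) ->
  mu2.-integrable (disk r : set mplane) (EFin \o w).
Proof.
move=> iw; apply/(negligible_integrable (measurable_set1_plane 0)).
- exact: measurable_disk.
- have -> : disk r = P `|` [set 0] :> set mplane by exact: disk_setU.
  apply/measurable_funU; [exact: measurable_P|exact: measurable_set1_plane|].
  by split; [exact: measurable_int iw|exact: measurable_fun_set1].
- exact: lebesgue2_set1.
- have -> : disk r `\` [set 0] = P :> set mplane by exact: punctured_diskE.
  exact: iw.
Qed.

Lemma integral_disk (w : plane -> R) : mu2.-integrable (P : set mplane) (EFin \o w) ->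
  (\int[mu2]_(x in disk r) (w x)%:E = \int[mu2]_(x in P) (w x)%:E)%E.
Proof.
move=> iw; rewrite -punctured_diskE; apply: negligible_integral.
- exact: measurable_set1_plane.
- exact: measurable_disk.
- exact: integrable_disk.
- exact: lebesgue2_set1.
Qed.

Lemma weak_solution : distributional_solution f (disk r) u.
Proof.
split.
- move=> K cK Kr; apply: (integrableS measurable_disk _ Kr); first exact: measurable_compact_plane.
  exact: integrable_disk integrable_usol.
- move=> K cK Kr; apply: (integrableS measurable_disk _ Kr); first exact: measurable_compact_plane.
  exact: integrable_disk integrable_fusol.
- move=> phi [sphi cK Kr]; have [i1 i2 E] := weak_identity sphi cK Kr.
  by rewrite (integral_disk i1) (integral_disk i2).
Qed.

End WeakSolution.

(** * Reduction to the variable log(1/|x|^2) *)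

Section PolarReduction.
Variable R : realType.
Local Notation plane := (R * R)%type.
Implicit Types (x y : plane) (s B : R) (f : R -> R).

Lemma ln_enormV x : 0 < sqn x -> ln (enorm x ^+ 2)^-1 = regtau 0 x.
Proof. by move=> x0; rewrite enorm_sqr lnV ?posrE// /regtau addr0. Qed.

Lemma ln_enorm x : 0 < sqn x -> - ln (enorm x) = regtau 0 x / 2.
Proof.
move=> x0; have e0 : 0 < enorm x by rewrite enorm_gt0.
by rewrite /regtau addr0 -enorm_sqr expr2 lnM ?posrE//; field.
Qed.

Lemma utilde_regtau f B x : 1 <= B -> 0 < sqn x -> 0 < regtau 0 x ->
  utilde f B x = usigma f B (regtau 0 x).
Proof.
move=> B1 x0 t0; have [E _ _ _ _ _ _] := model_specP B1 t0.
by rewrite /utilde /usigma -E /model_v ln_enormV.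
Qed.

Lemma Rem_regtau f B x : 1 <= B -> 0 < sqn x -> 0 < regtau 0 x ->
  Rem1 f B x + Rem2 f B x = rem1 f B (regtau 0 x) + rem2 f B (regtau 0 x).
Proof.
move=> B1 x0 t0; rewrite /Rem1 /Rem2 (utilde_regtau f B1 x0 t0).
by rewrite /rem1 /rem2 /model_v ln_enormV.
Qed.

(** A point with log(1/|x|^2) = s, through which hypotheses and suprema over x are read as
    statements about s. *)
Definition axis_point s : plane := (expR (- (s / 2)), 0).

Lemma sqn_axis_point s : sqn (axis_point s) = expR (- s).
Proof. by rewrite /sqn /axis_point /= expr0n addr0 expR_half_sqr. Qed.

Lemma regtau_axis_point s : regtau 0 (axis_point s) = s.
Proof. by rewrite /regtau addr0 sqn_axis_point expRK opprK. Qed.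

Lemma Remsup_regtau f B x : 1 <= B -> 0 < sqn x -> 0 < regtau 0 x ->
  Remsup f B x = remsup f B (regtau 0 x).
Proof.
move=> B1 x0 t0; congr sup; rewrite eqEsubset; split=> z [].
  move=> y /andP[]; rewrite enorm_gt0 => y0 yx <-.
  have ty : regtau 0 x <= regtau 0 y.
    rewrite /regtau !addr0 lerN2 ler_ln ?posrE// -!enorm_sqr.
    by rewrite ler_sqr ?nnegrE ?sqrtr_ge0.
  by exists (regtau 0 y); [exact: ty|exact: (esym (Rem_regtau f B1 y0 (lt_le_trans t0 ty)))].
move=> t tx <-; have tp : 0 < t by exact: lt_le_trans tx.
have a0 : 0 < sqn (axis_point t) by rewrite sqn_axis_point expR_gt0.
have xt : expR (- t) <= sqn x.
  have h : - t <= ln (sqn x) by rewrite lerNl; move: tx; rewrite /= /regtau addr0.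
  rewrite -ler_expR in h; apply: (le_trans h); by rewrite lnK.
have ax : 0 < enorm (axis_point t) <= enorm x.
  by rewrite enorm_gt0 a0 -ler_sqr ?nnegrE ?sqrtr_ge0// !enorm_sqr sqn_axis_point.
have ap : 0 < regtau 0 (axis_point t) by rewrite regtau_axis_point.
have E : Rem1 f B (axis_point t) + Rem2 f B (axis_point t) = rem1 f B t + rem2 f B t.
  by apply: (etrans (Rem_regtau f B1 a0 ap)); rewrite regtau_axis_point.
by exists (axis_point t); [exact: ax|exact: E].
Qed.

Lemma near_regtau_ge (l : R) :
  \forall x \near (0 : plane)^', 0 < sqn x /\ l <= regtau 0 x.
Proof.
have c := @cont_sqn R 0; have l0 : 0 < expR (- l) by exact: expR_gt0.
have s0 : sqn (0 : plane) = 0 by rewrite /sqn/= expr0n/= addr0.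
move/cvgrPdist_lt : c => /(_ _ l0); rewrite s0 => n0.
rewrite near_withinE; move: n0; apply: filterS => x; rewrite sub0r normrN => xl x0.
have xp : 0 < sqn x by exact: sqn_gt0.
rewrite gtr0_norm// in xl; split=> //.
by rewrite /regtau addr0 lerNr -[leRHS]expRK ler_ln ?posrE// ltW.
Qed.

Lemma rem_small f B : 1 <= B ->
  Num.sqrt (- ln (enorm x)) * (Rem1 f B x + Rem2 f B x) @[x --> (0 : plane)^'] --> (0 : R) ->
  forall e : R, 0 < e -> exists m : R, forall s, m <= s ->
    Num.sqrt s * (rem1 f B s + rem2 f B s) <= e.
Proof.
move=> B1 hR e e0; have e2 : 0 < e / 2 by rewrite divr_gt0.
move/cvgrPdist_lt : hR => /(_ _ e2); rewrite near_withinE => /nbhs_ballP[d /= d0 hd].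
exists (Num.max 1 (1 - 2 * ln d)) => s; rewrite ge_max => /andP[s1 sd].
have a0 : 0 < sqn (axis_point s) by rewrite sqn_axis_point expR_gt0.
have sp : 0 < s by lra.
have an0 : axis_point s != 0.
  by apply/negP => /eqP h; move: a0; rewrite h /sqn/= expr0n/= addr0 ltxx.
have ba : ball (0 : plane) d (axis_point s).
  split; rewrite /ball/= sub0r normrN; last by rewrite normr0.
  by rewrite gtr0_norm ?expR_gt0// -[ltRHS]lnK ?posrE// ltr_expR; lra.
have ap : 0 < regtau 0 (axis_point s) by rewrite regtau_axis_point.
have E : Rem1 f B (axis_point s) + Rem2 f B (axis_point s) = rem1 f B s + rem2 f B s.
  by apply: (etrans (Rem_regtau f B1 a0 ap)); rewrite regtau_axis_point.
have bound (p q Z Z' : R) : `|0 - p * Z| < e / 2 -> p = q -> Z = Z' -> q * Z' < e / 2.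
  by move=> h <- <-; move: h; rewrite sub0r normrN => /ltr_normlW.
have p_eq : Num.sqrt (- ln (enorm (axis_point s))) = Num.sqrt (s / 2).
  by rewrite (ln_enorm a0) regtau_axis_point.
have h := bound _ _ _ _ (hd _ ba an0) p_eq E.
clear E.
have r0 : 0 <= rem1 f B s + rem2 f B s by apply: addr_ge0; exact: normr_ge0.
(* The hypothesis has -log|x| = s / 2 under the root; the factor 2 absorbs sqrt 2 and explains the e
   / 2 above. *)
have s2 : Num.sqrt s <= 2 * Num.sqrt (s / 2).
  rewrite -ler_sqr ?nnegrE ?sqrtr_ge0 ?mulr_ge0// exprMn !sqr_sqrtr; lra.
by apply: (le_trans (ler_wpM2r r0 s2)); rewrite -mulrA; lra.
Qed.

End PolarReduction.

Unset Implicit Arguments.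

Theorem theorem2p2 (R : realType) (f : R -> R) (B : R)
    (hf1 : hyp_f1 f) (hf2 : hyp_f2 f B)
    (hR : Num.sqrt (- ln (enorm x)) * (Rem1 f B x + Rem2 f B x)
            @[x --> (0 : R * R)^'] --> (0 : R))
    (hC1 : C1_ge0 f)
    (hpos : forall s : R, 0 < s ->
       [/\ 0 < f s, (tailint f s < +oo)%E & 0 < derive1 f s]) :
  exists (r : R) (u : R * R -> R),
    [/\ 0 < r,
        (fun x => u x - utilde f B x) =O_ ((0 : R * R)^')
          (fun x => f (utilde f B x) * Fint f (utilde f B x) * Remsup f B x),
        classical_dirichlet_solution f r u &
        distributional_solution f (disk r) u].
Proof.
have [_ _ B1] := hf2.
have f_gt0 s : 0 < s -> 0 < f s by move/hpos=> [].
have f_tail s : 0 < s -> (tailint f s < +oo)%E by move/hpos=> [].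
have f_d s : 0 < s -> 0 < derive1 f s by move/hpos=> [].
have f_cont s : 0 < s -> {for s, continuous f} by exact: C1_cont.
have f_incr s t : 0 < s -> s <= t -> f s <= f t by exact: C1_incr.
have [U [V [W [r0 [K [y3 [U0 dUV cW hpost [hV hU]]]]]]]] :=
  radial_solution hf1 B1 hC1 hpos (rem_small B1 hR).
have dU (t : R) : is_derive t 1 U (V t) by have [] := dUV t.
have dV (t : R) : is_derive t 1 V (W t) by have [] := dUV t.
have regP (x : R * R) : 0 < sqn x -> regdom 0 x by rewrite /regdom/= addr0.
(* On the circle of this radius log(1/|x|^2) = r0, the zero of U. *)
exists (expR (- (r0 / 2))), (regsol U 0); split.
- exact: expR_gt0.
(* The constant has to be positive, and nothing is known about the sign of K here. *)
- apply/eqO_exP; exists (`|K| + 1); first by rewrite ltr_wpDl.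
  have : \forall x \near (0 : R * R)^', 0 < sqn x /\ Num.max 1 y3 <= regtau 0 x by exact: near_regtau_ge.
  apply: filterS => x [x0]; rewrite ge_max => /andP[t1 t3].
  have tp : 0 < regtau 0 x by rewrite (lt_le_trans _ t1).
  have [_ _ FE h] := hU _ t3.
  rewrite (utilde_regtau f B1 x0 tp) (Remsup_regtau f B1 x0 tp) FE; apply: (le_trans h).
  apply: (le_trans (ler_norm _)); rewrite normrM ler_wpM2r// lerDl//.
- split.
  + have sub : punctured_disk (expR (- (r0 / 2))) `<=` @regdom R 0.
      by move=> x /punctured_disk_regtau[x0 _]; exact: regP.
    exact: (@Cn_subset R 2 _ _ _ sub (regsol_C2 0 dU dV cW)).
  + move=> x /punctured_disk_regtau[x0 rt]; have [U0' _ Wx] := hpost _ rt; split; first exact: ltW.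
    rewrite (laplacian_regsol dU dV (regP x x0)) Wx expR_regtau ?addr0//.
    by rewrite /regsol; field; rewrite gt_eqF.
  + apply: continuous_in_subspaceT => x /set_mem /andP[]; rewrite enorm_gt0 => x0 _.
    by apply: (cont_regsol dU); exact: regP.
  + move=> x xr; rewrite /regsol /regtau addr0 -enorm_sqr xr expR_half_sqr expRK opprK.
    exact: U0.
- exact: (weak_solution dU dV cW hpost hV f_gt0 f_tail f_cont f_incr).
Qed.
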